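(* Let $\mathfrak g=\oplus_{\alpha\in\Gamma}\mathfrak g_\alpha$ be a restricted Lie color algebra over $\mathbf F$ and let $\chi=\{\chi_\alpha\}_{\alpha\in\Gamma^+}$ be a $p$-character of $\mathfrak g$; for each $\alpha\in\Gamma^+$ with $\chi_\alpha\in\mathscr F_\alpha$ fix a representative $(\xi,c)$ of $\chi_\alpha=[\xi,c]$. Let $\{e_i\}_{i\in I}$ be a totally ordered homogeneous basis of $\mathfrak g^+$ which contains each of these elements $\xi$, let $\{f_j\}_{j\in M}$ be a totally ordered homogeneous basis of $\mathfrak g^-$, and let $J\subseteq I$ be the set of those $i$ for which $e_i$ is one of the elements $\xi$. Let $\sigma:\mathfrak g\to U(\mathfrak g)/I_\chi$ be the canonical map. Then the pair $(U(\mathfrak g)/I_\chi,\sigma)$ is the $\chi$-reduced universal enveloping algebra of $\mathfrak g$, and the elements $$\sigma(f)^{\delta}\sigma(e)^{n}=\prod_{j\in M}\sigma(f_j)^{\delta(j)}\prod_{i\in I}\sigma(e_i)^{n(i)},$$ where $\delta:M\to\{0,1\}$ and $n:I\to\mathbf N$ have finite support, $0\le n(i)<p$ for $i\in I\setminus J$, and $0\le n(i)<ps$ for $i\in J$ (with $s$ the order of $p\alpha$ when $e_i\in\mathfrak g_\alpha$), form a basis of $U(\mathfrak g)/I_\chi$.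
   Context: $\mathbf F$ is an algebraically closed field of characteristic $p>3$, $\mathbf N=\{0,1,2,\dots\}$. $\Gamma$ is an abelian group (possibly infinite, zero element $\bar 0$) with a bicharacter $(,):\Gamma\times\Gamma\to\mathbf F^\times$: $(\alpha,\beta)(\beta,\alpha)=1$, $(\alpha,\beta+\gamma)=(\alpha,\beta)(\alpha,\gamma)$, $(\alpha+\beta,\gamma)=(\alpha,\gamma)(\beta,\gamma)$. $\Gamma^\pm=\{\gamma\in\Gamma:(\gamma,\gamma)=\pm1\}$. A Lie color algebra is a $\Gamma$-graded $\mathbf F$-space $\mathfrak g=\oplus_\alpha\mathfrak g_\alpha$ with a bilinear bracket with $[\mathfrak g_\alpha,\mathfrak g_\beta]\subseteq\mathfrak g_{\alpha+\beta}$, $[y,x]=-(\beta,\alpha)[x,y]$ and $(\gamma,\alpha)[x,[y,z]]+(\alpha,\beta)[y,[z,x]]+(\beta,\gamma)[z,[x,y]]=0$ for $x\in\mathfrak g_\alpha,y\in\mathfrak g_\beta,z\in\mathfrak g_\gamma$. $\mathfrak g^\pm=\sum_{\gamma\in\Gamma^\pm}\mathfrak g_\gamma$. It is restricted if for every $\gamma\in\Gamma^+$ there is a map $x\mapsto x^{[p]}$, $\mathfrak g_\gamma\to\mathfrak g_{p\gamma}$, with $(x+y)^{[p]}=x^{[p]}+y^{[p]}+\sum_{i=1}^{p-1}s_i(x,y)$ ($i\,s_i(x,y)$ being the coefficient of $t^{i-1}$ in $(\mathrm{ad}(tx+y))^{p-1}(x)$), $(rx)^{[p]}=r^px^{[p]}$,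 $\mathrm{ad}\,x^{[p]}=(\mathrm{ad}\,x)^p$, for $x,y\in\mathfrak g_\gamma$, $r\in\mathbf F$. $U(\mathfrak g)$ is the quotient of the tensor algebra by the ideal generated by $x\otimes y-(\alpha,\beta)y\otimes x-[x,y]$, $x\in\mathfrak g_\alpha$, $y\in\mathfrak g_\beta$. For an associative $\Gamma$-graded algebra $A$, $A^-$ is the Lie color algebra with bracket $[x,y]=xy-(\alpha,\beta)yx$, $x\in A_\alpha$, $y\in A_\beta$. Homomorphisms preserve the $\Gamma$-grading. For $\alpha\in\Gamma^+$ with $p\alpha\ne0$ of finite order $s$, $\mathscr F_\alpha$ is the set of equivalence classes $[\xi,c]$ of pairs $(\xi,c)$ with $c\in\mathfrak g_\alpha^*$, $\xi\in\mathfrak g_\alpha$, $c(\xi)=1$, under $(\xi,c)\sim(\eta,b)$ iff $c=c(\eta)b$, $b=b(\xi)c$ and $c(\eta)^s=b(\xi)^s=1$. A $p$-character of $\mathfrak g$ is a family $\chi=\{\chi_\alpha\}_{\alpha\in\Gamma^+}$ such that: $\chi_\alpha\in\mathfrak g_\alpha^*$ if $p\alpha=0$; $\chi_\alpha=0$ if $\alpha$ has infinite order; $\chi_\alpha\in\mathscr F_\alpha\cup\{0\}$ if $p\alpha\neq0$ has finite order. (When $\chi_\alpha=0$ it is regarded as the zero element of $\mathfrak g_\alpha^*$.) $I_\chi$ is the two-sided ideal of $U(\mathfrak g)$ generated by: $x^p-x^{[p]}-\chi_\alpha(x)^p\cdot1$ for $x\in\mathfrak g_\alpha$, if $\chi_\alpha\in\mathfrak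 g_\alpha^*$; and $(\xi^p-\xi^{[p]})^s-1$ and $(x^p-x^{[p]})-c(x)^p(\xi^p-\xi^{[p]})$ for $x\in\mathfrak g_\alpha$, if $\chi_\alpha=[\xi,c]\in\mathscr F_\alpha$, $s$ the order of $p\alpha$ ($\alpha$ running over $\Gamma^+$). This does not depend on the representatives. A $\chi$-reduced universal enveloping algebra is a pair $(u,\sigma)$ of an associative unital $\Gamma$-graded $\mathbf F$-algebra $u$ and a homomorphism $\sigma:\mathfrak g\to u^-$ such that: (1) for $\alpha\in\Gamma^+$ and $x\in\mathfrak g_\alpha$, $\sigma(x)^p-\sigma(x^{[p]})=\chi_\alpha(x)^p$ if $\chi_\alpha\in\mathfrak g_\alpha^*$, and $(\sigma(\xi)^p-\sigma(\xi^{[p]}))^s=1$, $\sigma(x)^p-\sigma(x^{[p]})=c(x)^p(\sigma(\xi)^p-\sigma(\xi^{[p]}))$ if $\chi_\alpha=[\xi,c]\in\mathscr F_\alpha$; (2) for every associative unital $\Gamma$-graded $\mathbf F$-algebra $A$ and every homomorphism $g:\mathfrak g\to A^-$ satisfying the condition (1) with $g$ in place of $\sigma$, there is a unique homomorphism $\tilde g:u\to A$ of $\Gamma$-graded associative algebras with $\tilde g\circ\sigma=g$. *)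

(* Defs.v *)
From HB Require Import structures.
From mathcomp Require Import all_boot all_order all_algebra finmap.
From mathcomp Require Import boolp classical_sets.
From mathcomp.multinomials Require Import monalg.

Set Implicit Arguments.
Unset Strict Implicit.
Unset Printing Implicit Defensive.

Import Order.TTheory GRing.Theory.

Local Open Scope classical_set_scope.
Local Open Scope ring_scope.

(* MathComp's [algType] excludes the zero ring. A quotient of an algebra is    *)
(* not known in advance to be nonzero, and the universal property below ranges *)
(* over all unital algebras, so nontriviality is dropped here.                 *)
HB.mixin Record Lmodule_isPzAlgebra (F : fieldType) A of GRing.Lmodule F A := {
  pzalg_one : A;
  pzalg_mul : A -> A -> A;
  pzalg_mulA : associative pzalg_mul;
  pzalg_mul1l : left_id pzalg_one pzalg_mul;
  pzalg_mul1r : right_id pzalg_one pzalg_mul;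
  pzalg_mulDl : left_distributive pzalg_mul +%R;
  pzalg_mulDr : right_distributive pzalg_mul +%R;
  pzalg_scaleAl : forall (a : F) (x y : A),
    a *: pzalg_mul x y = pzalg_mul (a *: x) y;
  pzalg_scaleAr : forall (a : F) (x y : A),
    a *: pzalg_mul x y = pzalg_mul x (a *: y)
}.

#[short(type="pzAlgType")]
HB.structure Definition PzAlgebra (F : fieldType) :=
  {A of GRing.Lmodule F A & Lmodule_isPzAlgebra F A}.

(* Hierarchy-Builder rejects a structure inheriting from both [PzRing] and     *)
(* [Lmodule] (their only join in MathComp is nontrivial), hence this instance. *)
HB.instance Definition _ (F : fieldType) (A : pzAlgType F) :=
  GRing.Zmodule_isPzRing.Build (PzAlgebra.sort A)
    pzalg_mulA pzalg_mul1l pzalg_mul1r pzalg_mulDl pzalg_mulDr.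

Section PzAlgebraTheory.
Variables (F : fieldType) (A : pzAlgType F).
Implicit Types (a : F) (x y : A).

Lemma pzscalerAl a x y : a *: (x * y) = (a *: x) * y.
Proof. exact: pzalg_scaleAl. Qed.

Lemma pzscalerAr a x y : a *: (x * y) = x * (a *: y).
Proof. exact: pzalg_scaleAr. Qed.

End PzAlgebraTheory.

Section LinearAlgebra.
Variables (F : fieldType) (V : lmodType F).

Definition is_subspace (W : set V) : Prop :=
  W 0 /\ forall (a : F) (x y : V), W x -> W y -> W (a *: x + y).

Definition lspan (S : set V) : set V :=
  [set v | forall W : set V, is_subspace W -> S `<=` W -> W v].

(* [b], restricted to the index set [D], is a basis of the subspace [W]. *)
Definition is_basis (K : choiceType) (D : set K) (b : K -> V) (W : set V) :=
  [/\ forall k, D k -> W (b k),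
      forall s : seq K, uniq s -> (forall k, k \in s -> D k) ->
        forall a : K -> F, \sum_(k <- s) a k *: b k = 0 ->
        forall k, k \in s -> a k = 0
    & forall w, W w -> exists (s : seq K) (a : K -> F),
        (forall k, k \in s -> D k) /\ w = \sum_(k <- s) a k *: b k].

End LinearAlgebra.

Section IdealQuotient.
Variables (F : fieldType) (A : pzAlgType F).

Definition is_ideal (J : set A) : Prop :=
  [/\ J 0, forall x y, J x -> J y -> J (x - y)
    & forall a x b, J x -> J (a * x * b)].

Definition ideal_gen (S : set A) : {pred A} :=
  fun x => `[< forall J : set A, is_ideal J -> S `<=` J -> J x >].

Lemma ideal_genP (S : set A) x :
  reflect (forall J : set A, is_ideal J -> S `<=` J -> J x) (x \in ideal_gen S).
Proof. exact: asboolP. Qed.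

Lemma mem_ideal_gen (S : set A) x : S x -> x \in ideal_gen S.
Proof. by move=> Sx; apply/ideal_genP => J _; apply. Qed.

Lemma ideal_gen_zmod (S : set A) : zmod_closed (ideal_gen S).
Proof.
split=> [|x y /ideal_genP Ix /ideal_genP Iy]; apply/ideal_genP => J IJ SJ.
  by case: IJ.
by case: (IJ) => _ JB _; apply: JB; [apply: Ix | apply: Iy].
Qed.

HB.instance Definition _ (S : set A) :=
  GRing.isZmodClosed.Build A (ideal_gen S) (ideal_gen_zmod S).

Lemma ideal_genM (S : set A) a x b :
  x \in ideal_gen S -> a * x * b \in ideal_gen S.
Proof.
move=> /ideal_genP Ix; apply/ideal_genP => J IJ SJ.
by case: (IJ) => _ _ JM; apply: JM; apply: Ix.
Qed.

Variable S : set A.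

Definition quot_type : Type := Quotient.quot (ideal_gen S).
HB.instance Definition _ := GRing.Zmodule.on quot_type.

Definition qpi (x : A) : quot_type :=
  (\pi_(Quotient.quot (ideal_gen S)) x)%qT.

Lemma qpi_surj (u : quot_type) : exists x, u = qpi x.
Proof. by exists (repr (u : Quotient.quot _)); rewrite /qpi reprK. Qed.

Lemma qpi_eq x y : (qpi x = qpi y) <-> (x - y \in ideal_gen S).
Proof. by rewrite Quotient.idealrBE; split=> [H|/eqP H]; [apply/eqP|]; exact: H. Qed.

Lemma qpiD x y : qpi (x + y) = qpi x + qpi y.
Proof. exact: (Quotient.pi_add (ideal_gen S)). Qed.

Let rep (u : quot_type) : A := repr (u : Quotient.quot _).
Let repK u : qpi (rep u) = u. Proof. exact: reprK. Qed.

Definition quot_one : quot_type := qpi 1.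
Definition quot_mul (u v : quot_type) : quot_type := qpi (rep u * rep v).
Definition quot_scale (a : F) (u : quot_type) : quot_type := qpi (a *: rep u).

Lemma quot_mulE x y : quot_mul (qpi x) (qpi y) = qpi (x * y).
Proof.
apply/qpi_eq; set x' := rep _; set y' := rep _.
have Dx : x' - x \in ideal_gen S by apply/qpi_eq; rewrite repK.
have Dy : y' - y \in ideal_gen S by apply/qpi_eq; rewrite repK.
have -> : x' * y' - x * y = 1 * (x' - x) * y' + x * (y' - y) * 1.
  by rewrite mul1r mulr1 mulrBl mulrBr addrA subrK.
by rewrite rpredD ?ideal_genM.
Qed.

Lemma quot_scaleE a x : quot_scale a (qpi x) = qpi (a *: x).
Proof.
apply/qpi_eq; set x' := rep _.
have Dx : x' - x \in ideal_gen S by apply/qpi_eq; rewrite repK.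
have -> : a *: x' - a *: x = (a *: (1 : A)) * (x' - x) * 1.
  by rewrite mulr1 -pzscalerAl mul1r scalerBr.
exact: ideal_genM.
Qed.

Let lift1 (P : quot_type -> Prop) : (forall x, P (qpi x)) -> forall u, P u.
Proof. by move=> H u; rewrite -(repK u). Qed.

Lemma quot_mulA : associative quot_mul.
Proof.
by elim/lift1=> x; elim/lift1=> y; elim/lift1=> z; rewrite !quot_mulE mulrA.
Qed.
Lemma quot_mul1 : left_id quot_one quot_mul.
Proof. by elim/lift1=> x; rewrite quot_mulE mul1r. Qed.
Lemma quot_mulq1 : right_id quot_one quot_mul.
Proof. by elim/lift1=> x; rewrite quot_mulE mulr1. Qed.
Lemma quot_mulDl : left_distributive quot_mul +%R.
Proof.
elim/lift1=> x; elim/lift1=> y; elim/lift1=> z.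
by rewrite -qpiD !quot_mulE -qpiD mulrDl.
Qed.
Lemma quot_mulDr : right_distributive quot_mul +%R.
Proof.
elim/lift1=> x; elim/lift1=> y; elim/lift1=> z.
by rewrite -qpiD !quot_mulE -qpiD mulrDr.
Qed.

Lemma quot_scaleA a b u : quot_scale a (quot_scale b u) = quot_scale (a * b) u.
Proof. by elim/lift1: u => x; rewrite !quot_scaleE scalerA. Qed.
Lemma quot_scale1 : left_id 1 quot_scale.
Proof. by elim/lift1=> x; rewrite quot_scaleE scale1r. Qed.
Lemma quot_scaleDr : right_distributive quot_scale +%R.
Proof.
move=> a; elim/lift1=> x; elim/lift1=> y.
by rewrite -qpiD !quot_scaleE -qpiD scalerDr.
Qed.
Lemma quot_scaleDl u : {morph quot_scale^~ u : a b / a + b}.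
Proof.
by move=> a b; elim/lift1: u => x; rewrite !quot_scaleE -qpiD scalerDl.
Qed.

HB.instance Definition _ := GRing.Zmodule_isLmodule.Build F quot_type
  quot_scaleA quot_scale1 quot_scaleDr quot_scaleDl.

Lemma quot_scaleAl (a : F) (u v : quot_type) :
  a *: quot_mul u v = quot_mul (a *: u) v.
Proof.
elim/lift1: u => x; elim/lift1: v => y.
by rewrite -![_ *: _]/(quot_scale _ _) !(quot_mulE, quot_scaleE) pzscalerAl.
Qed.
Lemma quot_scaleAr (a : F) (u v : quot_type) :
  a *: quot_mul u v = quot_mul u (a *: v).
Proof.
elim/lift1: u => x; elim/lift1: v => y.
by rewrite -![_ *: _]/(quot_scale _ _) !(quot_mulE, quot_scaleE) pzscalerAr.
Qed.

HB.instance Definition _ := Lmodule_isPzAlgebra.Build F quot_type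
  quot_mulA quot_mul1 quot_mulq1 quot_mulDl quot_mulDr
  quot_scaleAl quot_scaleAr.

Definition quot_alg : pzAlgType F := quot_type.

Definition quot_pi : A -> quot_alg := qpi.

Lemma quot_pi_surj (u : quot_alg) : exists x, u = quot_pi x.
Proof. exact: qpi_surj. Qed.

Lemma quot_pi_eq x y : (quot_pi x = quot_pi y) <-> (x - y \in ideal_gen S).
Proof. exact: qpi_eq. Qed.

Lemma quot_piD x y : quot_pi (x + y) = quot_pi x + quot_pi y.
Proof. exact: qpiD. Qed.

Lemma quot_piZ a x : quot_pi (a *: x) = a *: quot_pi x.
Proof. by rewrite -[RHS]/(quot_scale _ _) quot_scaleE. Qed.

Lemma quot_piM x y : quot_pi (x * y) = quot_pi x * quot_pi y.
Proof. by rewrite -[RHS]/(quot_mul _ _) quot_mulE. Qed.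

Lemma quot_pi1 : quot_pi 1 = 1. Proof. by []. Qed.

End IdealQuotient.

Section FreeAlgebra.
Variables (F : fieldType) (X : choiceType).

Lemma malg_scalerAl (a : F) (x y : {malg F[{fmonom X}]}) :
  a *: (x * y) = (a *: x) * y.
Proof. by rewrite scalerAl. Qed.

Lemma malg_scalerAr (a : F) (x y : {malg F[{fmonom X}]}) :
  a *: (x * y) = x * (a *: y).
Proof.
have C : x * a%:MP = a%:MP * x.
  rewrite mul_malgC malgM_def fgmulgU malgZ_def; apply/eq_bigr => /= k _.
  by rewrite mulm1 mulrC.
by rewrite -!mul_malgC mulrA -C mulrA.
Qed.

HB.instance Definition _ := Lmodule_isPzAlgebra.Build F {malg F[{fmonom X}]}
  (@mulrA _) (@mul1r _) (@mulr1 _) (@mulrDl _) (@mulrDr _)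
  malg_scalerAl malg_scalerAr.

Definition free_alg : pzAlgType F := {malg F[{fmonom X}]}.

Definition free_var (x : X) : free_alg := << fmu x >>.

End FreeAlgebra.

(* The tensor algebra of [V]: the free algebra on the underlying set of [V]    *)
(* modulo the relations making the insertion of [V] linear.                   *)
Section TensorAlgebra.
Variables (F : fieldType) (V : lmodType F).

Definition tensor_rel : set (free_alg F V) :=
  [set w | exists (a : F) (x y : V),
     w = free_var F (a *: x + y) - (a *: free_var F x + free_var F y)].

Definition tensor_alg : pzAlgType F := quot_alg tensor_rel.

Definition tensor_in (x : V) : tensor_alg := quot_pi tensor_rel (free_var F x).

End TensorAlgebra.

Section Graded.
Variables (F : fieldType) (G : zmodType).

Record bicharacter (eps : G -> G -> F) : Prop := {
  bichar_inv : forall a b, eps a b * eps b a = 1;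
  bichar_addr : forall a b c, eps a (b + c) = eps a b * eps a c;
  bichar_addl : forall a b c, eps (a + b) c = eps a c * eps b c }.

(* [V] is the direct sum of the subspaces [gr a]. *)
Record is_grading (V : lmodType F) (gr : G -> set V) : Prop := {
  grading_sub : forall a, is_subspace (gr a);
  grading_sum : forall v : V, exists (s : seq G) (x : G -> V),
    (forall a, gr a (x a)) /\ v = \sum_(a <- s) x a;
  grading_direct : forall (s : seq G) (x : G -> V),
    uniq s -> (forall a, gr a (x a)) -> \sum_(a <- s) x a = 0 ->
    forall a, a \in s -> x a = 0 }.

(* [graded_alg_one] is a consequence of the two other axioms. *)
Record is_graded_alg (A : pzAlgType F) (gr : G -> set A) : Prop := {
  graded_alg_grading : is_grading gr;
  graded_alg_one : gr 0 1;
  graded_alg_mul : forall a b x y, gr a x -> gr b y -> gr (a + b) (x * y) }.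

Definition graded_map (V W : lmodType F) (grV : G -> set V) (grW : G -> set W)
    (h : V -> W) : Prop := forall a x, grV a x -> grW a (h x).

Record is_graded_alg_hom (A B : pzAlgType F) (grA : G -> set A)
    (grB : G -> set B) (h : A -> B) : Prop := {
  alg_hom_linear : linear h;
  alg_hom_mul : {morph h : x y / x * y};
  alg_hom_one : h 1 = 1;
  alg_hom_graded : graded_map grA grB h }.

Record is_lie_color (eps : G -> G -> F) (V : lmodType F) (gr : G -> set V)
    (br : V -> V -> V) : Prop := {
  lie_grading : is_grading gr;
  lie_linear_l : forall y, linear (br^~ y);
  lie_linear_r : forall x, linear (br x);
  lie_graded : forall a b x y, gr a x -> gr b y -> gr (a + b) (br x y);
  lie_skew : forall a b x y, gr a x -> gr b y -> br y x = - (eps b a *: br x y);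
  lie_jacobi : forall a b c x y z, gr a x -> gr b y -> gr c z ->
    eps c a *: br x (br y z) + eps a b *: br y (br z x)
      + eps b c *: br z (br x y) = 0 }.

(* A homomorphism of Lie color algebras into [A^-]. The bracket of [A^-] is    *)
(* determined by its values x * y - (a,b) y * x on homogeneous elements, which *)
(* span, so preservation of the bracket is only required there.                *)
Record is_lie_hom_minus (eps : G -> G -> F) (V : lmodType F) (gr : G -> set V)
    (br : V -> V -> V) (A : pzAlgType F) (grA : G -> set A) (h : V -> A) : Prop := {
  lie_hom_linear : linear h;
  lie_hom_graded : graded_map gr grA h;
  lie_hom_bracket : forall a b x y, gr a x -> gr b y ->
    h (br x y) = h x * h y - eps a b *: (h y * h x) }.

(* g^+ for e = 1, g^- for e = -1. *)
Definition sign_part (eps : G -> G -> F) (V : lmodType F) (gr : G -> set V)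
    (e : F) : set V :=
  lspan [set x | exists2 a, eps a a = e & gr a x].

(* Order of an element; 0 encodes infinite order. *)
Definition zorder (a : G) : nat :=
  if pselect (exists n, (0 < n)%N && (a *+ n == 0)) is left h
  then ex_minn h else 0%N.

End Graded.

Section Restricted.
Variables (F : fieldType) (p : nat) (G : zmodType) (eps : G -> G -> F).
Variables (V : lmodType F) (gr : G -> set V) (br : V -> V -> V).

(* A polynomial in t with coefficients in [V] is the function giving its       *)
(* coefficients; this is the action on it of ad (t x + y).                     *)
Definition ad_txy (x y : V) (P : nat -> V) : nat -> V :=
  fun k => (if k is k'.+1 then br x (P k') else 0) + br y (P k).

Definition jacobson_s (i : nat) (x y : V) : V :=
  i%:R^-1 *:
    iter p.-1 (ad_txy x y) (fun k => if k is 0%N then x else 0) i.-1.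

(* [pp a x] is x^[p] for x of degree [a] in Gamma^+; other values are junk. *)
Record is_restricted (pp : G -> V -> V) : Prop := {
  pmap_graded : forall a x, eps a a = 1 -> gr a x -> gr (a *+ p) (pp a x);
  pmapD : forall a x y, eps a a = 1 -> gr a x -> gr a y ->
    pp a (x + y) = pp a x + pp a y + \sum_(1 <= i < p) jacobson_s i x y;
  pmapZ : forall a (r : F) x, eps a a = 1 -> gr a x ->
    pp a (r *: x) = r ^+ p *: pp a x;
  pmap_ad : forall a x, eps a a = 1 -> gr a x ->
    forall z, br (pp a x) z = iter p (br x) z }.

End Restricted.

Section PCharacter.
Variables (F : fieldType) (p : nat) (G : zmodType) (eps : G -> G -> F).
Variables (V : lmodType F) (gr : G -> set V).

(* An element of the dual of [gr a] is represented by a function on [V] which  *)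
(* is linear on [gr a]; its values elsewhere are irrelevant.                  *)
Definition is_dual (a : G) (f : V -> F) : Prop :=
  forall (r : F) (x y : V), gr a x -> gr a y -> f (r *: x + y) = r * f x + f y.

Definition is_fpair (a : G) (u : V * (V -> F)) : Prop :=
  [/\ gr a u.1, is_dual a u.2 & u.2 u.1 = 1].

Definition fpair_equiv (a : G) (u v : V * (V -> F)) : Prop :=
  let s := zorder (a *+ p) in
  [/\ forall x, gr a x -> u.2 x = u.2 v.1 * v.2 x,
      forall x, gr a x -> v.2 x = v.2 u.1 * u.2 x,
      u.2 v.1 ^+ s = 1 & v.2 u.1 ^+ s = 1].

Definition fclass (a : G) (u : V * (V -> F)) : set (V * (V -> F)) :=
  [set v | is_fpair a v /\ fpair_equiv a u v].

Definition fclasses (a : G) : set (set (V * (V -> F))) :=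
  [set C | exists2 u, is_fpair a u & C = fclass a u].

Variant pchar_value :=
  | PFunctional of (V -> F)
  | PClass of set (V * (V -> F)).

Definition is_zero_value (a : G) (v : pchar_value) : Prop :=
  exists2 f, v = PFunctional f & forall x, gr a x -> f x = 0.

Record is_pcharacter (chi : G -> pchar_value) : Prop := {
  pchar_ptorsion : forall a, eps a a = 1 -> a *+ p = 0 ->
    exists2 f, chi a = PFunctional f & is_dual a f;
  pchar_infinite : forall a, eps a a = 1 -> zorder a = 0%N ->
    is_zero_value a (chi a);
  pchar_finite : forall a, eps a a = 1 -> a *+ p <> 0 -> zorder a <> 0%N ->
    (exists2 C, chi a = PClass C & fclasses a C) \/ is_zero_value a (chi a) }.

(* [u] = (xi, c) ranges over all representatives of the class; the condition   *)
(* for one representative implies it for the others.                          *)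
Definition satisfies_pchar (pp : G -> V -> V) (chi : G -> pchar_value)
    (A : pzAlgType F) (h : V -> A) : Prop :=
  forall a, eps a a = 1 ->
  (forall f, chi a = PFunctional f -> forall x, gr a x ->
     h x ^+ p - h (pp a x) = f x ^+ p *: (1 : A)) /\
  (forall C u, chi a = PClass C -> C u ->
     (h u.1 ^+ p - h (pp a u.1)) ^+ zorder (a *+ p) = 1 /\
     forall x, gr a x ->
       h x ^+ p - h (pp a x) = u.2 x ^+ p *: (h u.1 ^+ p - h (pp a u.1))).

End PCharacter.

Section Enveloping.
Variables (F : fieldType) (p : nat) (G : zmodType) (eps : G -> G -> F).
Variables (V : lmodType F) (gr : G -> set V) (br : V -> V -> V).
Variables (pp : G -> V -> V) (chi : G -> pchar_value V).

Definition tensor_gr (a : G) : set (tensor_alg V) :=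
  lspan [set w | exists s : seq (G * V),
    [/\ forall u, u \in s -> gr u.1 u.2, \sum_(u <- s) u.1 = a
      & w = \prod_(u <- s) tensor_in u.2]].

Definition uea_rel : set (tensor_alg V) :=
  [set w | exists a b x y, [/\ gr a x, gr b y &
     w = tensor_in x * tensor_in y - eps a b *: (tensor_in y * tensor_in x)
         - tensor_in (br x y)]].

Definition uea : pzAlgType F := quot_alg uea_rel.

Definition uea_in (x : V) : uea := quot_pi uea_rel (tensor_in x).

Definition uea_gr (a : G) : set uea := quot_pi uea_rel @` tensor_gr a.

(* Generators of the ideal I_chi, for all representatives [u] = (xi, c) of the *)
(* classes; the ideal is the same when one representative of each is used.     *)
Definition red_uea_rel : set uea :=
  [set w | exists2 a, eps a a = 1 &
     (exists f x, [/\ chi a = PFunctional f, gr a x &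
        w = uea_in x ^+ p - uea_in (pp a x) - f x ^+ p *: (1 : uea)])
  \/ (exists C u, [/\ chi a = PClass C, C u &
        w = (uea_in u.1 ^+ p - uea_in (pp a u.1)) ^+ zorder (a *+ p) - 1
     \/ exists2 x, gr a x &
        w = (uea_in x ^+ p - uea_in (pp a x))
            - u.2 x ^+ p *: (uea_in u.1 ^+ p - uea_in (pp a u.1))])].

Definition red_uea : pzAlgType F := quot_alg red_uea_rel.

Definition red_uea_in (x : V) : red_uea := quot_pi red_uea_rel (uea_in x).

Definition red_uea_gr (a : G) : set red_uea := quot_pi red_uea_rel @` uea_gr a.

Record is_reduced_uea (u : pzAlgType F) (gru : G -> set u) (sigma : V -> u) :
    Prop := {
  reduced_uea_graded : is_graded_alg gru;
  reduced_uea_hom : is_lie_hom_minus eps gr br gru sigma;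
  reduced_uea_pchar : satisfies_pchar p eps gr pp chi sigma;
  reduced_uea_univ : forall (A : pzAlgType F) (grA : G -> set A) (g : V -> A),
    is_graded_alg grA -> is_lie_hom_minus eps gr br grA g ->
    satisfies_pchar p eps gr pp chi g ->
    exists! h : u -> A, is_graded_alg_hom gru grA h /\ h \o sigma = g }.

End Enveloping.

(* sigma(f)^delta sigma(e)^n: the factors are taken in increasing order of the *)
(* indices, first those indexed by [M] and then those indexed by [I].          *)
Definition pbw_monomial (F : fieldType) (V : lmodType F) (A : pzAlgType F)
    (sigma : V -> A) (dI dM : Order.disp_t) (I : orderType dI) (M : orderType dM)
    (e : I -> V) (f : M -> V)
    (dn : {fsfun M -> bool with false} * {fsfun I -> nat with 0%N}) : A :=
  \prod_(j <- sort <=%O (finsupp dn.1)) sigma (f j) ^+ dn.1 j *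
  \prod_(i <- sort <=%O (finsupp dn.2)) sigma (e i) ^+ dn.2 i.

(* Main.v *)
(* Bergman's diamond lemma, applied to the free algebra on the letters f_j, e_i *)
(* (with f_j < e_i). The rules are y x -> (y,x) x y + [y,x] for letters x < y,  *)
(* f_j^2 -> [f_j,f_j]/2, and, for each e_i, its relation in I_chi solved for    *)
(* its leading power: e_i^p when i is not in J, and xi^(ps), the leading term   *)
(* of (xi^p - xi^[p])^s - 1, when e_i = xi. Words are compared by total weight, *)
(* the letters xi having weight 2 and all others weight 3, and then by number   *)
(* of inversions; in this way e_i^p -> c(e_i)^p xi^p + ... decreases too.       *)
(* Every power relation D_x = x^m - ... color-commutes with each letter a       *)
(* modulo relations of smaller weight,                                          *)
(*   D_x a - (x,a)^m a D_x =                                                    *)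
(*     sum_(i < m) (x,a)^i x^(m-1-i) (x a - (x,a) a x - [x,a]) x^i + ...,       *)
(* because (ad x)^p = ad x^[p], and this resolves all overlaps which involve a  *)
(* power; the overlaps of two swaps are resolved by the Jacobi identity.        *)
(* The irreducible words are the PBW monomials, so these form a basis of the    *)
(* quotient by the rules. That quotient satisfies the relations of I_chi for    *)
(* all x, not only for letters, since x^p - x^[p] is p-semilinear by Jacobson's *)
(* formula, and so it is U(g)/I_chi. The rules are homogeneous, which makes the *)
(* grading direct.                                                              *)
Require Import Defs.
From HB Require Import structures.
From mathcomp Require Import all_boot all_order all_algebra finmap.
From mathcomp Require Import boolp classical_sets ring zify.
From mathcomp.multinomials Require Import monalg.

Set Implicit Arguments.
Unset Strict Implicit.
Unset Printing Implicit Defensive.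

Import Order.TTheory GRing.Theory.

Local Open Scope classical_set_scope.
Local Open Scope ring_scope.

(** * Linear algebra and algebra homomorphisms *)

(** The whole difficulty is linear independence, and it is a question of confluence. On a
    homogeneous basis of [g], odd letters before even ones, the relations are oriented: an inverted
    pair is transposed, and for each letter one power relation is solved for its leading power. If
    all overlaps of these rules resolve, reduction gives a well defined linear map [nf] on the free
    algebra that kills the ideal of the rules and fixes the irreducible words ([nf_step],
    [nf_ideal], [nf_irr]). Irreducible words are the sorted words with bounded multiplicities
    ([irreducible_sorted]), that is, the monomials of the theorem.

    The overlaps are resolved for abstract data in [straightening_ambiguities]. For three distinct
    letters the Jacobi identity suffices. If a power is involved, its relation must color-commute
    with every letter modulo relations of smaller weight ([lpow_comm]). In characteristic $p$ the
    iterate $(\mathrm{ad}\,x)^{p-1}$ sends $b$ to $\sum_i c^i x^{p-1-i} b x^i$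
    ([iter_tw_comm_pred]), so commuting with $x^p$ amounts to
    $(\mathrm{ad}\,x)^p=\mathrm{ad}\,x^{[p]}$, and $x^p-x^{[p]}$ color-commutes with letters
    ([zpow_comm]). The definition of a $p$-character takes care of the constant terms: $\chi_\alpha$
    is a nonzero functional only if $p\alpha=0$, and $ps\alpha=0$ in the class case, so the color
    factor of the power is 1 wherever a constant is present ([bichar_torsion]). The self-overlap of
    the square of an odd letter uses that 3 is invertible ([lpow_comm_self]).

    The rules contain the power relations for basis letters alone. By Jacobson's formula
    ([jacobson_hom]) the map $v\mapsto v^p-v^{[p]}$ is $p$-semilinear in the quotient by the rules,
    which therefore satisfies the relations for all $v$ ([model_in_pchar]). This gives homomorphisms
    in both directions between that quotient and $U(\mathfrak g)/I_\chi$ ([red_uea_model]), and the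
    basis is carried over by [red_uea_irr_free] and [red_uea_irr_span].

    The universal property is formal ([red_uea_lift]) except for the directness of the grading. The
    rules are homogeneous, so degree projections of the free algebra preserve their ideal
    ([ideal_proj], [model_direct]), and directness is pulled back along the injection into the model
    ([red_uea_grading]). *)

Section Subspaces.
Variables (F : fieldType) (V : lmodType F).
Implicit Types (W S : set V).

Section Closure.
Variables (W : set V) (hW : is_subspace W).

Lemma subspace0 : W 0. Proof. by case: hW. Qed.

Lemma subspaceD x y : W x -> W y -> W (x + y).
Proof. by move=> Wx Wy; case: hW => _ /(_ 1 x y Wx Wy); rewrite scale1r. Qed.

Lemma subspaceZ a x : W x -> W (a *: x).
Proof. by move=> Wx; case: hW => W0 /(_ a x 0 Wx W0); rewrite addr0. Qed.

Lemma subspaceN x : W x -> W (- x).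
Proof. by move=> Wx; rewrite -scaleN1r; apply: subspaceZ. Qed.

Lemma subspaceB x y : W x -> W y -> W (x - y).
Proof. by move=> Wx Wy; apply/subspaceD/subspaceN. Qed.

Lemma subspace_sum (T : Type) (r : seq T) (P : pred T) (E : T -> V) :
  (forall i, P i -> W (E i)) -> W (\sum_(i <- r | P i) E i).
Proof. by move=> WE; apply: big_ind => //; [exact: subspace0 | exact: subspaceD]. Qed.

Lemma subspace_sum_seq (T : eqType) (r : seq T) (E : T -> V) :
  (forall i, i \in r -> W (E i)) -> W (\sum_(i <- r) E i).
Proof.
by move=> WE; rewrite big_seq; apply: subspace_sum.
Qed.

Lemma subspace_trans x y : W (x - y) -> W y -> W x.
Proof. by move=> Wxy Wy; rewrite -(subrK y x); apply: subspaceD. Qed.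

End Closure.

Lemma eq_subspace W W' : (forall x, W x = W' x) -> is_subspace W -> is_subspace W'.
Proof. by move=> /funext ->. Qed.

Lemma lspan_subspace S : is_subspace (lspan S).
Proof.
split=> [W [] //|a x y Sx Sy W hW SW].
by case: (hW) => _; apply; [apply: Sx | apply: Sy].
Qed.

Lemma lspan_incl S x : S x -> lspan S x.
Proof. by move=> Sx W _; apply. Qed.

Lemma lspan_min S W : is_subspace W -> S `<=` W -> lspan S `<=` W.
Proof. by move=> hW SW x; apply. Qed.

End Subspaces.

Section LinearMaps.
Variables (F : fieldType) (V W : lmodType F) (h : V -> W) (hlin : linear h).

Let H : {linear V -> W} :=
  HB.pack h (GRing.isLinear.Build F V W *:%R h hlin).

Lemma linear_map0 : h 0 = 0. Proof. exact: (linear0 H). Qed.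
Lemma linear_mapD x y : h (x + y) = h x + h y. Proof. exact: (linearD H). Qed.
Lemma linear_mapN x : h (- x) = - h x. Proof. exact: (linearN H). Qed.
Lemma linear_mapB x y : h (x - y) = h x - h y. Proof. exact: (linearB H). Qed.
Lemma linear_mapZ a x : h (a *: x) = a *: h x. Proof. exact: (linearZZ H). Qed.
Lemma linear_map_sum (T : Type) (r : seq T) (P : pred T) (E : T -> V) :
  h (\sum_(i <- r | P i) E i) = \sum_(i <- r | P i) h (E i).
Proof. exact: (linear_sum H). Qed.

Lemma preim_subspace (S : set W) :
  is_subspace S -> is_subspace [set x | S (h x)].
Proof.
move=> hS; split=> [|a x y /= Sx Sy] /=; first by rewrite linear_map0; case: hS.
by rewrite linear_mapD linear_mapZ; case: hS => _; apply.
Qed.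

Lemma ker_subspace : is_subspace [set x | h x = 0].
Proof.
split=> [|a x y /= hx hy] /=; first exact: linear_map0.
by rewrite linear_mapD linear_mapZ hx hy scaler0 addr0.
Qed.

End LinearMaps.

Lemma equalizer_subspace (F : fieldType) (V W : lmodType F) (h k : V -> W) :
  linear h -> linear k -> is_subspace [set x | h x = k x].
Proof.
move=> hl kl; split=> [|a x y /= hx hy]; first by rewrite /= !linear_map0.
by rewrite /= hl kl hx hy.
Qed.

Section AlgebraMaps.
Variable F : fieldType.

Record is_alg_hom (A B : pzAlgType F) (h : A -> B) : Prop := {
  ahom_lin : linear h;
  ahomM : {morph h : x y / x * y};
  ahom1 : h 1 = 1 }.

Lemma ahomX (A B : pzAlgType F) (h : A -> B) (hh : is_alg_hom h) x n :
  h (x ^+ n) = h x ^+ n.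
Proof.
by elim: n => [|n IHn]; rewrite ?expr0 ?(ahom1 hh) // !exprS (ahomM hh) IHn.
Qed.

Lemma ahom_prod (A B : pzAlgType F) (h : A -> B) (hh : is_alg_hom h)
  (T : Type) (r : seq T) (E : T -> A) :
  h (\prod_(i <- r) E i) = \prod_(i <- r) h (E i).
Proof. exact: (big_morph h (ahomM hh) (ahom1 hh)). Qed.

Lemma alg_hom_comp (A B C : pzAlgType F) (h : A -> B) (k : B -> C) :
  is_alg_hom h -> is_alg_hom k -> is_alg_hom (k \o h).
Proof.
move=> hh hk; split=> [a x y|x y|] /=.
- by rewrite (ahom_lin hh) (ahom_lin hk).
- by rewrite (ahomM hh) (ahomM hk).
- by rewrite (ahom1 hh) (ahom1 hk).
Qed.

Lemma mul_linear_l (A : pzAlgType F) (a : A) : linear (fun x : A => a * x).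
Proof. by move=> c x y; rewrite mulrDr -pzscalerAr. Qed.

Lemma mul_linear_r (A : pzAlgType F) (a : A) : linear (fun x : A => x * a).
Proof. by move=> c x y; rewrite mulrDl -pzscalerAl. Qed.

Lemma mul_linear_lr (A : pzAlgType F) (a b : A) : linear (fun x : A => a * x * b).
Proof. by move=> c x y; rewrite mulrDr mulrDl -pzscalerAr -pzscalerAl. Qed.

Lemma quot_pi_hom (A : pzAlgType F) (S : set A) : is_alg_hom (quot_pi S).
Proof.
split=> [a x y|x y|]; last exact: quot_pi1.
  by rewrite quot_piD quot_piZ.
exact: quot_piM.
Qed.

Lemma quot_pi_rel (A : pzAlgType F) (S : set A) x : S x -> quot_pi S x = 0.
Proof.
move=> Sx; rewrite -(linear_map0 (ahom_lin (quot_pi_hom S))).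
by apply/quot_pi_eq; rewrite subr0; apply: mem_ideal_gen.
Qed.

Lemma ideal_gen_ker (A B : pzAlgType F) (S : set A) (h : A -> B) :
  is_alg_hom h -> (forall x, S x -> h x = 0) ->
  forall x, x \in ideal_gen S -> h x = 0.
Proof.
move=> hh hS x /ideal_genP /(_ [set x | h x = 0]) /=; apply=> //.
have hl := ahom_lin hh; split=> /=.
- exact: linear_map0.
- by move=> y z hy hz; rewrite linear_mapB // hy hz subr0.
- by move=> a y b hy; rewrite !(ahomM hh) hy mulr0 mul0r.
Qed.

Lemma ideal_gen_subspace (A : pzAlgType F) (S : set A) :
  is_subspace [set x | x \in ideal_gen S].
Proof.
split=> [|a x y /= Sx Sy]; first exact: rpred0.
apply: rpredD => //; rewrite -[x]mul1r pzscalerAl -[_ * x]mulr1.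
exact: ideal_genM.
Qed.

(** The lift evaluates [h] on a chosen preimage; [kE] is the independence of that choice. *)
Lemma quot_lift (A B : pzAlgType F) (S : set A) (h : A -> B) :
  is_alg_hom h -> (forall x, S x -> h x = 0) ->
  exists2 k : quot_alg S -> B, is_alg_hom k & forall x, k (quot_pi S x) = h x.
Proof.
move=> hh hS; have [r rK] := choice (@quot_pi_surj F A S).
have kE x : h (r (quot_pi S x)) = h x.
  apply/eqP; rewrite -subr_eq0 -(linear_mapB (ahom_lin hh)); apply/eqP.
  by apply: (ideal_gen_ker hh hS); apply/quot_pi_eq.
have hq := quot_pi_hom S.
exists (fun u => h (r u)) => //; split=> [a u v|u v|]; last first.
- by rewrite -(ahom1 hq) kE (ahom1 hh).
- by rewrite (rK u) (rK v) -(ahomM hq) !kE (ahomM hh).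
- by rewrite (rK u) (rK v) -(ahom_lin hq) !kE (ahom_lin hh).
Qed.

End AlgebraMaps.

(* The interface of a free algebra, kept abstract so that unification never    *)
(* unfolds the finitely supported functions implementing [free_alg].          *)
Record is_free_on (F : fieldType) (X : Type) (A : pzAlgType F) (word : seq X -> A) :
    Prop := {
  free_on_nil : word [::] = 1;
  free_on_cat : forall s t, word (s ++ t) = word s * word t;
  free_on_span : forall W : set A, is_subspace W -> (forall s, W (word s)) -> forall a, W a;
  free_on_ext : forall (V : lmodType F) (n : seq X -> V),
    exists2 h : A -> V, linear h & forall s, h (word s) = n s }.

Section FreeOn.
Variables (F : fieldType) (X : Type) (A : pzAlgType F) (word : seq X -> A).
Hypothesis hA : is_free_on word.

Definition wlin (V : lmodType F) (n : seq X -> V) : A -> V :=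
  s2val (cid2 (free_on_ext hA n)).

Lemma wlin_linear (V : lmodType F) (n : seq X -> V) : linear (wlin n).
Proof. exact: (s2valP (cid2 (free_on_ext hA n))). Qed.

Lemma wlin_word (V : lmodType F) (n : seq X -> V) s : wlin n (word s) = n s.
Proof. exact: (s2valP' (cid2 (free_on_ext hA n))). Qed.

Lemma linear_eq_free (V : lmodType F) (h k : A -> V) :
  linear h -> linear k -> (forall s, h (word s) = k (word s)) -> h =1 k.
Proof.
by move=> hl kl E; apply: (free_on_span hA (equalizer_subspace hl kl)).
Qed.

Lemma free_lift (B : pzAlgType F) (t : X -> B) :
  exists2 h : A -> B, is_alg_hom h & forall s, h (word s) = \prod_(x <- s) t x.
Proof.
pose h := wlin (fun s => \prod_(x <- s) t x : B).
have hl : linear h := wlin_linear _.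
have hE s : h (word s) = \prod_(x <- s) t x by rewrite /h wlin_word.
exists h => //; split=> // [|]; last by rewrite -(free_on_nil hA) hE big_nil.
move=> x y; move: x; apply: linear_eq_free => [a u v|a u v|s].
- by rewrite mulrDl -pzscalerAl hl.
- by rewrite hl mulrDl -pzscalerAl.
move: y; apply: linear_eq_free => [a u v|a u v|s'].
- by rewrite mulrDr -pzscalerAr hl.
- by rewrite hl mulrDr -pzscalerAr.
by rewrite -(free_on_cat hA) !hE big_cat.
Qed.

Lemma free_on_nseq n x : word [:: x] ^+ n = word (nseq n x).
Proof.
elim: n => [|n IHn]; first by rewrite expr0 (free_on_nil hA).
by rewrite exprS IHn -(free_on_cat hA).
Qed.

End FreeOn.

Section FreeAlgebra.
Variables (F : fieldType) (X : choiceType).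
Local Notation A := (free_alg F X).
Implicit Types (s t : seq X).

Definition word s : A := \prod_(x <- s) free_var F x.

Lemma wordM s t : word (s ++ t) = word s * word t.
Proof. exact: big_cat. Qed.

Lemma word_nil : word [::] = 1. Proof. exact: big_nil. Qed.

Lemma word_cons x s : word (x :: s) = free_var F x * word s.
Proof. exact: big_cons. Qed.

Lemma word1 x : word [:: x] = free_var F x.
Proof. by rewrite word_cons word_nil mulr1. Qed.

Let mon s : {malg F[{fmonom X}]} := << FMonom s >>.

Lemma wordE s : word s = mon s.
Proof.
elim: s => [|x s IHs].
  rewrite word_nil -[LHS]/(1 : {malg F[{fmonom X}]}) /mon -fmoneE //.
rewrite word_cons IHs -[LHS]/((<< fmu x >> : {malg F[{fmonom X}]}) * mon s).
rewrite malgM_def fgmulUU mulr1 /mon; congr << _ >>.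
by rewrite -[LHS]/(fmmul _ _) fmmulE fmuE.
Qed.

Definition malg_ext (V : lmodType F) (n : seq X -> V) (a : A) : V :=
  \sum_(k <- msupp (a : {malg F[{fmonom X}]}))
     mcoeff k (a : {malg F[{fmonom X}]}) *: n (fmonom_val k).

Lemma malg_extEw (V : lmodType F) (n : seq X -> V) (a : A) (d : {fset {fmonom X}}) :
  (msupp (a : {malg F[{fmonom X}]}) `<=` d)%fset ->
  malg_ext n a = \sum_(k <- d) mcoeff k (a : {malg F[{fmonom X}]}) *: n (fmonom_val k).
Proof.
move=> sd; rewrite /malg_ext (big_fset_incl _ sd) //= => k _ /mcoeff_outdom ->.
by rewrite scale0r.
Qed.

Lemma malg_ext_linear (V : lmodType F) (n : seq X -> V) : linear (malg_ext n).
Proof.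
move=> c x y; pose x' : {malg F[{fmonom X}]} := x; pose y' : {malg F[{fmonom X}]} := y.
pose d := (msupp x' `|` msupp y')%fset.
have sxy : (msupp (c *: x' + y') `<=` d)%fset.
  apply: (fsubset_trans (msuppD_le _ _)).
  by apply: fsetUSS => //; apply: msuppZ_le.
rewrite (malg_extEw n (a := (c *: x + y)) (d := d)) //.
rewrite (malg_extEw n (a := x) (d := d)) ?fsubsetUl //.
rewrite (malg_extEw n (a := y) (d := d)) ?fsubsetUr //.
rewrite scaler_sumr -big_split /=; apply: eq_bigr => k _.
rewrite -[mcoeff k _]/(mcoeff k (c *: x' + y')) mcoeffD mcoeffZ.
by rewrite scalerDl scalerA.
Qed.

Lemma malg_ext_word (V : lmodType F) (n : seq X -> V) s : malg_ext n (word s) = n s.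
Proof.
rewrite wordE /malg_ext msuppU1 big_seq_fset1.
by rewrite /mon mcoeffU1 eqxx scale1r.
Qed.

Lemma free_alg_span (W : set A) : is_subspace W -> (forall s, W (word s)) -> forall a, W a.
Proof.
move=> hW Ww a; pose a' : {malg F[{fmonom X}]} := a.
have -> : a = \sum_(k <- msupp a') (mcoeff k a' *: word (fmonom_val k)).
  rewrite {1}(monalgE a : a = _); apply: eq_bigr => k _; rewrite wordE.
  apply/malgP => k'; rewrite -[_ *: _]/(mcoeff k a' *: mon (fmonom_val k)).
  by rewrite mcoeffZ /mon !mcoeffU fmK mulrnAr mulr1.
by apply: subspace_sum => // k _; apply: subspaceZ.
Qed.

Lemma free_alg_free : is_free_on word.
Proof.
split; [exact: word_nil|exact: wordM|exact: free_alg_span|].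
by move=> V n; exists (malg_ext n); [exact: malg_ext_linear|exact: malg_ext_word].
Qed.

End FreeAlgebra.

(** * Homomorphisms out of the reduced enveloping algebra *)

Lemma image_lspan (F : fieldType) (V W : lmodType F) (h : V -> W) (S : set V) :
  linear h -> h @` lspan S = lspan (h @` S).
Proof.
move=> hl; rewrite eqEsubset; split=> [_ [x Sx <-]|].
  move: x Sx; apply: lspan_min => [|x Sx].
    exact: (preim_subspace hl (lspan_subspace _)).
  by apply: lspan_incl; exists x.
apply: lspan_min => [|_ [x Sx <-]]; last by exists x => //; exact: lspan_incl.
split; first by exists 0; [case: (lspan_subspace S) | rewrite linear_map0].
move=> a _ _ [x Sx <-] [y Sy <-]; exists (a *: x + y); last by rewrite hl.
by case: (lspan_subspace S) => _; apply.
Qed.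

Section AlgHomRelations.
Variables (F : fieldType) (A B : pzAlgType F) (h : A -> B) (hh : is_alg_hom h).
Let hl := ahom_lin hh.

(** This and the next three identities have the shapes of the generators of the relations, so that a
    homomorphism passes through a generator in one rewrite. *)
Lemma ahom_bracket c (x y z : A) :
  h (x * y - c *: (y * x) - z) = h x * h y - c *: (h y * h x) - h z.
Proof. by rewrite !(linear_mapB hl) (linear_mapZ hl) !(ahomM hh). Qed.

Lemma ahom_ppow n c (x y : A) :
  h (x ^+ n - y - c *: (1 : A)) = h x ^+ n - h y - c *: (1 : B).
Proof. by rewrite !(linear_mapB hl) (linear_mapZ hl) (ahomX hh) (ahom1 hh). Qed.

Lemma ahom_ppow_ppow n m (x y : A) :
  h ((x ^+ n - y) ^+ m - 1) = (h x ^+ n - h y) ^+ m - 1.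
Proof.
by rewrite (linear_mapB hl) (ahomX hh) (linear_mapB hl) (ahomX hh) (ahom1 hh).
Qed.

Lemma ahom_ppow_sub n c (x y x' y' : A) :
  h (x ^+ n - y - c *: (x' ^+ n - y')) = h x ^+ n - h y - c *: (h x' ^+ n - h y').
Proof. by rewrite !(linear_mapB hl) (linear_mapZ hl) !(linear_mapB hl) !(ahomX hh). Qed.

End AlgHomRelations.

Section ReducedEnveloping.
Variables (F : fieldType) (p : nat) (G : zmodType) (eps : G -> G -> F).
Variables (g : lmodType F) (gr : G -> set g) (br : g -> g -> g).
Variables (pp : G -> g -> g) (chi : G -> pchar_value g).

Local Notation A := (free_alg F g).
Local Notation urel := (@red_uea_rel F p G eps g gr br pp chi).
Local Notation u := (@red_uea F p G eps g gr br pp chi).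
Local Notation inu := (@red_uea_in F p G eps g gr br pp chi).
Local Notation gru := (@red_uea_gr F p G eps g gr br pp chi).

(** The algebra is a threefold quotient of the free algebra on the set [g]: by linearity, by the
    bracket relations, and by the generators of $I_\chi$. *)
Lemma red_uea_pi_hom : is_alg_hom
  (quot_pi urel \o quot_pi (uea_rel eps gr br)
     \o quot_pi (tensor_rel (V := g))).
Proof.
by apply: alg_hom_comp; [|apply: alg_hom_comp]; exact: quot_pi_hom.
Qed.

Lemma red_uea_pi_surj (w : u) : exists x : A,
  w = quot_pi urel
        (quot_pi (uea_rel eps gr br) (quot_pi (tensor_rel (V := g)) x)).
Proof.
have [x ->] := quot_pi_surj w; have [y ->] := quot_pi_surj x.
by have [z ->] := quot_pi_surj y; exists z.
Qed.

Lemma red_uea_in_linear : linear inu.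
Proof.
have lin : linear (@tensor_in F g).
  move=> a x y; apply/eqP; rewrite -subr_eq0; apply/eqP.
  have hl := ahom_lin (quot_pi_hom (tensor_rel (V := g))).
  rewrite /tensor_in -hl -(linear_mapB hl); apply: quot_pi_rel.
  by exists a, x, y.
by move=> a x y; rewrite /red_uea_in /uea_in lin !(ahom_lin (quot_pi_hom _)).
Qed.

Lemma red_uea_ind (W : set u) : is_subspace W ->
  (forall s : seq g, W (\prod_(x <- s) inu x)) -> forall w, W w.
Proof.
move=> hW Ws w; have [x ->] := red_uea_pi_surj w.
have hp := red_uea_pi_hom.
refine (free_alg_span (preim_subspace (ahom_lin hp) hW) _ x) => s.
rewrite /mkset [X in W X](ahom_prod hp); exact: Ws.
Qed.

Lemma red_uea_hom_eq (B : pzAlgType F) (h k : u -> B) :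
  is_alg_hom h -> is_alg_hom k -> (forall x, h (inu x) = k (inu x)) -> h =1 k.
Proof.
move=> hh hk E.
apply: (red_uea_ind (equalizer_subspace (ahom_lin hh) (ahom_lin hk))) => s.
rewrite /mkset (ahom_prod hh) (ahom_prod hk).
by under eq_bigr do rewrite E.
Qed.

(** The universal property with gradings left aside: the map out of the free algebra descends
    through the three quotients in turn. *)
Lemma red_uea_lift (B : pzAlgType F) (s : g -> B) :
  linear s ->
  (forall a b x y, gr a x -> gr b y ->
     s (br x y) = s x * s y - eps a b *: (s y * s x)) ->
  satisfies_pchar p eps gr pp chi s ->
  exists2 h : u -> B, is_alg_hom h & forall x, h (inu x) = s x.
Proof.
move=> sl sbr schi.
have [h0 hh0 E0'] := free_lift (free_alg_free F g) s.
have E0 x : h0 (free_var F x) = s x by rewrite -word1 E0' big_seq1.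
have [|h1 hh1 E1] := @quot_lift _ _ _ (tensor_rel (V := g)) _ hh0.
  move=> _ [a [x [y ->]]]; have hl := ahom_lin hh0.
  by rewrite (linear_mapB hl) hl !E0 sl subrr.
have {}E1 x : h1 (tensor_in x) = s x by rewrite E1 E0.
have [|h2 hh2 E2] := @quot_lift _ _ _ (uea_rel eps gr br) _ hh1.
  move=> _ [a [b [x [y [ax by_ ->]]]]].
  by rewrite (ahom_bracket hh1) !E1 (sbr a b) // subrr.
have {}E2 x : h2 (uea_in eps gr br x) = s x by rewrite E2 E1.
have [|h3 hh3 E3] := @quot_lift _ _ _ urel _ hh2.
  move=> w [a aa [[f [x [fa ax ->]]]|[C [v [Ca Cv H]]]]].
    have [/(_ f fa x ax) sx _] := schi a aa.
    by rewrite (ahom_ppow hh2) !E2 sx subrr.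
  have [_ /(_ C v Ca Cv) [s1 sx]] := schi a aa.
  case: H => [->|[x ax ->]].
    by rewrite (ahom_ppow_ppow hh2) !E2 s1 subrr.
  by rewrite (ahom_ppow_sub hh2) !E2 sx // subrr.
by exists h3 => // x; rewrite E3 E2.
Qed.

Lemma red_uea_in_bracket a b x y : gr a x -> gr b y ->
  inu (br x y) = inu x * inu y - eps a b *: (inu y * inu x).
Proof.
move=> ax by_; apply/esym/eqP; rewrite -subr_eq0; apply/eqP.
have hk := quot_pi_hom (uea_rel eps gr br); have hS := quot_pi_hom urel.
rewrite -(ahom_bracket hS) -(linear_map0 (ahom_lin hS)); congr quot_pi.
by rewrite -(ahom_bracket hk); apply: quot_pi_rel; exists a, b, x, y.
Qed.

Lemma red_uea_in_pchar : satisfies_pchar p eps gr pp chi inu.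
Proof.
move=> a aa; have hk := quot_pi_hom urel.
split=> [f fa x ax|C v Ca Cv].
  apply/eqP; rewrite -subr_eq0 -(ahom_ppow hk); apply/eqP.
  by apply: quot_pi_rel; exists a => //; left; exists f, x.
split=> [|x ax]; apply/eqP; rewrite -subr_eq0.
  rewrite -(ahom_ppow_ppow hk); apply/eqP.
  by apply: quot_pi_rel; exists a => //; right; exists C, v; split=> //; left.
rewrite -(ahom_ppow_sub hk); apply/eqP.
by apply: quot_pi_rel; exists a => //; right; exists C, v; split=> //; right; exists x.
Qed.

Definition hom_prods (a : G) : set u :=
  [set w | exists s : seq (G * g),
    [/\ forall v, v \in s -> gr v.1 v.2, \sum_(v <- s) v.1 = a
      & w = \prod_(v <- s) inu v.2]].

Lemma red_uea_grE a : gru a = lspan (hom_prods a).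
Proof.
set S := urel; set T := uea_rel eps gr br.
have hS := quot_pi_hom S; have hT := quot_pi_hom T.
rewrite /red_uea_gr /uea_gr /tensor_gr (image_lspan _ (ahom_lin hT)).
rewrite (image_lspan _ (ahom_lin hS)); congr lspan.
rewrite eqEsubset; split.
  move=> _ [_ [_ [s [hs sa ->]] <-] <-]; exists s; split=> //.
  by rewrite (ahom_prod hT) (ahom_prod hS).
move=> _ [s [hs sa ->]]; exists (quot_pi T (\prod_(v <- s) tensor_in v.2)).
  by exists (\prod_(v <- s) tensor_in v.2) => //; exists s.
by rewrite (ahom_prod hT) (ahom_prod hS).
Qed.

Lemma red_uea_gr_subspace a : is_subspace (gru a).
Proof. by rewrite red_uea_grE; exact: lspan_subspace. Qed.

Lemma red_uea_gr1 : gru 0 1.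
Proof.
rewrite red_uea_grE; apply: lspan_incl; exists [::]; split=> //; by rewrite big_nil.
Qed.

Lemma red_uea_gr_in a x : gr a x -> gru a (inu x).
Proof.
move=> ax; rewrite red_uea_grE; apply: lspan_incl; exists [:: (a, x)].
by split=> [v /[!inE] /eqP->//||]; rewrite big_seq1.
Qed.

Lemma red_uea_grM a b x y : gru a x -> gru b y -> gru (a + b) (x * y).
Proof.
move=> ax; move: y; rewrite !red_uea_grE; apply: lspan_min.
  exact: (preim_subspace (mul_linear_l x) (lspan_subspace _)).
move=> _ [t [ht tb ->]] /=; move: x ax; rewrite red_uea_grE; apply: lspan_min.
  exact: (preim_subspace (mul_linear_r _) (lspan_subspace _)).
move=> _ [s [hs sa ->]] /=; apply: lspan_incl; exists (s ++ t); split.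
- by move=> v; rewrite mem_cat => /orP[/hs|/ht].
- by rewrite big_cat sa tb.
- by rewrite big_cat.
Qed.

End ReducedEnveloping.

(** * The diamond lemma *)

Lemma cat_eq_prefix (T : Type) (a b c d : seq T) :
  a ++ b = c ++ d -> (size a <= size c)%N -> exists2 m, c = a ++ m & b = m ++ d.
Proof.
elim: a c => [|x a IHa] [|y c] //= E le; [by exists [::] | by exists (y :: c) |].
by case: E => -> /IHa[] // m -> ->; exists m.
Qed.

Section Diamond.
Variables (F : fieldType) (X : eqType) (A : pzAlgType F) (word : seq X -> A).
Hypothesis hA : is_free_on word.
Implicit Types (w s t u v : seq X) (r : A).
Variable lt : seq X -> seq X -> Prop.
Hypothesis lt_wf : well_founded lt.
Variable rule : seq X -> A -> Prop.
Hypothesis rule_lt : forall s r, rule s r ->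
  lspan [set a | exists2 t, forall u v, lt (u ++ t ++ v) (u ++ s ++ v) & a = word t] r.

Definition rewrites_to w (a : A) : Prop := exists u s r v,
  [/\ rule s r, w = u ++ s ++ v & a = word u * r * word v].

Definition irreducible w : Prop := ~ exists a, rewrites_to w a.

Lemma rewrites_to_lt w a : rewrites_to w a ->
  lspan [set b | exists2 t, lt t w & b = word t] a.
Proof.
move=> [u [s [r [v [/rule_lt hr -> ->]]]]]; move: r hr; apply: lspan_min.
  exact: (preim_subspace (mul_linear_lr _ _) (lspan_subspace _)).
move=> _ [t ht ->] /=; apply: lspan_incl; exists (u ++ t ++ v) => //.
by rewrite !(free_on_cat hA) mulrA.
Qed.

(** Some reduction of [w] is picked by choice and the recursion continues on its words. The value 0
    on words not below [w] is never reached, by [rewrites_to_lt]. *)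
Definition nf_rec w (rec : forall t, lt t w -> A) : A :=
  if pselect (exists a, rewrites_to w a) is left h then
    wlin hA (fun t => if pselect (lt t w) is left ht then rec t ht else 0)
      (projT1 (cid h))
  else word w.

Definition nf_word : seq X -> A := Fix lt_wf (fun=> A) nf_rec.

Definition nf : A -> A := wlin hA nf_word.

Lemma nf_wordE w : nf_word w = nf_rec (fun t (_ : lt t w) => nf_word t).
Proof.
apply: (Fix_eq lt_wf (fun=> A)) => {}w f h E; congr nf_rec.
by apply: functional_extensionality_dep => t; apply: funext => ht.
Qed.

Lemma nf_linear : linear nf. Proof. exact: wlin_linear. Qed.

Lemma nf_irr w : irreducible w -> nf (word w) = word w.
Proof.
by move=> irr; rewrite /nf wlin_word nf_wordE /nf_rec; case: pselect.
Qed.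

(** Invariance under the one reduction picked by the recursion; for arbitrary reductions this is
    confluence, proved in [nf_step]. *)
Lemma nf_some_step w a : rewrites_to w a ->
  exists2 b, rewrites_to w b & nf (word w) = nf b.
Proof.
move=> wa; rewrite {1}/nf wlin_word nf_wordE /nf_rec.
case: pselect => [h|[]]; last by exists a.
case: (cid h) => b /= wb; exists b; first by [].
move: (rewrites_to_lt wb) => {wb}; move: b.
apply: lspan_min (equalizer_subspace (wlin_linear _ _) nf_linear) _ => _ [t tw ->].
by rewrite /= /nf !wlin_word; case: pselect.
Qed.

(** Bergman's resolvability relative to the order: the two results differ by relations in context
    whose leading words are below [w]. Quantifying over [W] avoids naming their span. Coinciding and
    nested occurrences count as overlaps. *)
Hypothesis ambiguities : forall (W : set A) w, is_subspace W ->
  (forall u s r v, rule s r -> lt (u ++ s ++ v) w ->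
     W (word u * (word s - r) * word v)) ->
  forall u s r v u' s' r' v', rule s r -> rule s' r' ->
  w = u ++ s ++ v -> w = u' ++ s' ++ v' ->
  (size u <= size u' < size u + size s)%N ->
  W (word u * r * word v - word u' * r' * word v').

(** By induction [nf] kills all relations in context below [w], so its kernel can serve as [W] in
    [ambiguities]. Only disjoint occurrences remain. *)
Lemma nf_step w a : rewrites_to w a -> nf (word w) = nf a.
Proof.
elim/(well_founded_ind lt_wf): w a => w IH a wa.
have kerN := ker_subspace nf_linear.
have IHr u s r v : rule s r -> lt (u ++ s ++ v) w ->
    nf (word u * (word s - r) * word v) = 0.
  move=> rs lw; rewrite mulrBr mulrBl (linear_mapB nf_linear) -mulrA -!(free_on_cat hA).
  by apply/eqP; rewrite subr_eq0 (IH _ lw (word u * r * word v)) //; exists u, s, r, v.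
suff conf u s r v u' s' r' v' : rule s r -> rule s' r' ->
    w = u ++ s ++ v -> w = u' ++ s' ++ v' -> (size u <= size u')%N ->
    nf (word u * r * word v) = nf (word u' * r' * word v').
  have [_ [u [s [r [v [rs wE ->]]]]] ->] := nf_some_step wa.
  have [u' [s' [r' [v' [rs' wE' ->]]]]] := wa.
  have [le|/ltnW le] := leqP (size u) (size u');
    first exact: (conf _ _ _ _ _ _ _ _ rs rs' wE wE' le).
  by apply/esym; exact: (conf _ _ _ _ _ _ _ _ rs' rs wE' wE le).
move=> rs rs' wE wE' le; have [lt'|ge] := ltnP (size u') (size u + size s)%N.
  apply/eqP; rewrite -subr_eq0 -(linear_mapB nf_linear); apply/eqP.
  by apply: (ambiguities kerN IHr rs rs' wE wE'); rewrite le.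
have wEE : (u ++ s) ++ v = u' ++ (s' ++ v') by rewrite -catA -wE.
have [m] := cat_eq_prefix wEE (leq_trans (eq_leq (size_cat u s)) ge).
rewrite -catA => u'E vE.
(* Disjoint occurrences: both results have the normal form obtained by applying both rules, because
   [s'] can still be reduced next to each smaller word of [r], and conversely. *)
have -> : nf (word u * r * word v) = nf (word u * r * word m * r' * word v').
  apply/eqP; rewrite -subr_eq0 -(linear_mapB nf_linear) vE !(free_on_cat hA) !mulrA.
  rewrite -!mulrBl -mulrBr; apply/eqP; move: (rule_lt rs); move: (r).
  apply: lspan_min => [|_ [t ht ->]].
    have Q := preim_subspace (mul_linear_lr (word u) (word m * (word s' - r') * word v'))
      kerN.
    by apply: eq_subspace Q => x; rewrite /mkset !mulrA.
  rewrite /mkset -!(free_on_cat hA); apply: IHr rs' _; rewrite wE vE -!catA; exact: ht.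
suff H : nf (word u * (word s - r) * word m * r' * word v') = 0.
  move: H; rewrite mulrBr !mulrBl (linear_mapB nf_linear) -!(free_on_cat hA) -!catA -u'E.
  by move=> /eqP; rewrite subr_eq0 => /eqP.
move: (rule_lt rs'); move: (r').
apply: lspan_min => [|_ [t ht ->]].
  exact: (preim_subspace (mul_linear_lr (word u * (word s - r) * word m) (word v')) kerN).
rewrite /mkset -!mulrA -!(free_on_cat hA) mulrA; apply: IHr rs _; rewrite wE vE.
have := ht (u ++ s ++ m) v'; by rewrite -!catA.
Qed.

Lemma nf_rule u s r v : rule s r -> nf (word u * (word s - r) * word v) = 0.
Proof.
move=> rs; rewrite mulrBr mulrBl (linear_mapB nf_linear) -!(free_on_cat hA) -catA.
by apply/eqP; rewrite subr_eq0; apply/eqP/nf_step; exists u, s, r, v.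
Qed.

Definition rule_rel : set A := [set a | exists s r, rule s r /\ a = word s - r].

(** The kernel of [nf] is not visibly an ideal; the property is strengthened to all [a * x * b],
    which is stable under multiplication. *)
Lemma nf_ideal x : x \in ideal_gen rule_rel -> nf x = 0.
Proof.
have kerN := ker_subspace nf_linear.
move=> /ideal_genP /(_ [set x | forall a b, nf (a * x * b) = 0]) Ix.
have {Ix}/(_ 1 1) : forall a b, nf (a * x * b) = 0.
  apply: Ix; last first.
    move=> _ [s [r [rs ->]]] a b; set y := word s - r.
    refine (free_on_span hA (W := fun a => nf (a * y * b) = 0) _ _ a) => [|u].
      exact: (preim_subspace (mul_linear_r y) (preim_subspace (mul_linear_r b) kerN)).
    refine (free_on_span hA (W := fun b => nf (word u * y * b) = 0) _ _ b) => [|v].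
      exact: (preim_subspace (mul_linear_l (word u * y)) kerN).
    exact: nf_rule.
  split=> [a b|y z hy hz a b|c y d hy a b] /=.
  - by rewrite mulr0 mul0r (linear_map0 nf_linear).
  - by rewrite mulrBr mulrBl (linear_mapB nf_linear) hy hz subr0.
  - by rewrite !mulrA -(mulrA _ d) hy.
by rewrite mul1r mulr1.
Qed.

Lemma nf_span (W : set A) : is_subspace W ->
  (forall w, irreducible w -> W (word w)) -> forall w, W (nf (word w)).
Proof.
move=> hW Wirr; elim/(well_founded_ind lt_wf) => w IH.
have [[a wa]|irr] := pselect (exists a, rewrites_to w a); last first.
  by rewrite nf_irr //; exact: Wirr.
rewrite (nf_step wa); move: (rewrites_to_lt wa); move: (a).
apply: lspan_min (preim_subspace nf_linear hW) _ => _ [t tw ->].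
exact: IH.
Qed.

Lemma nf_word_mod w : word w - nf (word w) \in ideal_gen rule_rel.
Proof.
have hI := ideal_gen_subspace rule_rel.
elim/(well_founded_ind lt_wf): w => w IH.
have [[a wa]|irr] := pselect (exists a, rewrites_to w a); last first.
  by rewrite nf_irr // subrr; exact: subspace0 hI.
have: word w - a \in ideal_gen rule_rel.
  have [u [s [r [v [rs -> ->]]]]] := wa.
  rewrite !(free_on_cat hA) mulrA -mulrBl -mulrBr; apply: ideal_genM.
  by apply: mem_ideal_gen; exists s, r.
have -> : word w - nf (word w) = (word w - a) + (a - nf a).
  by rewrite (nf_step wa) addrA subrK.
move=> wI; apply: rpredD => //.
move: (rewrites_to_lt wa); move: (a); apply: lspan_min => [|_ [t tw ->]]; last exact: IH.
have hl : linear (fun x => x - nf x).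
  by move=> c x y; rewrite nf_linear scalerBr opprD addrACA.
exact: (preim_subspace hl hI).
Qed.

Lemma nf_mod x : x - nf x \in ideal_gen rule_rel.
Proof.
refine (free_on_span hA (W := fun x => x - nf x \in ideal_gen rule_rel) _ nf_word_mod x).
have hl : linear (fun x => x - nf x).
  by move=> c y z; rewrite nf_linear scalerBr opprD addrACA.
exact: (preim_subspace hl (ideal_gen_subspace rule_rel)).
Qed.

End Diamond.

(** * Commutators in characteristic p and Jacobson's formula *)

Section PrimeCharacteristic.
Variables (p : nat) (p_pr : prime p) (V : zmodType).
Hypothesis charV : forall v : V, v *+ p = 0.

(** The congruence $\binom{p-1}{i}\equiv(-1)^i$ modulo $p$, from Pascal's rule and
    $p\mid\binom{p}{i+1}$, stated as an action on a group killed by $p$. *)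
Lemma pmul0_bin_pred (v : V) i :
  (i < p)%N -> v *+ 'C(p.-1, i) = (if odd i then - v else v).
Proof.
have p_gt0 := prime_gt0 p_pr.
elim: i => [|i IHi] lt_ip; first by rewrite bin0.
have := charV (v *+ ('C(p, i.+1) %/ p)).
rewrite -mulrnA divnK ?prime_dvd_bin ?lt_ip //.
rewrite -{1}(prednK p_gt0) binS mulrnDr IHi ?(ltnW lt_ip) // => /eqP.
by rewrite addr_eq0 => /eqP -> /=; case: odd; rewrite ?opprK.
Qed.

Variables (L S : {additive V -> V}).
Hypothesis commLS : forall v, L (S v) = S (L v).

Let D v := L v - S v.

Lemma iter_sub_bin n b : iter n D b =
  \sum_(i < n.+1) (if odd i then - iter (n - i) L (iter i S b)
                   else iter (n - i) L (iter i S b)) *+ 'C(n, i).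
Proof.
pose E n i := if odd i then - iter (n - i) L (iter i S b) else iter (n - i) L (iter i S b).
rewrite -[RHS]/(\sum_(i < n.+1) E n i *+ 'C(n, i)).
elim: n => [|n IHn]; first by rewrite big_ord_recl big_ord0 /= bin0 addr0.
have LE i : (i <= n)%N -> L (E n i) = E n.+1 i.
  by move=> le_in; rewrite /E subSn //; case: odd; rewrite ?(raddfN L).
have SL m v : S (iter m L v) = iter m L (S v).
  by elim: m => //= m IHm; rewrite -commLS IHm.
have SE i : S (E n i) = - E n.+1 i.+1.
  by rewrite /E subSS /=; case: odd; rewrite ?(raddfN S) SL ?opprK.
rewrite iterS IHn /D (raddf_sum L) (raddf_sum S).
under eq_bigr => i _ do rewrite (raddfMn L) LE ?leq_ord //.
under [X in _ - X]eq_bigr => i _ do rewrite (raddfMn S) SE mulNrn.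
rewrite sumrN opprK [RHS]big_ord_recl bin0 /=.
under [in RHS]eq_bigr => i _ do rewrite binS mulrnDr.
rewrite big_split /= addrA; congr (_ + _).
rewrite big_ord_recl bin0 [in RHS]big_ord_recr /= bin_small // mulr0n addr0.
by congr (_ + _); apply: eq_bigr.
Qed.

(** The signs of the binomial formula cancel those of $\binom{p-1}{i}$: $(L-S)^{p-1}=\sum_i
    L^{p-1-i}S^i$. *)
Lemma iter_sub_pred b :
  iter p.-1 D b = \sum_(i < p) iter (p.-1 - i) L (iter i S b).
Proof.
rewrite iter_sub_bin prednK ?prime_gt0 //; apply: eq_bigr => i _.
by case: ifP => oi; rewrite ?mulNrn pmul0_bin_pred ?oi ?opprK.
Qed.

End PrimeCharacteristic.

Section TwistedCommutator.
Variables (F : fieldType) (A : pzAlgType F).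
Implicit Types (c : F) (x y a b : A).

Definition tw_comm c x y : A := x * y - c *: (y * x).

Lemma tw_comm_linear c x : linear (tw_comm c x).
Proof.
move=> k y z; rewrite /tw_comm mulrDr mulrDl scalerDr -pzscalerAr -pzscalerAl.
by rewrite scalerA mulrC -scalerA opprD addrACA scalerBr.
Qed.

(** Telescoping: [a] is moved past the factors [x] one at a time, each passage costing a factor
    [c]. *)
Lemma tw_commX c n x a :
  tw_comm (c ^+ n) (x ^+ n) a =
  \sum_(i < n) c ^+ i *: (x ^+ (n.-1 - i) * tw_comm c x a * x ^+ i).
Proof.
elim: n => [|n IHn].
  by rewrite big_ord0 /tw_comm !expr0 mul1r mulr1 scale1r subrr.
rewrite big_ord_recr /= subnn expr0 mul1r.
have -> : \sum_(i < n) c ^+ i *: (x ^+ (n - i) * tw_comm c x a * x ^+ i) =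
    x * tw_comm (c ^+ n) (x ^+ n) a.
  rewrite IHn mulr_sumr; apply: eq_bigr => i _.
  have -> : (n - i = (n.-1 - i).+1)%N by rewrite -subn1 subnAC subn1 prednK ?subn_gt0.
  by rewrite exprS -pzscalerAr !mulrA.
rewrite /tw_comm mulrBr mulrBl scalerBr -pzscalerAr -pzscalerAl.
rewrite scalerA -exprSr -!mulrA -exprS [x * (x ^+ n * a)]mulrA -exprS.
by rewrite addrA subrK.
Qed.

Variables (p : nat) (hp : p \in [pchar F]).

Lemma pchar_pzalg (x : A) : x *+ p = 0.
Proof. by rewrite -scaler_nat (pcharf0 hp) scale0r. Qed.

(** [iter_sub_pred] for left multiplication by [x] and [c] times right multiplication, which
    commute. Together with [tw_commX] for exponent [p] it makes the color commutator with $x^p$ a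
    $p$-fold iterated commutator with $x$. *)
Lemma iter_tw_comm_pred c x b : iter p.-1 (tw_comm c x) b =
  \sum_(i < p) c ^+ i *: (x ^+ (p.-1 - i) * b * x ^+ i).
Proof.
pose L : {linear A -> A} := HB.pack (fun y : A => x * y)
  (GRing.isLinear.Build F A A *:%R _ (mul_linear_l x)).
have sl : linear (fun y : A => c *: (y * x)).
  by move=> k y z; rewrite mulrDl scalerDr -pzscalerAl !scalerA mulrC.
pose S : {linear A -> A} := HB.pack (fun y : A => c *: (y * x))
  (GRing.isLinear.Build F A A *:%R _ sl).
have commLS v : L (S v) = S (L v) by rewrite /L /S /= -pzscalerAr mulrA.
have := @iter_sub_pred p (pcharf_prime hp) A pchar_pzalg L S commLS b.
rewrite -[LHS]/(iter p.-1 (tw_comm c x) b) => ->; apply: eq_bigr => i _.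
have -> m : iter m S b = c ^+ m *: (b * x ^+ m).
  elim: m => [|m IHm] /=; first by rewrite !expr0 scale1r mulr1.
  by rewrite IHm -pzscalerAl scalerA -mulrA -exprSr -exprS.
have -> m v : iter m L v = x ^+ m * v.
  by elim: m => [|m IHm] /=; rewrite ?mul1r // IHm /L /= mulrA -exprS.
by rewrite -pzscalerAr mulrA.
Qed.

End TwistedCommutator.

Section Jacobson.
Variables (p : nat) (p_pr : prime p) (R : nzRingType).
Hypothesis charR : forall v : R, v *+ p = 0.
Variables x y : R.

Let w : {poly R} := x%:P * 'X + y%:P.

Let coef_wM (Q : {poly R}) k :
  (w * Q)`_k = (if k is k'.+1 then x * Q`_k' else 0) + y * Q`_k.
Proof.
rewrite /w mulrDl coefD coefCM -mulrA -(commr_polyX Q) mulrA coefMX.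
by case: k => [|k] //=; rewrite coefCM.
Qed.

Let coef_Mw (Q : {poly R}) k :
  (Q * w)`_k = (if k is k'.+1 then Q`_k' * x else 0) + Q`_k * y.
Proof.
rewrite /w mulrDr coefD coefMC mulrA coefMX.
by case: k => [|k] //=; rewrite coefMC.
Qed.

Let wX_big n k : (n < k)%N -> (w ^+ n)`_k = 0.
Proof.
elim: n k => [|n IHn] [|k] // lt_nk; first by rewrite expr0 coef1.
by rewrite exprS coef_wM !IHn ?(ltnW lt_nk) // !mulr0 addr0.
Qed.

Let wX_lead n : (w ^+ n)`_n = x ^+ n.
Proof.
elim: n => [|n IHn]; first by rewrite !expr0 coef1.
by rewrite exprS coef_wM IHn wX_big // mulr0 addr0 -exprS.
Qed.

Let wX_0 n : (w ^+ n)`_0 = y ^+ n.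
Proof.
elim: n => [|n IHn]; first by rewrite !expr0 coef1.
by rewrite exprS coef_wM IHn add0r -exprS.
Qed.

Let wX_sum n : (x + y) ^+ n = \sum_(k < n.+1) (w ^+ n)`_k.
Proof.
elim: n => [|n IHn]; first by rewrite big_ord_recl big_ord0 !expr0 coef1 addr0.
rewrite exprS IHn mulrDl !mulr_sumr [w ^+ n.+1]exprS.
under [RHS]eq_bigr => k _ do rewrite coef_wM.
rewrite big_split /= [in RHS]big_ord_recl /= add0r; congr (_ + _).
by rewrite [in RHS]big_ord_recr /= wX_big // mulr0 addr0.
Qed.

Definition polycomm (P : {poly R}) : {poly R} := w * P - P * w.

Lemma coef_polycomm P k : (polycomm P)`_k =
  (if k is k'.+1 then x * P`_k' - P`_k' * x else 0) + (y * P`_k - P`_k * y).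
Proof.
by rewrite coefB coef_wM coef_Mw opprD addrACA; case: k => [|k]; rewrite ?subr0.
Qed.

Let deriv_wX n : (w ^+ n)^`() = \sum_(i < n) w ^+ (n.-1 - i) * x%:P * w ^+ i.
Proof.
have dw : w^`() = x%:P.
  by rewrite /w derivD derivC addr0 derivM derivC mul0r add0r derivX mulr1.
elim: n => [|n IHn]; first by rewrite expr0 derivC big_ord0.
rewrite exprS derivM dw IHn addrC big_ord_recr /= subnn expr0 mul1r; congr (_ + _).
rewrite mulr_sumr; apply: eq_bigr => i _.
have -> : (n - i = (n.-1 - i).+1)%N by rewrite -subn1 subnAC subn1 prednK ?subn_gt0.
by rewrite exprS !mulrA.
Qed.

(* Both sides are coefficients of the derivative of [w ^+ p]: in characteristic *)
(* p, [(ad w)^(p-1) x] is the sum of the [w^(p-1-i) x w^i].                    *)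
Lemma jacobson_coef k : (0 < k)%N ->
  (w ^+ p)`_k *+ k = (iter p.-1 polycomm x%:P)`_k.-1.
Proof.
case: k => // k _; rewrite -coef_deriv deriv_wX.
pose L : {additive {poly R} -> {poly R}} := w \*o idfun.
pose S : {additive {poly R} -> {poly R}} := w \o* idfun.
have commLS v : L (S v) = S (L v) by rewrite /L /S /= mulrA.
have charP (P : {poly R}) : P *+ p = 0 by apply/polyP => i; rewrite coefMn charR coef0.
have := @iter_sub_pred p p_pr _ charP L S commLS x%:P.
rewrite -[LHS]/(iter p.-1 polycomm x%:P) => ->; congr (nth 0 (polyseq _) _).
apply: eq_bigr => i _.
have -> m v : iter m S v = v * w ^+ m.
  elim: m => [|m IHm] /=; first by rewrite expr0 mulr1.
  by rewrite IHm -mulrA -exprSr.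
elim: (p.-1 - i)%N => [|m IHm] /=; first by rewrite mul1r.
by rewrite -IHm /L /= exprS !mulrA.
Qed.

(** At $t=1$ the polynomial $(tx+y)^p$ is the sum of its coefficients, the extreme ones being $y^p$
    and $x^p$. *)
Lemma jacobson_sum :
  (x + y) ^+ p = x ^+ p + y ^+ p + \sum_(1 <= k < p) (w ^+ p)`_k.
Proof.
have p_gt0 := prime_gt0 p_pr.
rewrite wX_sum big_ord_recr /= wX_lead addrC -addrA; congr (_ + _).
by rewrite -(big_mkord xpredT (fun k => (w ^+ p)`_k)) big_ltn // wX_0.
Qed.

End Jacobson.

Section JacobsonHom.
Variables (F : fieldType) (p : nat) (hp : p \in [pchar F]).
Variables (G : zmodType) (eps : G -> G -> F) (heps : bicharacter eps).
Variables (V : lmodType F) (gr : G -> set V) (br : V -> V -> V).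
Hypothesis hg : is_lie_color eps gr br.
Variables (A : pzAlgType F) (h : V -> A).
Hypothesis h_lin : linear h.
Hypothesis h_br : forall a b x y, gr a x -> gr b y ->
  h (br x y) = h x * h y - eps a b *: (h y * h x).

Lemma bichar_mulrn a b n : eps a (b *+ n) = eps a b ^+ n.
Proof.
elim: n => [|n IHn]; last by rewrite mulrS (bichar_addr heps) IHn exprS.
rewrite mulr0n expr0; have := bichar_addr heps a 0 0; rewrite addr0 => E.
have e0 : eps a 0 != 0.
  by apply/eqP => e0; have := bichar_inv heps a 0; rewrite e0 mul0r => /esym/eqP;
    rewrite oner_eq0.
by apply: (mulfI e0); rewrite mulr1 -E.
Qed.

(** All brackets involved have color factor 1 because [eps a a = 1], so [h] carries the coefficients
    of iterated brackets to those of ordinary iterated commutators of polynomials. *)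
Lemma jacobson_hom a x y : eps a a = 1 -> gr a x -> gr a y ->
  (h x + h y) ^+ p = h x ^+ p + h y ^+ p + h (\sum_(1 <= i < p) jacobson_s p br i x y).
Proof.
move=> aa ax ay; have p_pr := pcharf_prime hp; have p_gt0 := prime_gt0 p_pr.
(* Polynomials are formed over a nonzero ring; in the zero algebra the identity is trivial. *)
have [A0|A1] := eqVneq (1 : A) 0.
  have all0 (z : A) : z = 0 by rewrite -[z]mul1r A0 mul0r.
  by rewrite [LHS]all0 [RHS]all0.
pose R : nzRingType := HB.pack (PzAlgebra.sort A) (GRing.PzSemiRing_isNonZero.Build
  (PzAlgebra.sort A) A1).
have charR (v : R) : v *+ p = 0 := pchar_pzalg hp (v : A).
have := jacobson_sum p_pr (h x : R) (h y : R).
rewrite -[LHS]/((h x + h y : A) ^+ p) => ->; congr (_ + _).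
pose P0 k := if k is 0%N then x else 0 : V.
have gsub b := grading_sub (lie_grading hg) b.
have coefE m k : gr (a *+ m.+1) (iter m (ad_txy br x y) P0 k) /\
    h (iter m (ad_txy br x y) P0 k) =
    (iter m (polycomm (h x : R) (h y : R)) (h x : R)%:P)`_k.
  elim: m k => [|m IHm] k.
    rewrite (_ : iter 0 _ _ = (h x : R)%:P) // coefC /P0.
    case: k => [|k]; split=> //; last exact: linear_map0.
    exact: (subspace0 (gsub _)).
  have brE z k' : gr a z -> gr (a *+ m.+2) (br z (iter m (ad_txy br x y) P0 k')) /\
      h (br z (iter m (ad_txy br x y) P0 k')) =
      (h z : R) * (iter m (polycomm (h x : R) (h y : R)) (h x : R)%:P)`_k' -
      (iter m (polycomm (h x : R) (h y : R)) (h x : R)%:P)`_k' * (h z : R).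
    move=> az; have [gk hk] := IHm k'; split.
      by rewrite mulrS; exact: (lie_graded hg az gk).
    by rewrite (h_br az gk) hk bichar_mulrn aa expr1n scale1r.
  rewrite !iterS coef_polycomm {1 2}/ad_txy; case: k => [|k].
    have [g1 h1] := brE y 0%N ay.
    split; first by rewrite add0r.
    by rewrite (linear_mapD h_lin) h1 (linear_map0 h_lin).
  have [g1 h1] := brE x k ax; have [g2 h2] := brE y k.+1 ay.
  split; first exact: (subspaceD (gsub _)).
  by rewrite (linear_mapD h_lin) h1 h2.
rewrite (linear_map_sum h_lin); apply: eq_big_nat => k /andP[k_gt0 lt_kp].
rewrite (linear_mapZ h_lin); have [_ ->] := coefE p.-1 k.-1.
have scaleK (v : A) : k%:R^-1 *: (v *+ k) = v.
  rewrite -scaler_nat scalerA mulVf ?scale1r //.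
  by rewrite -(dvdn_pcharf hp) gtnNdvd.
by rewrite -(jacobson_coef p_pr charR) //; apply/esym/scaleK.
Qed.

End JacobsonHom.

(** * Linear identities with noncommutative atoms *)

(** Reflected linear combinations: comparing the coefficients of each atom turns an identity between
    noncommutative monomials into scalar identities for [ring]. *)
Inductive lin_expr (F : Type) : Type :=
  | LAtom of nat | LZero | LAdd of lin_expr F & lin_expr F | LOpp of lin_expr F
  | LScale of F & lin_expr F.
Arguments LAtom {F} _.
Arguments LZero {F}.

Section LinearExpressions.
Variables (F : fieldType) (V : lmodType F) (env : seq V).

Fixpoint leval (e : lin_expr F) : V :=
  match e with
  | LAtom n => env`_n
  | LZero => 0%R
  | LAdd e1 e2 => leval e1 + leval e2
  | LOpp e1 => - leval e1
  | LScale a e1 => a *: leval e1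
  end.

Fixpoint lcoef (e : lin_expr F) (k : nat) : F :=
  match e with
  | LAtom n => (if eqn n k then 1 else 0)%R
  | LZero => 0%R
  | LAdd e1 e2 => lcoef e1 k + lcoef e2 k
  | LOpp e1 => - lcoef e1 k
  | LScale a e1 => a * lcoef e1 k
  end.

Lemma leval_coef e : leval e = \sum_(k < size env) lcoef e k *: env`_k.
Proof.
elim: e => [n||e1 IH1 e2 IH2|e1 IH1|a e1 IH1] /=.
- transitivity (\sum_(k < size env) (if n == k :> nat then env`_k else 0)); last first.
    by apply: eq_bigr => k _; rewrite -[eqn n k]/(n == k); case: eqP;
      rewrite ?scale1r ?scale0r.
  have [lt_n|le_n] := ltnP n (size env).
    rewrite (bigD1 (Ordinal lt_n)) //= eqxx big1 ?addr0 // => k.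
    by rewrite -val_eqE eq_sym => /negPf /= ->.
  rewrite nth_default // big1 // => k _.
  by rewrite gtn_eqF // (leq_trans (ltn_ord k)).
- by rewrite big1 // => k _; rewrite scale0r.
- by rewrite IH1 IH2 -big_split; apply: eq_bigr => k _; rewrite scalerDl.
- by rewrite IH1 -sumrN; apply: eq_bigr => k _; rewrite scaleNr.
- by rewrite IH1 scaler_sumr; apply: eq_bigr => k _; rewrite scalerA.
Qed.

Fixpoint coef_eqs (e1 e2 : lin_expr F) (n : nat) : Prop :=
  if n is n'.+1 then coef_eqs e1 e2 n' /\ lcoef e1 n' = lcoef e2 n' else True.

Lemma leval_eq e1 e2 : coef_eqs e1 e2 (size env) -> leval e1 = leval e2.
Proof.
rewrite !leval_coef => H; apply: eq_bigr => k _; congr (_ *: _).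
suff E n : coef_eqs e1 e2 n -> forall i, (i < n)%N -> lcoef e1 i = lcoef e2 i.
  exact: E H k (ltn_ord k).
elim: n => //= n IHn [H1 H2] i; rewrite ltnS leq_eqVlt => /orP[/eqP->//|].
exact: IHn.
Qed.

End LinearExpressions.

(* Syntactic equality up to the inference paths of the ring structure. *)
Ltac same_atom a b :=
  lazymatch a with
  | (?a1 * ?a2)%R =>
    lazymatch b with (?b1 * ?b2)%R => same_atom a1 b1; same_atom a2 b2 end
  | (?a1 ^+ ?n)%R => lazymatch b with (?b1 ^+ n)%R => same_atom a1 b1 end
  | _ => constr_eq_strict a b
  end.

Ltac lin_index x l :=
  match l with
  | ?y :: _ => let _ := match goal with _ => same_atom x y end in constr:(0%N)
  | _ :: ?l' => let n := lin_index x l' in constr:(S n)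
  end.

Ltac lin_mem x l :=
  match l with
  | nil => constr:(false)
  | ?y :: _ => let _ := match goal with _ => same_atom x y end in constr:(true)
  | _ :: ?l' => lin_mem x l'
  end.

Ltac lin_atoms t l :=
  lazymatch t with
  | (?a + ?b)%R => let l1 := lin_atoms a l in lin_atoms b l1
  | (- ?a)%R => lin_atoms a l
  | (_ *: ?a)%R => lin_atoms a l
  | 0%R => l
  | _ => let m := lin_mem t l in
         lazymatch m with true => l | false => constr:(t :: l) end
  end.

Ltac lin_reify F t l :=
  lazymatch t with
  | (?a + ?b)%R => let ea := lin_reify F a l in let eb := lin_reify F b l in
                   constr:(@LAdd F ea eb)
  | (- ?a)%R => let ea := lin_reify F a l in constr:(@LOpp F ea)
  | (?c *: ?a)%R => let ea := lin_reify F a l in constr:(@LScale F c ea)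
  | 0%R => constr:(@LZero F)
  | _ => let n := lin_index t l in constr:(@LAtom F n)
  end.

(* Reduces an equality in an [F]-module [V] to the equalities of the           *)
(* coefficients of its atoms.                                                  *)
Ltac lin_eq F V :=
  lazymatch goal with
  | |- @eq _ ?a ?b =>
    let l0 := constr:(@nil V) in
    let l1 := lin_atoms a l0 in
    let l2 := lin_atoms b l1 in
    let ea := lin_reify F a l2 in
    let eb := lin_reify F b l2 in
    apply: (@leval_eq _ V l2 ea eb); cbn [size coef_eqs lcoef eqn]; repeat split
  end.

(** * Resolution of the overlaps *)

Section Words.
Variables (X : eqType) (ltX : rel X) (wt : X -> nat).
Implicit Types (s t u v : seq X).

Definition wtw s : nat := (\sum_(x <- s) wt x)%N.

Fixpoint inv s : nat :=
  if s is x :: s' then (count (ltX^~ x) s' + inv s')%N else 0%N.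

Definition word_lt s t : Prop :=
  (wtw s < wtw t)%N \/ perm_eq s t /\ (inv s < inv t)%N.

Lemma wtw_cat s t : wtw (s ++ t) = (wtw s + wtw t)%N.
Proof. exact: big_cat. Qed.

Lemma wtw_cons x s : wtw (x :: s) = (wt x + wtw s)%N.
Proof. exact: big_cons. Qed.

Lemma wtw_nil : wtw [::] = 0%N. Proof. exact: big_nil. Qed.

Lemma wtw_nseq n x : wtw (nseq n x) = (n * wt x)%N.
Proof. by elim: n => [|n IHn]; rewrite /= ?wtw_nil // wtw_cons IHn mulSn. Qed.

Lemma wtw_perm s t : perm_eq s t -> wtw s = wtw t.
Proof. exact: perm_big. Qed.

Lemma inv_cat s t : inv (s ++ t) = (inv s + inv t + \sum_(x <- s) count (ltX^~ x) t)%N.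
Proof.
elim: s => [|x s IHs] /=; first by rewrite big_nil addn0.
by rewrite big_cons count_cat IHs; lia.
Qed.

Lemma inv_ctx u s t v :
  perm_eq s t -> (inv s < inv t)%N -> (inv (u ++ s ++ v) < inv (u ++ t ++ v))%N.
Proof.
move=> st lt_st; rewrite !inv_cat (perm_big _ st) /=.
have -> : (\sum_(x <- u) count (ltX^~ x) (s ++ v) =
           \sum_(x <- u) count (ltX^~ x) (t ++ v))%N.
  by apply: eq_bigr => x _; rewrite !count_cat (permP st).
by rewrite !ltn_add2r ltn_add2l ltn_add2r ltn_add2r.
Qed.

Lemma word_lt_ctx u s t v : word_lt s t -> word_lt (u ++ s ++ v) (u ++ t ++ v).
Proof.
case=> [lt_st|[st lt_st]]; [left|right].
  by rewrite !wtw_cat ltn_add2l ltn_add2r.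
by split; [rewrite perm_cat2l perm_cat2r | exact: inv_ctx].
Qed.

(** Lexicographic descent on weight and inversions; a step of the second kind permutes the letters
    and so keeps the weight. *)
Lemma word_lt_wf : well_founded word_lt.
Proof.
have H n : forall m s, (wtw s <= n)%N -> (inv s <= m)%N -> Acc word_lt s.
  elim: n => [|n IHn]; elim=> [|m IHm] s le_sn le_sm; constructor => t;
    case=> [|[/wtw_perm E]] lt_ts; try lia.
  - by apply: IHm; lia.
  - by apply: (IHn (inv t)); lia.
  - by apply: (IHn (inv t)); lia.
  - by apply: IHm; lia.
by move=> s; apply: (H (wtw s) (inv s)).
Qed.

End Words.

Lemma sum_ord_predl (V : zmodType) n (f : nat -> V) : (0 < n)%N ->
  \sum_(i < n) f i = f 0%N + \sum_(i < n.-1) f i.+1.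
Proof. by case: n => // n _; rewrite big_ord_recl. Qed.

Lemma sum_ord_predr (V : zmodType) n (f : nat -> V) : (0 < n)%N ->
  \sum_(i < n) f i = \sum_(i < n.-1) f i + f n.-1.
Proof. by case: n => // n _; rewrite big_ord_recr. Qed.

Section Insertions.
Variables (X : eqType) (ltX : rel X).
Hypothesis ltX_asym : forall x y, ltX x y -> ~~ ltX y x.

Lemma ltX_irr x : ltX x x = false.
Proof. by apply/negP => ltxx; have := ltX_asym ltxx; rewrite ltxx. Qed.

Lemma inv_nseq n (x : X) : inv ltX (nseq n x) = 0%N.
Proof. by elim: n => //= n ->; rewrite count_nseq ltX_irr mul0n. Qed.

(** The comparisons act as 0 or 1. The count is linear in the position of [y], which ranks the
    summands of the commutator of a power with [y]. *)
Lemma inv_insert a b (x y : X) :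
  inv ltX (nseq a x ++ y :: nseq b x) = (ltX x y * b + a * ltX y x)%N.
Proof.
elim: a => [|a IHa] /=; first by rewrite inv_nseq count_nseq.
by rewrite IHa count_cat /= !count_nseq ltX_irr; lia.
Qed.

Lemma perm_insert a b c d (x y : X) : (a + b = c + d)%N ->
  perm_eq (nseq a x ++ y :: nseq b x) (nseq c x ++ y :: nseq d x).
Proof.
by move=> E; apply/permP => P; rewrite !count_cat /= !count_nseq; case: (P x); lia.
Qed.

End Insertions.

Section Straightening.
Variables (F : fieldType) (X : eqType) (A : pzAlgType F) (word : seq X -> A).
Hypothesis hA : is_free_on word.
Implicit Types (u v s t : seq X) (x y z : X) (a b r : A).
Variable ltX : rel X.
Hypothesis ltX_asym : forall x y, ltX x y -> ~~ ltX y x.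
Hypothesis ltX_trans : transitive ltX.
Hypothesis ltX_total : forall x y, x != y -> ltX x y || ltX y x.
Variables (wt : X -> nat) (ep : X -> X -> F) (br : X -> X -> A).
Variables (mexp : X -> nat) (D : X -> A).
Hypothesis ep_inv : forall x y, ep x y * ep y x = 1.
Hypothesis br_skew : forall x y, br x y = - (ep x y *: br y x).

Let wtw := wtw wt.
Let lt := word_lt ltX wt.
Let L x := word [:: x].

Definition Wle n : set A := lspan [set a | exists2 t, (wtw t <= n)%N & a = word t].

Definition rel_swap x y : A := tw_comm (ep x y) (L x) (L y) - br x y.

(* Modulo [LR n] one may use every relation, in any context, as long as the    *)
(* total weight stays below [n]; in use, [n] is the weight of an overlap.      *)
Definition LRgen n : set A := [set a | exists u v r k,
  [/\ (exists x y, r = rel_swap x y /\ k = (wt x + wt y)%N) \/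
      (exists x, r = D x /\ k = (mexp x * wt x)%N),
      (wtw u + k + wtw v < n)%N & a = word u * r * word v]].

Definition LR n : set A := lspan (LRgen n).

Lemma LR_subspace n : is_subspace (LR n). Proof. exact: lspan_subspace. Qed.

Lemma Wle_subspace n : is_subspace (Wle n). Proof. exact: lspan_subspace. Qed.

Lemma LR_mono n n' a : (n <= n')%N -> LR n a -> LR n' a.
Proof.
move=> le_n; move: a; apply: lspan_min (LR_subspace _) _ => _ [u [v [r [k [rk lt_n ->]]]]].
by apply: lspan_incl; exists u, v, r, k; split=> //; apply: leq_trans le_n.
Qed.

Lemma Wle_mono n n' a : (n <= n')%N -> Wle n a -> Wle n' a.
Proof.
move=> le_n; move: a; apply: lspan_min (Wle_subspace _) _ => _ [t tn ->].
by apply: lspan_incl; exists t => //; apply: leq_trans le_n.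
Qed.

Lemma Wle_word n t : (wtw t <= n)%N -> Wle n (word t).
Proof. by move=> le_n; apply: lspan_incl; exists t. Qed.

Lemma Wle1 n : Wle n 1.
Proof. by rewrite -(free_on_nil hA); apply: Wle_word; rewrite /wtw wtw_nil. Qed.

Lemma WleM n n' a b : Wle n a -> Wle n' b -> Wle (n + n') (a * b).
Proof.
move=> an bn; move: a an.
apply: lspan_min (preim_subspace (mul_linear_r b) (Wle_subspace _)) _ => _ [s sn ->] /=.
move: b bn.
apply: lspan_min (preim_subspace (mul_linear_l _) (Wle_subspace _)) _ => _ [t tn ->] /=.
by rewrite -(free_on_cat hA); apply: Wle_word; rewrite /wtw wtw_cat leq_add.
Qed.

Lemma WleX n k a : Wle n a -> Wle (k * n) (a ^+ k).
Proof.
move=> an; elim: k => [|k IHk]; first by rewrite expr0; exact: Wle1.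
by rewrite exprS mulSn; apply: WleM.
Qed.

Lemma LR_mulr n n' a r : Wle n' a -> LR n r -> LR (n + n') (r * a).
Proof.
move=> an rn; move: a an.
apply: lspan_min (preim_subspace (mul_linear_l r) (LR_subspace _)) _ => _ [t tn ->] /=.
move: r rn.
apply: lspan_min (preim_subspace (mul_linear_r _) (LR_subspace _)) _.
move=> _ [u [v [r [k [rk lt_n ->]]]]] /=; apply: lspan_incl; exists u, (v ++ t), r, k.
split=> //; last by rewrite (free_on_cat hA) !mulrA.
by rewrite /wtw wtw_cat; move: lt_n tn; rewrite /wtw; lia.
Qed.

Lemma LR_mull n n' a r : Wle n' a -> LR n r -> LR (n' + n) (a * r).
Proof.
move=> an rn; move: a an.
apply: lspan_min (preim_subspace (mul_linear_r r) (LR_subspace _)) _ => _ [t tn ->] /=.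
move: r rn.
apply: lspan_min (preim_subspace (mul_linear_l _) (LR_subspace _)) _.
move=> _ [u [v [r [k [rk lt_n ->]]]]] /=; apply: lspan_incl; exists (t ++ u), v, r, k.
split=> //; last by rewrite (free_on_cat hA) !mulrA.
by rewrite /wtw wtw_cat; move: lt_n tn; rewrite /wtw; lia.
Qed.

Lemma LR_swap n x y : (wt x + wt y < n)%N -> LR n (rel_swap x y).
Proof.
move=> lt_n; apply: lspan_incl; exists [::], [::], (rel_swap x y), (wt x + wt y)%N.
split; [by left; exists x, y | by rewrite /wtw wtw_nil addn0 |].
by rewrite (free_on_nil hA) mulr1 mul1r.
Qed.

Hypothesis wt_bounds : forall x, (2 <= wt x <= 3)%N.
Hypothesis br_wt : forall x y, Wle 3 (br x y).
Hypothesis mexp_gt1 : forall x, (1 < mexp x)%N.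
Hypothesis D_lead : forall x, Wle (mexp x * wt x).-1 (word (nseq (mexp x) x) - D x).
Hypothesis rel_diag : forall x, rel_swap x x = 0 \/
  mexp x = 2%N /\ exists k, rel_swap x x = k *: D x.
(* The summands of index [i = 0] and [i = mexp x - 1] are the two swaps that    *)
(* compete with the power rule in the overlaps x^m y and y x^m.                *)
Hypothesis D_comm : forall x y,
  LR (mexp x * wt x + wt y)
   (tw_comm (ep x y ^+ mexp x) (D x) (L y) -
    \sum_(i < mexp x)
      ep x y ^+ i *: (L x ^+ ((mexp x).-1 - i) * rel_swap x y * L x ^+ i)).
Hypothesis D_comm_self : forall x, LR (mexp x * wt x + wt x) (D x * L x - L x * D x).
Hypothesis jacobi : forall x y z,
  LR (wt z + wt y + wt x)
    (tw_comm (ep z x * ep y x) (br z y) (L x)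
     - tw_comm (ep z y * ep z x) (L z) (br y x)
     + ep z y *: tw_comm (ep y z * ep y x) (L y) (br z x)).

Arguments br_wt : clear implicits.
Arguments D_lead : clear implicits.
Arguments D_comm : clear implicits.
Arguments D_comm_self : clear implicits.
Arguments jacobi : clear implicits.

(** Right-hand sides are written as leading word minus relation, so that [word s - r] gives the
    relation back. *)
Definition rule s r : Prop :=
  (exists x y, [/\ ltX y x, s = [:: x; y] & r = word s - rel_swap x y]) \/
  (exists x, s = nseq (mexp x) x /\ r = word s - D x).

(** A transposition removes one inversion; its bracket term has weight at most 3, while two letters
    weigh at least 4. Power rules lower the weight by [D_lead]. *)
Lemma rule_lt s r : rule s r -> lspan [set a | exists2 t,
  forall u v, lt (u ++ t ++ v) (u ++ s ++ v) & a = word t] r.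
Proof.
move=> sr; have low n a : (n < wtw s)%N -> Wle n a -> lspan [set a | exists2 t,
  forall u v, lt (u ++ t ++ v) (u ++ s ++ v) & a = word t] a.
  move=> lt_n; move: a; apply: lspan_min (lspan_subspace _) _ => _ [t tn ->].
  apply: lspan_incl; exists t => // u v; apply: word_lt_ctx; left.
  exact: leq_ltn_trans tn lt_n.
case: sr low => [[x [y [ltyx -> ->]]]|[x [-> ->]]] low; last first.
  apply: low (D_lead x); rewrite /wtw wtw_nseq.
  have := mexp_gt1 x; have /andP[] := wt_bounds x; case: (mexp x) => [|[|n]] //; lia.
have -> : word [:: x; y] - rel_swap x y = ep x y *: word [:: y; x] + br x y.
  rewrite /rel_swap /tw_comm /L (free_on_cat hA [:: x] [:: y]) (free_on_cat hA [:: y] [::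
    x]).
  by lin_eq F A; ring.
apply: (subspaceD (lspan_subspace _)); last first.
  apply: low (br_wt x y); rewrite /wtw !wtw_cons wtw_nil.
  by have /andP[] := wt_bounds x; have /andP[] := wt_bounds y; lia.
apply: (subspaceZ (lspan_subspace _)); apply: lspan_incl; exists [:: y; x] => // u v.
apply: word_lt_ctx; right; split.
  exact/permPl/(perm_catC [:: y] [:: x]).
by rewrite /= ltyx (negPf (ltX_asym ltyx)).
Qed.

Section Ambiguity.
Variables (W : set A) (w : seq X).
Hypothesis hW : is_subspace W.
Hypothesis W_rule : forall u s r v, rule s r -> lt (u ++ s ++ v) w ->
  W (word u * (word s - r) * word v).

Let W_swap u x y v : ltX y x -> lt (u ++ [:: x; y] ++ v) w ->
  W (word u * rel_swap x y * word v).
Proof.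
move=> ltyx lt_w; rewrite -[rel_swap x y](subKr (word [:: x; y])).
by apply: W_rule lt_w; left; exists x, y.
Qed.

Let W_pow u x v : lt (u ++ nseq (mexp x) x ++ v) w -> W (word u * D x * word v).
Proof.
move=> lt_w; rewrite -[D x](subKr (word (nseq (mexp x) x))).
by apply: W_rule lt_w; right; exists x.
Qed.

Lemma rel_swap_skew x y : rel_swap x y = - (ep x y *: rel_swap y x).
Proof.
rewrite /rel_swap /tw_comm br_skew.
by lin_eq F A; ring: (ep_inv x y).
Qed.

(** A relation of weight below that of [w] is available in any context. Swaps that are not rules
    reduce to rules by skew symmetry, and on the diagonal by [rel_diag]. *)
Let W_LR a : LR (wtw w) a -> W a.
Proof.
move: a; apply: lspan_min hW _ => _ [u [v [r [k [rk lt_w ->]]]]].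
have W_powlt x : k = (mexp x * wt x)%N -> W (word u * D x * word v).
  by move=> kE; apply: W_pow; left; rewrite !wtw_cat wtw_nseq -kE addnA.
case: rk => [[x [y [-> kE]]]|[x [-> kE]]]; last exact: W_powlt.
have ltw y1 y2 : k = (wt y1 + wt y2)%N -> lt (u ++ [:: y1; y2] ++ v) w.
  by move=> kE'; left; rewrite !wtw_cat !wtw_cons wtw_nil addn0 -kE' addnA.
have [xy|/ltX_total/orP[ltxy|ltyx]] := eqVneq x y.
- rewrite -xy; have [->|[mx [c ->]]] := rel_diag x.
    by rewrite mulr0 mul0r; exact: subspace0.
  rewrite -pzscalerAr -pzscalerAl; apply: (subspaceZ hW); apply: W_powlt.
  by rewrite kE -xy mx; lia.
- rewrite rel_swap_skew mulrN mulNr -pzscalerAr -pzscalerAl.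
  by apply/(subspaceN hW)/(subspaceZ hW)/W_swap => //; apply: ltw; rewrite kE addnC.
- exact/W_swap/ltw.
Qed.

Let W_ctx u v a b r : a = r + b ->
  W (word u * r * word v) -> W (word u * b * word v) -> W (word u * a * word v).
Proof. by move=> -> Wr Wb; rewrite mulrDr mulrDl; exact: (subspaceD hW). Qed.

Let W_ctxLR u v n a : (wtw u + n + wtw v <= wtw w)%N -> LR n a ->
  W (word u * a * word v).
Proof.
move=> le_n an; apply: W_LR; apply: LR_mono le_n _.
by apply: LR_mulr; [exact: Wle_word | apply: LR_mull; [exact: Wle_word|]].
Qed.

(** The two ways of sorting z y x differ by the Jacobi expression and four swaps, each inside a
    permutation of z y x with fewer than its three inversions. *)
Let swap_swap u x y z v : ltX x y -> ltX y z -> w = u ++ [:: z; y; x] ++ v ->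
  W (word u * (L z * rel_swap y x - rel_swap z y * L x) * word v).
Proof.
move=> ltxy ltyz wE; have ltxz := ltX_trans ltxy ltyz.
have [nyx nzy nzx] := And3 (negPf (ltX_asym ltxy)) (negPf (ltX_asym ltyz)) (negPf
  (ltX_asym ltxz)).
have lw t : perm_eq t [:: z; y; x] -> (inv ltX t < 3)%N -> lt (u ++ t ++ v) w.
  move=> tp ti; rewrite wE; apply: word_lt_ctx; right; split=> //.
  by apply: leq_trans ti _; rewrite /= ltxy ltyz ltxz.
have perm3 t : (forall P : pred X, count P t = count P [:: z; y; x]) -> perm_eq t [:: z;
  y; x].
  by move=> tP; apply/permP.
apply: (W_ctx (r := tw_comm (ep z x * ep y x) (br z y) (L x)
     - tw_comm (ep z y * ep z x) (L z) (br y x)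
     + ep z y *: tw_comm (ep y z * ep y x) (L y) (br z x))
  (b := - (ep y x *: (rel_swap z x * L y)) - (ep y x * ep z x) *: (L x * rel_swap z y)
  + ep z y *: (L y * rel_swap z x) + (ep z y * ep z x) *: (rel_swap y x * L z))).
- rewrite /rel_swap /tw_comm !(mulrBr, mulrBl) -!(pzscalerAl, pzscalerAr).
  rewrite !mulrA; lin_eq F A; ring: (ep_inv z y).
- by apply: (W_ctxLR _ (jacobi x y z)); rewrite wE /wtw !wtw_cat !wtw_cons wtw_nil; lia.
have wL1 y1 : word u * L y1 = word (u ++ [:: y1]) by rewrite (free_on_cat hA).
have wL2 y1 : L y1 * word v = word ([:: y1] ++ v) by rewrite (free_on_cat hA).
have hW' := preim_subspace (mul_linear_lr (word u) (word v)) hW.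
apply: (subspaceD hW'); first (apply: (subspaceD hW'); first apply: (subspaceD hW')).
- apply/(subspaceN hW')/(subspaceZ hW'); rewrite /mkset -!mulrA wL2 mulrA;
    apply: W_swap => //.
  by apply: (lw [:: z; x; y]); [apply: perm3 => P /=;
    lia | rewrite /= ?ltxy ?ltxz ?ltyz ?nyx ?nzy ?nzx].
- apply/(subspaceN hW')/(subspaceZ hW'); rewrite /mkset mulrA wL1; apply: W_swap => //.
  by rewrite -catA; apply: (lw [:: x; z; y]); [apply: perm3 => P /=;
    lia | rewrite /= ?ltxy ?ltxz ?ltyz ?nyx ?nzy ?nzx].
- apply/(subspaceZ hW'); rewrite /mkset mulrA wL1; apply: W_swap => //.
  by rewrite -catA; apply: (lw [:: y; z; x]); [apply: perm3 => P /=;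
    lia | rewrite /= ?ltxy ?ltxz ?ltyz ?nyx ?nzy ?nzx].
- apply/(subspaceZ hW'); rewrite /mkset -!mulrA wL2 mulrA; apply: W_swap => //.
  by apply: (lw [:: y; x; z]); [apply: perm3 => P /=;
    lia | rewrite /= ?ltxy ?ltxz ?ltyz ?nyx ?nzy ?nzx].
Qed.

Let wordX n x : L x ^+ n = word (nseq n x). Proof. exact: free_on_nseq. Qed.

Let hWc u v := preim_subspace (mul_linear_lr (word u) (word v)) hW.

Let lt_insert u v (i j k l : nat) x y : (i + j = k + l)%N ->
  w = u ++ (nseq k x ++ y :: nseq l x) ++ v ->
  (ltX x y * j + i * ltX y x < ltX x y * l + k * ltX y x)%N ->
  lt (u ++ (nseq i x ++ y :: nseq j x) ++ v) w.
Proof.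
move=> E -> lt_inv; apply: word_lt_ctx; right.
by rewrite !inv_insert //; split=> //; apply: perm_insert.
Qed.

(** In [D_comm] the summand of index 0 is the competing swap. The summand of index i > 0 has leading
    word $x^{m-i}yx^i$, with fewer inversions than $x^m y$, where m = [mexp x]. *)
Let pow_swap u x y v : ltX y x -> w = u ++ (nseq (mexp x) x ++ [:: y]) ++ v ->
  W (word u * (L x ^+ (mexp x).-1 * rel_swap x y - D x * L y) * word v).
Proof.
move=> ltyx wE; have nxy := negPf (ltX_asym ltyx).
set k := mexp x in wE *; set S := \sum_(i < k.-1)
  ep x y ^+ i.+1 *: (L x ^+ (k.-1 - i.+1) * rel_swap x y * L x ^+ i.+1).
have k_gt1 : (1 < k)%N := mexp_gt1 x.
have wE' : w = u ++ (nseq k x ++ y :: nseq 0 x) ++ v by [].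
apply: (@W_ctx _ _ _ (- (ep x y ^+ k *: (L y * D x)) - S) (- (tw_comm (ep x y ^+ k) (D x)
  (L y) -
    \sum_(i < k) ep x y ^+ i *: (L x ^+ (k.-1 - i) * rel_swap x y * L x ^+ i)))).
- rewrite (sum_ord_predl (fun i =>
    ep x y ^+ i *: (L x ^+ (k.-1 - i) * _ * L x ^+ i)) (ltnW k_gt1)).
  rewrite subn0 expr0 scale1r mulr1.
  by rewrite -/S /tw_comm; lin_eq F A; ring.
- rewrite mulrN mulNr; apply: (subspaceN hW); apply: (W_ctxLR _ (D_comm x y)).
  by rewrite wE /wtw !wtw_cat wtw_nseq wtw_cons wtw_nil; lia.
apply: (subspaceB (hWc u v)).
  apply/(subspaceN (hWc u v))/(subspaceZ (hWc u v)); rewrite /mkset mulrA -(free_on_cat hA).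
  apply: W_pow; rewrite -/k; have := @lt_insert u v 0 k k 0 x y (addnC _ _) wE'.
  by rewrite nxy ltyx -!catA /= !mul0n add0n muln1; apply; rewrite (ltnW k_gt1).
apply: (subspace_sum (hWc u v)) => i _; apply: (subspaceZ (hWc u v)).
rewrite /mkset !wordX !mulrA -(free_on_cat hA) -mulrA -(free_on_cat hA);
  apply: W_swap => //.
have := @lt_insert u v (k.-1 - i.+1).+1 i.+1 k 0 x y _ wE'.
rewrite nxy ltyx -addn1 nseqD -!catA /=; apply; have := ltn_ord i; lia.
Qed.

(** The mirror image of [pow_swap]: after scaling [D_comm] by [ep y x ^+ mexp x], its last summand
    becomes the competing swap. *)
Let swap_pow u x y v : ltX x y -> w = u ++ (y :: nseq (mexp x) x) ++ v ->
  W (word u * (L y * D x - rel_swap y x * L x ^+ (mexp x).-1) * word v).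
Proof.
move=> ltxy wE; have nyx := negPf (ltX_asym ltxy).
set k := mexp x in wE *; set S := \sum_(i < k.-1)
  ep x y ^+ i *: (L x ^+ (k.-1 - i) * rel_swap x y * L x ^+ i).
have k_gt1 : (1 < k)%N := mexp_gt1 x.
have wE' : w = u ++ (nseq 0 x ++ y :: nseq k x) ++ v by [].
have eK : ep y x ^+ k * ep x y ^+ k = 1 by rewrite -exprMn ep_inv expr1n.
(* The coefficient of the last summand after scaling, times the factor [ep x y] coming from skew
   symmetry. *)
have eE : ep y x ^+ k * ep x y ^+ k.-1 * ep x y = 1 by
  rewrite -mulrA -exprSr prednK // ltnW.
apply: (@W_ctx _ _ _ (ep y x ^+ k *: (D x * L y - S))
   (- (ep y x ^+ k *: (tw_comm (ep x y ^+ k) (D x) (L y) -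
    \sum_(i < k) ep x y ^+ i *: (L x ^+ (k.-1 - i) * rel_swap x y * L x ^+ i))))).
- rewrite (sum_ord_predr (fun i =>
    ep x y ^+ i *: (L x ^+ (k.-1 - i) * _ * L x ^+ i)) (ltnW k_gt1)).
  rewrite subnn expr0 mul1r.
  rewrite -/S /tw_comm [rel_swap x y]rel_swap_skew mulNr -pzscalerAl.
  move: (ep y x ^+ k) (ep x y ^+ k) (ep x y ^+ k.-1) eK eE => e1 e2 e3 eK eE.
  by lin_eq F A; first [ring: eK | ring: eE].
- rewrite mulrN mulNr; apply: (subspaceN hW); apply: (subspaceZ (hWc u v)).
  apply: (W_ctxLR _ (D_comm x y)).
  by rewrite wE /wtw !wtw_cat wtw_cons wtw_nseq; lia.
apply: (subspaceZ (hWc u v)); apply: (subspaceB (hWc u v)).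
  rewrite /mkset -!mulrA -(free_on_cat hA) mulrA.
  apply: W_pow; rewrite -/k; have := @lt_insert u v k 0 0 k x y (addnC _ _) wE'.
  by rewrite ltxy nyx -!catA /=; apply; lia.
apply: (subspace_sum (hWc u v)) => i _; apply: (subspaceZ (hWc u v)).
rewrite rel_swap_skew mulrN mulNr -pzscalerAr -pzscalerAl.
apply/(subspaceN (hWc u v))/(subspaceZ (hWc u v)).
rewrite /mkset !wordX !mulrA -(free_on_cat hA) -mulrA -(free_on_cat hA);
  apply: W_swap => //.
have := @lt_insert u v (k.-1 - i) i.+1 0 k x y _ wE'.
rewrite ltxy nyx -!catA /=; apply; have := ltn_ord i; lia.
Qed.

(** Shifted copies of the same power: [D x] commutes with [x] modulo lower relations, hence with its
    powers by telescoping with factor 1. *)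
Let pow_pow u x j v : w = u ++ nseq (j + mexp x) x ++ v ->
  W (word u * (L x ^+ j * D x - D x * L x ^+ j) * word v).
Proof.
move=> wE; case: j wE => [|j] wE.
  by rewrite expr0 mul1r mulr1 subrr mulr0 mul0r; exact: subspace0.
have -> : L x ^+ j.+1 * D x - D x * L x ^+ j.+1 = tw_comm (1 ^+ j.+1) (L x ^+ j.+1) (D x).
  by rewrite /tw_comm expr1n scale1r.
rewrite tw_commX; apply: (subspace_sum (hWc u v)) => i _; apply: (subspaceZ (hWc u v)).
have -> : tw_comm 1 (L x) (D x) = - (D x * L x - L x * D x).
  by rewrite /tw_comm scale1r opprB.
rewrite mulrN mulNr; apply: (subspaceN (hWc u v)).
rewrite /mkset !wordX !mulrA -(free_on_cat hA) -mulrA -(free_on_cat hA).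
apply: (W_ctxLR _ (D_comm_self x)).
rewrite wE /wtw !wtw_cat !wtw_nseq; have := ltn_ord i; nia.
Qed.

(** Unless the occurrences coincide, a swap can meet a later rule only in its second letter, and a
    power can meet a swap only in its last letter, because the letters of a swap are distinct. Two
    powers that meet are powers of one letter. *)
Lemma straightening_ambiguities u s r v u' s' r' v' : rule s r -> rule s' r' ->
  w = u ++ s ++ v -> w = u' ++ s' ++ v' ->
  (size u <= size u' < size u + size s)%N ->
  W (word u * r * word v - word u' * r' * word v').
Proof.
move=> rs rs' wE wE' /andP[le_u lt_u].
have [m u'E smE] := cat_eq_prefix (etrans (esym wE) wE') le_u.
have {lt_u} lt_m : (size m < size s)%N by move: lt_u; rewrite u'E size_cat ltn_add2l.
have word2 x y : word [:: x; y] = L x * L y by rewrite -(free_on_cat hA).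
have wordS x k : (1 < k)%N -> word (nseq k x) = L x ^+ k.-1 * L x.
  by move=> k1; rewrite -exprSr wordX prednK // ltnW.
have wordS' x k : (1 < k)%N -> word (nseq k x) = L x * L x ^+ k.-1.
  by move=> k1; rewrite -exprS wordX prednK // ltnW.
case: rs smE lt_m wE => [[x [y [ltyx -> ->]]]|[x [-> ->]]] smE lt_m wE.
  case: rs' smE wE' => [[x' [y' [ltyx' -> ->]]]|[x' [-> ->]]] smE wE'.
    case: m u'E smE lt_m => [|z [|? ?]] u'E //=.
      move=> [<- <- <-] _; rewrite u'E cats0 subrr; exact: subspace0.
    move=> [zE x'E vE] _; rewrite u'E -zE vE -x'E -(cat1s y' v') !(free_on_cat hA) !word2.
    rewrite -x'E in ltyx' wE'.
    have := swap_swap ltyx' ltyx (_ : w = u ++ _ ++ v'); rewrite u'E -zE -catA in wE'.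
    move=> /(_ wE'); congr W; move: (rel_swap _ _) (rel_swap _ _) => R1 R2.
    by rewrite -/(L x) -/(L y') !(mulrBr, mulrBl) !mulrA; lin_eq F A; ring.
  have [k kE] : exists k, mexp x' = k.+2.
    by have := mexp_gt1 x'; case: (mexp x') => [|[|k]] // _; exists k.
  case: m u'E smE lt_m => [|z [|? ?]] u'E //=.
    by rewrite kE => -[xE yE _] _; move: ltyx; rewrite xE yE (ltX_irr ltX_asym).
  rewrite {1}kE => -[zE yE vE] _; rewrite -yE in kE vE wE' *.
  rewrite u'E -zE -catA in wE'.
  have := swap_pow ltyx wE'.
  have -> : v = nseq (mexp y).-1 y ++ v' by rewrite vE kE.
  rewrite u'E -zE !(free_on_cat hA) word2 (wordS' _ _ (mexp_gt1 y)) -!wordX.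
  congr W; move: (rel_swap _ _) => R1.
  by rewrite -/(L x) !(mulrBr, mulrBl) !mulrA; lin_eq F A; ring.
rewrite size_nseq in lt_m.
have [n] := cat_eq_prefix (esym smE) (leq_trans (ltnW lt_m) (eq_leq (esym (size_nseq _
  _)))).
move=> /esym sE; have mE : m = nseq (size m) x.
  by have := congr1 (take (size m)) sE; rewrite take_size_cat // take_nseq // ltnW.
have nE : n = nseq (mexp x - size m) x.
  by have := congr1 (drop (size m)) sE; rewrite drop_size_cat // drop_nseq.
move=> smE'; have [k kE] : exists k, (mexp x - size m = k.+1)%N.
  by exists (mexp x - size m).-1; rewrite prednK // subn_gt0.
rewrite {}kE in nE; have mexpE : mexp x = (size m + k.+1)%N.
  by rewrite -(size_nseq (mexp x) x) -sE size_cat nE size_nseq.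
case: rs' smE' wE' => [[x' [y' [ltyx' -> ->]]]|[x' [-> ->]]] smE' wE'.
  move: smE'; rewrite nE; case: k nE mexpE => [|k] nE mexpE /=; last first.
    by move=> [xE yE _]; move: ltyx'; rewrite xE yE (ltX_irr ltX_asym).
  move=> [xE vE]; rewrite xE in ltyx' wE' *.
  have mE' : m = nseq (mexp x).-1 x by rewrite {1}mE mexpE addn1.
  have wE1 : w = u ++ (nseq (mexp x) x ++ [:: y']) ++ v' by rewrite wE -vE -!catA.
  have := pow_swap ltyx' wE1; rewrite u'E mE' -vE -(cat1s y' v') !(free_on_cat hA).
  rewrite word2 (wordS _ _ (mexp_gt1 x)) -!wordX -/(L y').
  congr W; move: (rel_swap _ _) => R1.
  by rewrite !(mulrBr, mulrBl) !mulrA; lin_eq F A; ring.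
have xE : x' = x.
  by move: smE'; rewrite nE; have := mexp_gt1 x'; case: (mexp x') => // l _ [].
rewrite xE in smE' wE' *; have vE : v = nseq (size m) x ++ v'.
  move: smE'; rewrite mexpE addnC nseqD -nE -catA => /eqP.
  by rewrite eqseq_cat // eqxx => /eqP.
have wE1 : w = u ++ nseq (size m + mexp x) x ++ v' by rewrite wE' u'E nseqD -mE !catA.
have := pow_pow wE1; rewrite u'E vE [X in word (u ++ X)]mE !(free_on_cat hA) -!wordX.
congr W; rewrite !(mulrBr, mulrBl) !mulrA -!(mulrA (word u)) -!exprD addnC.
by lin_eq F A; ring.
Qed.

End Ambiguity.

End Straightening.

(* [Wle] and [LR] unfold to products, whose binders would become implicit. *)
Arguments Wle_mono {F X A word wt n n' a} _ _.
Arguments LR_mono {F X A word wt ep br mexp D n n' a} _ _.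
Arguments Wle_word {F X A word wt n t} _.
Arguments WleX {F X A word} hA {wt n} k {a} _.
Arguments WleM {F X A word} hA {wt n n' a b} _ _.
Arguments LR_mulr {F X A word} hA {wt ep br mexp D n n' a r} _ _.
Arguments LR_mull {F X A word} hA {wt ep br mexp D n n' a r} _ _.
Arguments LR_swap {F X A word} hA {wt ep br mexp D n x y} _.

(** * Homogeneous bases *)

Section Regrouping.
Variables (V : zmodType) (K : eqType).
Implicit Type l : seq (K * V).

Lemma sum_regroup l :
  \sum_(q <- l) q.2 = \sum_(k <- undup (map fst l)) \sum_(q <- l | q.1 == k) q.2.
Proof.
under [RHS]eq_bigr => k _ do rewrite big_mkcond.
rewrite exchange_big /= big_seq [RHS]big_seq; apply: eq_bigr => q ql.
rewrite (bigD1_seq q.1) ?undup_uniq ?mem_undup ?map_f //= eqxx big1 ?addr0 // => k.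
by rewrite eq_sym => /negPf ->.
Qed.

End Regrouping.

Section LinearCombinations.
Variables (F : fieldType) (K : eqType).

Lemma comb_regroup (V : lmodType F) (t : K -> V) (l : seq (K * F)) :
  \sum_(q <- l) q.2 *: t q.1 =
  \sum_(k <- undup (map fst l)) (\sum_(q <- l | q.1 == k) q.2) *: t k.
Proof.
rewrite -(big_map (fun q => (q.1, q.2 *: t q.1)) xpredT (fun q =>
  q.2)) sum_regroup -map_comp.
rewrite (eq_map (g := fst)) //; apply: eq_bigr => k _.
by rewrite big_map scaler_suml; apply: eq_bigr => q /eqP <-.
Qed.

(** Lists of pairs with repetitions are closed under linear combinations; equal indices are merged
    only at the end. *)
Lemma lspan_comb (V : lmodType F) (D : set K) (t : K -> V) w :
  lspan [set v | exists2 k, D k & v = t k] w ->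
  exists (s : seq K) (a : K -> F),
    (forall k, k \in s -> D k) /\ w = \sum_(k <- s) a k *: t k.
Proof.
pose W w := exists l : seq (K * F),
  (forall q, q \in l -> D q.1) /\ w = \sum_(q <- l) q.2 *: t q.1.
move=> w_span; have [l [lD ->]] : W w.
  move: w w_span; apply: lspan_min => [|_ [k Dk ->]]; last first.
    exists [:: (k, 1)]; rewrite big_seq1 scale1r; split=> // q /[!inE] /eqP ->.
    exact: Dk.
  split; first by exists [::]; rewrite big_nil.
  move=> r x y [l [lD ->]] [l' [lD' ->]].
  exists ([seq (q.1, r * q.2) | q <- l] ++ l'); split.
    by move=> q; rewrite mem_cat => /orP[/mapP[q' /lD ? ->]|/lD'].
  by rewrite big_cat big_map scaler_sumr; congr (_ + _); apply: eq_bigr => q _;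
    rewrite scalerA.
rewrite comb_regroup; exists (undup (map fst l)), (fun k => \sum_(q <- l | q.1 == k) q.2).
by split=> // k; rewrite mem_undup => /mapP[q /lD ? ->].
Qed.

End LinearCombinations.

Section Coordinates.
Variables (F : fieldType) (V : lmodType F) (K : choiceType) (b : K -> V).
Hypothesis hb : is_basis [set: K] b [set: V].

Lemma basis_null (W : lmodType F) (t : K -> W) (l : seq (K * F)) :
  \sum_(q <- l) q.2 *: b q.1 = 0 -> \sum_(q <- l) q.2 *: t q.1 = 0.
Proof.
rewrite !comb_regroup => s0; case: hb => _ free _.
rewrite big_seq big1 // => k ks.
rewrite (free (undup (map fst l)) _ _ (fun k => \sum_(q <- l | q.1 == k) q.2)) ?scale0r //.
exact: undup_uniq.
Qed.

(** The value is read off a chosen expansion of the vector. [basis_null], applied to concatenated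
    expansions, makes the result linear and correct on the basis. *)
Lemma basis_linear (W : lmodType F) (t : K -> W) :
  exists2 h : V -> W, linear h & forall k, h (b k) = t k.
Proof.
have [|l lE] := @choice V (seq (K * F)) (fun v l => v = \sum_(q <- l) q.2 *: b q.1).
  move=> v; case: hb => _ _ /(_ v I) [s [a [_ ->]]].
  by exists [seq (k, a k) | k <- s]; rewrite big_map.
pose h v := \sum_(q <- l v) q.2 *: t q.1.
have scaleE (W' : lmodType F) (t' : K -> W') c (r : seq (K * F)) :
    \sum_(q <- [seq (q.1, c * q.2)
      | q <- r]) q.2 *: t' q.1 = c *: \sum_(q <- r) q.2 *: t' q.1.
  by rewrite big_map scaler_sumr; apply: eq_bigr => q _; rewrite scalerA.
exists h => [c x y|k].
  apply/eqP; rewrite -subr_eq0 /h; apply/eqP.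
  pose r := l (c *: x + y) ++ [seq (q.1, - c * q.2) | q <- l x] ++ [seq (q.1, -1 * q.2)
    | q <- l y].
  have rE (W' : lmodType F) (t' : K -> W') : \sum_(q <- r) q.2 *: t' q.1 =
      \sum_(q <- l (c *: x + y)) q.2 *: t' q.1 -
      (c *: (\sum_(q <- l x) q.2 *: t' q.1) + \sum_(q <- l y) q.2 *: t' q.1).
    by rewrite /r !big_cat /= !scaleE scaleNr scaleN1r opprD.
  by rewrite -rE; apply: basis_null; rewrite rE -!lE subrr.
apply/eqP; rewrite -subr_eq0 /h; apply/eqP.
pose r := rcons (l (b k)) (k, -1).
have rE (W' : lmodType F) (t' : K -> W') : \sum_(q <- r) q.2 *: t' q.1 =
    \sum_(q <- l (b k)) q.2 *: t' q.1 - t' k.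
  by rewrite /r -cats1 big_cat big_seq1 /= scaleN1r.
by rewrite -rE; apply: basis_null; rewrite rE -lE subrr.
Qed.

Variables (G : zmodType) (gr : G -> set V) (dg : K -> G).
Hypothesis hgr : is_grading gr.
Hypothesis b_hom : forall k, gr (dg k) (b k).

(** Grouping an expansion of [v] by degree leaves only the group of degree [a], since the grading is
    direct. *)
Lemma basis_homog a v : gr a v -> lspan [set w | exists2 k, dg k = a & w = b k] v.
Proof.
move=> av; case: hb => _ _ /(_ v I) [s [r [_ vE]]].
have gsub d : is_subspace (gr d) := grading_sub hgr d.
pose vd d := \sum_(k <- s | dg k == d) r k *: b k.
have vd_gr d : gr d (vd d).
  by apply: (subspace_sum (gsub d)) => k /eqP <-; apply: (subspaceZ (gsub _)).
pose ds := undup (a :: map dg s).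
have sumE : v = \sum_(d <- ds) vd d.
  rewrite vE /vd; under [RHS]eq_bigr => d _ do rewrite big_mkcond.
  rewrite exchange_big /= big_seq [RHS]big_seq; apply: eq_bigr => k ks.
  rewrite (bigD1_seq (dg k)) ?undup_uniq //=; last first.
    by rewrite mem_undup inE map_f ?orbT.
  by rewrite eqxx big1 ?addr0 // => d; rewrite eq_sym => /negPf ->.
have a_ds : a \in ds by rewrite mem_undup mem_head.
suff -> : v = vd a.
  apply: (subspace_sum (lspan_subspace _)) => k /eqP ka.
  by apply: (subspaceZ (lspan_subspace _)); apply: lspan_incl; exists k.
apply/eqP; rewrite -subr_eq0; apply/eqP.
pose x d := if d == a then v - vd a else - vd d.
have := grading_direct hgr (s := ds) (x := x) (undup_uniq _).
have -> : v - vd a = x a by rewrite /x eqxx.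
apply=> // [d|]; rewrite /x.
  case: eqP => [->|_]; last exact: (subspaceN (gsub _)).
  exact: (subspaceB (gsub _)).
rewrite (bigD1_seq a) ?undup_uniq //= eqxx [X in X - _]sumE (bigD1_seq a) ?undup_uniq //=.
rewrite [vd a + _]addrC addrK -big_split big1 //= => d da.
by rewrite (negPf da) subrr.
Qed.

End Coordinates.

(** * The relations of a restricted Lie color algebra *)

Lemma zorderP (G : zmodType) (a : G) : zorder a <> 0%N -> a *+ zorder a = 0.
Proof.
rewrite /zorder; case: pselect => // h _; case: ex_minnP => n /andP[_ /eqP na] _.
exact: na.
Qed.

Lemma zorder_gt0 (G : zmodType) (a : G) n : (0 < n)%N -> a *+ n = 0 -> zorder a <> 0%N.
Proof.
move=> n_gt0 an; rewrite /zorder; case: pselect => [h|[]]; last first.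
  by exists n; rewrite n_gt0 an eqxx.
by case: ex_minnP => m /andP[m_gt0 _] _ m0; rewrite m0 in m_gt0.
Qed.

Section LieLetters.
Variables (F : fieldType) (p : nat) (hp : p \in [pchar F]) (hp3 : (3 < p)%N).
Variables (G : zmodType) (eps : G -> G -> F) (heps : bicharacter eps).
Variables (g : lmodType F) (gr : G -> set g) (br : g -> g -> g).
Hypothesis hg : is_lie_color eps gr br.
Variables (pp : G -> g -> g) (hpp : is_restricted p eps gr br pp).
Variables (chi : G -> pchar_value g) (hchi : is_pcharacter p eps gr chi).
Variables (xi : G -> g) (c : G -> g -> F).
Hypothesis hxi : forall a C, eps a a = 1 -> chi a = PClass C -> C (xi a, c a).

Lemma pchar_functional a f : eps a a = 1 -> chi a = PFunctional f ->
  is_dual gr a f /\ (a *+ p <> 0 -> forall x, gr a x -> f x = 0).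
Proof.
move=> aa fa; have [pa|pa] := pselect (a *+ p = 0).
  by have [f' ] := pchar_ptorsion hchi aa pa; rewrite fa => -[->].
suff f0 : forall x, gr a x -> f x = 0.
  split=> // r x y ax ay; have gs := grading_sub (lie_grading hg) a.
  rewrite !f0 ?mulr0 ?addr0 //; apply: (subspaceD gs) => //; exact: (subspaceZ gs).
have [za|za] := pselect (zorder a = 0%N).
  by have [f'] := pchar_infinite hchi aa za; rewrite fa => -[->].
have [[C]|[f']] := pchar_finite hchi aa pa za; first by rewrite fa.
by rewrite fa => -[->].
Qed.

(** The order of [a *+ p] is finite because that of [a] is. Equivalence with the chosen pair is
    composed through the pair [u0] defining the class. *)
Lemma pchar_class a C : eps a a = 1 -> chi a = PClass C ->
  [/\ zorder (a *+ p) <> 0%N, is_fpair gr a (xi a, c a)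
    & forall u, C u -> is_fpair gr a u /\ fpair_equiv p gr a (xi a, c a) u].
Proof.
move=> aa Ca.
have pa : a *+ p <> 0.
  by move=> pa; have [f] := pchar_ptorsion hchi aa pa; rewrite Ca.
have za : zorder a <> 0%N.
  by move=> za; have [f] := pchar_infinite hchi aa za; rewrite Ca.
have zpa : zorder (a *+ p) <> 0%N.
  apply: (@zorder_gt0 _ _ (zorder a)); first by case: (zorder a) za.
  by rewrite -mulrnA mulnC mulrnA (zorderP za) mul0rn.
have [[C' Ca' [u0 u0p C'E]]|[f]] := pchar_finite hchi aa pa za; last by rewrite Ca.
have CE : C = fclass p gr a u0 by move: Ca'; rewrite Ca => -[->].
have := hxi aa Ca; rewrite CE => -[xip [/= x1 x2 x3 x4]]; split=> // u.
move=> [up [y1 y2 y3 y4]]; split=> //; rewrite /fpair_equiv /=.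
have [axi _ cxi] := xip; have [au1 _ u21] := up; have [au0 _ u01] := u0p.
rewrite /= in axi cxi.
have E1 x : gr a x -> c a x = c a u.1 * u.2 x.
  by move=> ax; rewrite (x2 x ax) (y1 x ax) (x2 _ au1) !mulrA.
have E2 x : gr a x -> u.2 x = u.2 (xi a) * c a x.
  move=> ax; rewrite (y2 x ax) (x1 x ax) (y2 _ axi).
  by rewrite !mulrA.
split=> //.
  by rewrite (x2 _ au1) exprMn x4 y3 mulr1.
by rewrite (y2 _ axi) exprMn x3 y4 mulr1.
Qed.

Lemma pchar_class_torsion a C : eps a a = 1 -> chi a = PClass C ->
  a *+ (p * zorder (a *+ p)) = 0.
Proof. by move=> aa Ca; rewrite mulrnA zorderP //; have [] := pchar_class aa Ca. Qed.

(** This makes the constant terms of power relations commute with letters: the color factor of a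
    power is 1 when the exponent kills the degree. *)
Lemma bichar_torsion a n b : a *+ n = 0 -> eps a b ^+ n = 1.
Proof.
move=> an; have nz x y : eps x y != 0.
  by apply/eqP => e0; have := bichar_inv heps x y; rewrite e0 mul0r => /esym/eqP;
    rewrite oner_eq0.
have inv x y : eps x y = (eps y x)^-1.
  by apply: (mulIf (nz y x)); rewrite (bichar_inv heps) mulVf.
rewrite (inv a b) exprVn -(bichar_mulrn heps) an.
by have := bichar_mulrn heps b a 0; rewrite mulr0n expr0 => ->; rewrite invr1.
Qed.

Lemma eps_mulrn_l a n b : eps (a *+ n) b = eps a b ^+ n.
Proof.
elim: n => [|n IHn]; last by rewrite mulrS (bichar_addl heps) IHn exprS.
by rewrite -[LHS](expr1) (@bichar_torsion _ 1%N) ?expr0 // mulr0n mulr1n.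
Qed.

Lemma bichar_sign a : eps a a = 1 \/ eps a a = -1.
Proof.
have : (eps a a == 1) || (eps a a == -1) by rewrite -eqf_sqr expr1n expr2 (bichar_inv heps).
by case/orP => /eqP; [left | right].
Qed.

Lemma natF_neq0 n : (0 < n < p)%N -> n%:R != 0 :> F.
Proof. by move=> /andP[n0 np]; rewrite -(dvdn_pcharf hp) gtnNdvd. Qed.

Lemma br_self_even a x : eps a a = 1 -> gr a x -> br x x = 0.
Proof.
move=> aa ax; have := lie_skew hg ax ax; rewrite aa scale1r => /eqP.
rewrite -addr_eq0 -mulr2n -scaler_nat scaler_eq0 => /orP[|/eqP //].
by rewrite (negPf (natF_neq0 _)) //; lia.
Qed.

(** The cyclic identity as a Leibniz rule; skew symmetry turns it into the given Jacobi identity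
    scaled by [eps b a * eps d b]. *)
Lemma br_jacobi a b d x y z : gr a x -> gr b y -> gr d z ->
  br (br z y) x - br z (br y x) + eps d b *: br y (br z x) = 0.
Proof.
move=> ax by_ dz; have J := lie_jacobi hg ax by_ dz.
have lr := lie_linear_r hg.
rewrite (lie_skew hg ax (lie_graded hg dz by_)) (lie_skew hg by_ dz) (lie_skew hg ax by_).
rewrite !(linear_mapN (lr _)) !(linear_mapZ (lr _)) (bichar_addl heps).
rewrite -[RHS](scaler0 _ (eps b a * eps d b)) -J.
by lin_eq F g; ring: (bichar_inv heps d b) (bichar_inv heps b a).
Qed.

End LieLetters.

Lemma mul_sub_mul (R : pzRingType) (x x' y y' : R) :
  x * x' - y * y' = x * (x' - y') + (x - y) * y'.
Proof. by rewrite mulrBr mulrBl addrA subrK. Qed.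

Lemma pzexprZn (F : fieldType) (A : pzAlgType F) (r : F) (x : A) n :
  (r *: x) ^+ n = r ^+ n *: x ^+ n.
Proof.
elim: n => [|n IHn]; first by rewrite !expr0 scale1r.
by rewrite !exprS IHn -pzscalerAl -pzscalerAr scalerA.
Qed.

(** * The rules attached to a homogeneous basis, and their commutators with letters *)

Section LetterRelations.
Variables (F : fieldType) (p : nat) (hp : p \in [pchar F]) (hp3 : (3 < p)%N).
Variables (G : zmodType) (eps : G -> G -> F) (heps : bicharacter eps).
Variables (g : lmodType F) (gr : G -> set g) (br : g -> g -> g).
Hypothesis hg : is_lie_color eps gr br.
Variables (pp : G -> g -> g) (hpp : is_restricted p eps gr br pp).
Variables (chi : G -> pchar_value g) (hchi : is_pcharacter p eps gr chi).
Variables (xi : G -> g) (c : G -> g -> F).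
Hypothesis hxi : forall a C, eps a a = 1 -> chi a = PClass C -> C (xi a, c a).

Variables (X : eqType) (b : X -> g) (dg : X -> G).
Hypothesis b_hom : forall x, gr (dg x) (b x).
Hypothesis b_span : forall a v, gr a v -> lspan [set w | exists2 x, dg x = a & w = b x] v.
Hypothesis b_xi : forall a C, eps a a = 1 -> chi a = PClass C ->
  exists2 x, dg x = a & b x = xi a.

Variables (A : pzAlgType F) (word : seq X -> A) (hA : is_free_on word).
Variables (iota : g -> A) (iota_lin : linear iota).
Hypothesis iota_b : forall x, iota (b x) = word [:: x].

Definition is_xi x : bool := `[< eps (dg x) (dg x) = 1 /\
  exists2 C, chi (dg x) = PClass C & b x = xi (dg x) >].

Definition lwt x : nat := if is_xi x then 2 else 3.

Definition zpow a v : A := iota v ^+ p - iota (pp a v).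

Definition lexp_bound x : nat :=
  if eps (dg x) (dg x) == 1 then
    if is_xi x then (p * zorder (dg x *+ p))%N else p
  else 2.

Definition lpow x : A :=
  if eps (dg x) (dg x) == 1 then
    match chi (dg x) with
    | PFunctional f => zpow (dg x) (b x) - f (b x) ^+ p *: (1 : A)
    | PClass C =>
      if is_xi x then zpow (dg x) (b x) ^+ zorder (dg x *+ p) - 1
      else zpow (dg x) (b x) - c (dg x) (b x) ^+ p *: zpow (dg x) (xi (dg x))
    end
  else iota (b x) ^+ 2 - 2%:R^-1 *: iota (br (b x) (b x)).

Definition leps x y : F := eps (dg x) (dg y).
Definition lbr x y : A := iota (br (b x) (b y)).

Let L x := word [:: x].
Let LR := LR word lwt leps lbr lexp_bound lpow.
Let Wle := Wle word lwt.
Let rel := rel_swap word leps lbr.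

Let LRs n := LR_subspace word lwt leps lbr lexp_bound lpow n.
Let Wles n := Wle_subspace word lwt n.
Let p_gt0 : (0 < p)%N. Proof. lia. Qed.

Lemma lwt_bounds x : (2 <= lwt x <= 3)%N.
Proof. by rewrite /lwt; case: ifP. Qed.

Let lwt2 x : (2 <= lwt x)%N. Proof. by case/andP: (lwt_bounds x). Qed.
Let lwt3 x : (lwt x <= 3)%N. Proof. by case/andP: (lwt_bounds x). Qed.

Lemma leps_inv x y : leps x y * leps y x = 1.
Proof. exact: bichar_inv. Qed.

Lemma lbr_skew x y : lbr x y = - (leps x y *: lbr y x).
Proof.
by rewrite /lbr (lie_skew hg (b_hom y) (b_hom x)) (linear_mapN iota_lin) (linear_mapZ
  iota_lin).
Qed.

Lemma Wle_letter x : Wle (lwt x) (L x).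
Proof. by apply: Wle_word; rewrite wtw_cons wtw_nil addn0. Qed.

Arguments Wle_letter : clear implicits.

Lemma Wle_iota a v : gr a v -> Wle 3 (iota v).
Proof.
move=> /b_span; move: v; apply: lspan_min (preim_subspace iota_lin (Wles 3)) _.
by move=> _ [x _ ->]; rewrite /mkset iota_b; apply: (Wle_mono (lwt3 x)); exact: Wle_letter.
Qed.

Lemma Wle_lbr x y : Wle 3 (lbr x y).
Proof. exact: Wle_iota (lie_graded hg (b_hom x) (b_hom y)). Qed.

(** The bracket relation for arbitrary vectors. For homogeneous vectors and the matching factor [e]
    it is a combination of swaps of letters. *)
Definition bracket_defect e v w : A := tw_comm e (iota v) (iota w) - iota (br v w).

Lemma LR_defect_l n a v y : gr a v -> (3 + lwt y < n)%N ->
  LR n (bracket_defect (eps a (dg y)) v (b y)).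
Proof.
move=> av lt_n; move: (b_span av) => {av}; move: v.
have hl : linear (fun v => bracket_defect (eps a (dg y)) v (b y)).
  move=> k v w; rewrite /bracket_defect (lie_linear_l hg) !iota_lin.
  rewrite /tw_comm mulrDl mulrDr -pzscalerAl -pzscalerAr.
  by lin_eq F A; ring.
apply: lspan_min (preim_subspace hl (LRs n)) _ => _ [x xa ->].
rewrite /mkset /bracket_defect -xa !iota_b; apply: (LR_swap hA).
by have := lwt3 x; lia.
Qed.

Lemma LR_defect_r n a v y : gr a v -> (3 + lwt y < n)%N ->
  LR n (bracket_defect (eps (dg y) a) (b y) v).
Proof.
move=> av lt_n; move: (b_span av) => {av}; move: v.
have hl : linear (fun v => bracket_defect (eps (dg y) a) (b y) v).
  move=> k v w; rewrite /bracket_defect (lie_linear_r hg) !iota_lin.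
  rewrite /tw_comm mulrDl mulrDr -pzscalerAl -pzscalerAr.
  by lin_eq F A; ring.
apply: lspan_min (preim_subspace hl (LRs n)) _ => _ [x xa ->].
rewrite /mkset /bracket_defect -xa !iota_b; apply: (LR_swap hA).
by have := lwt3 x; lia.
Qed.

(** Subtracting the image of the Jacobi identity of [g], which is 0, leaves three bracket defects;
    each weighs less than three letters. *)
Lemma ljacobi x y z :
  LR (lwt z + lwt y + lwt x)
    (tw_comm (leps z x * leps y x) (lbr z y) (L x)
     - tw_comm (leps z y * leps z x) (L z) (lbr y x)
     + leps z y *: tw_comm (leps y z * leps y x) (L y) (lbr z x)).
Proof.
have gzy := lie_graded hg (b_hom z) (b_hom y).
have gyx := lie_graded hg (b_hom y) (b_hom x).
have gzx := lie_graded hg (b_hom z) (b_hom x).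
have [wx wy wz] := And3 (lwt2 x) (lwt2 y) (lwt2 z).
have := br_jacobi heps hg (b_hom x) (b_hom y) (b_hom z).
move=> /(congr1 iota); rewrite (linear_map0 iota_lin) (linear_mapD iota_lin).
rewrite (linear_mapB iota_lin) (linear_mapZ iota_lin) => J.
rewrite -[X in LR _ X]subr0 -J.
set n := (lwt z + lwt y + lwt x)%N.
suff -> : tw_comm (leps z x * leps y x) (lbr z y) (L x)
     - tw_comm (leps z y * leps z x) (L z) (lbr y x)
     + leps z y *: tw_comm (leps y z * leps y x) (L y) (lbr z x) -
     (iota (br (br (b z) (b y)) (b x)) - iota (br (b z) (br (b y) (b x))) +
       eps (dg z) (dg y) *: iota (br (b y) (br (b z) (b x)))) =
   bracket_defect (eps (dg z + dg y) (dg x)) (br (b z) (b y)) (b x)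
   - bracket_defect (eps (dg z) (dg y + dg x)) (b z) (br (b y) (b x))
   + leps z y *: bracket_defect (eps (dg y) (dg z + dg x)) (b y) (br (b z) (b x)).
  apply: (subspaceD (LRs n)); [apply: (subspaceB (LRs n))|apply: (subspaceZ (LRs n))].
  - by apply: LR_defect_l gzy _; rewrite /n; lia.
  - by apply: LR_defect_r gyx _; rewrite /n; lia.
  - by apply: LR_defect_r gzx _; rewrite /n; lia.
rewrite (bichar_addl heps) !(bichar_addr heps) /bracket_defect !iota_b /tw_comm /leps
  /lbr /L.
by lin_eq F A; ring.
Qed.

Definition rel_sum n x y : A :=
  \sum_(i < n) leps x y ^+ i *: (L x ^+ (n.-1 - i) * rel x y * L x ^+ i).

Lemma WleX_letter k x : Wle (k * lwt x) (L x ^+ k).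
Proof. by apply: (WleX hA); exact: Wle_letter. Qed.

Arguments WleX_letter : clear implicits.

Lemma LR_rel_sum n x y m : (n * lwt x + lwt y < m)%N -> LR m (rel_sum n x y).
Proof.
move=> lt_m; apply: (subspace_sum (LRs m)) => i _; apply: (subspaceZ (LRs m)).
have R0 : LR (lwt x + lwt y).+1 (rel x y) by apply: (LR_swap hA).
have R1 := LR_mulr hA (WleX_letter i x) (LR_mull hA (WleX_letter (n.-1 - i) x) R0).
by apply: LR_mono R1; have := ltn_ord i; nia.
Qed.

Lemma tw_comm_sub e x y y' : tw_comm e x (y - y') = tw_comm e x y - tw_comm e x y' :> A.
Proof. exact: (linear_mapB (tw_comm_linear e x)). Qed.

Lemma tw_comm_linear_l e y : linear (fun x : A => tw_comm e x y).
Proof.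
move=> k u v; rewrite /tw_comm mulrDl mulrDr -pzscalerAl -pzscalerAr.
by lin_eq F A; ring.
Qed.

Lemma LR_tw_comm n x e r : LR n r -> LR (n + lwt x) (tw_comm e (L x) r).
Proof.
move=> rn; apply: (subspaceB (LRs _)).
  by rewrite addnC; apply: (LR_mull hA (Wle_letter x) rn).
by apply: (subspaceZ (LRs _)); apply: (LR_mulr hA (Wle_letter x) rn).
Qed.

(** Bracketing with [b x] keeps the factor [e] because [eps (dg x) (dg x) = 1]. The constant 4 is
    the largest weight 3 of a letter of [v], plus one because [LR] bounds weights strictly. *)
Lemma iter_defect x a v e k : eps (dg x) (dg x) = 1 -> gr a v -> eps (dg x) a = e ->
  (exists2 a', gr a' (iter k (br (b x)) v) & eps (dg x) a' = e) /\
  LR (k * lwt x + 4) (iter k (tw_comm e (L x)) (iota v) - iota (iter k (br (b x)) v)).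
Proof.
move=> xx av ae; elim: k => [|k [[a' gk ek] Rk]] /=.
  by split; [exists a | rewrite subrr; exact: subspace0].
split; first by exists (dg x + a');
  [exact: (lie_graded hg (b_hom x) gk) | rewrite (bichar_addr heps) xx mul1r].
set u := iter k (tw_comm e (L x)) (iota v) in Rk *; set w := iter k (br (b x)) v in gk Rk *.
have -> : tw_comm e (L x) u - iota (br (b x) w) =
    tw_comm e (L x) (u - iota w) + bracket_defect e (b x) w.
  by rewrite tw_comm_sub /bracket_defect iota_b -/(L x); lin_eq F A; ring.
have wx := lwt2 x; apply: (subspaceD (LRs _)).
  by have R1 := @LR_tw_comm _ x e _ Rk; apply: LR_mono R1; lia.
by rewrite -ek; apply: LR_defect_r gk _; lia.
Qed.

(** Telescoping the commutator of $x^p$ with $y$ gives [rel_sum] plus the same sum with $[x,y]$ in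
    place of the swap. By characteristic $p$ the latter is a $(p-1)$-fold commutator of $[x,y]$,
    which modulo lower relations is $(\mathrm{ad}\,x)^p y=[x^{[p]},y]$ and cancels the contribution
    of $x^{[p]}$. *)
Lemma zpow_comm x y : eps (dg x) (dg x) = 1 ->
  LR (p * lwt x + lwt y)
    (tw_comm (leps x y ^+ p) (zpow (dg x) (b x)) (L y) - rel_sum p x y).
Proof.
move=> xx; set e := leps x y.
have gxy := lie_graded hg (b_hom x) (b_hom y).
have exy : eps (dg x) (dg x + dg y) = e by rewrite (bichar_addr heps) xx mul1r.
have [_] := iter_defect p.-1 xx gxy exy.
rewrite -iterSr prednK // -(pmap_ad hpp xx (b_hom x)).
rewrite (iter_tw_comm_pred hp) => R1.
have gpp := pmap_graded hpp xx (b_hom x).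
have [wx wy] := (lwt2 x, lwt2 y).
have R2 : LR (p * lwt x + lwt y) (bracket_defect (eps (dg x *+ p) (dg y)) (pp (dg x) (b
  x)) (b y)).
  by apply: LR_defect_l gpp _; nia.
set z := pp (dg x) (b x) in R1 R2 *.
rewrite eps_mulrn_l // in R2; rewrite /zpow -/z (linear_mapB (tw_comm_linear_l _ _)).
rewrite iota_b -/(L x) tw_commX.
have -> : tw_comm e (L x) (L y) = rel x y + lbr x y by rewrite /rel /rel_swap subrK.
have -> : \sum_(i < p) e ^+ i *: (L x ^+ (p.-1 - i) * (rel x y + lbr x y) * L x ^+ i) =
   rel_sum p x y + \sum_(i < p) e ^+ i *: (L x ^+ (p.-1 - i) * lbr x y * L x ^+ i).
  by rewrite -big_split; apply: eq_bigr => i _; rewrite mulrDr mulrDl scalerDr.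
move: R1 R2; rewrite /bracket_defect iota_b -/(lbr x y) -/(leps x y) -/e -/(L y).
move: (\sum_(i < p) e ^+ i *: _) => S R1 R2.
rewrite (_ : _ - _ = (S - iota (br z (b y))) - (tw_comm (e ^+ p) (iota z) (L y) - iota
  (br z (b y)))); last first.
  by lin_eq F A; ring.
by apply: (subspaceB (LRs _)) => //; apply: LR_mono R1; nia.
Qed.

Arguments zpow_comm : clear implicits.

Variant lpow_spec x : bool -> nat -> A -> Prop :=
  | LpowOdd of eps (dg x) (dg x) = -1 :
    lpow_spec x false 2 (L x ^+ 2 - 2%:R^-1 *: iota (br (b x) (b x)))
  | LpowFunctional f of eps (dg x) (dg x) = 1 & chi (dg x) = PFunctional f
      & (dg x *+ p <> 0 -> f (b x) = 0) :
    lpow_spec x false p (zpow (dg x) (b x) - f (b x) ^+ p *: (1 : A))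
  | LpowClass C y of eps (dg x) (dg x) = 1 & chi (dg x) = PClass C
      & is_xi y & dg y = dg x & b y = xi (dg x) :
    lpow_spec x false p
      (zpow (dg x) (b x) - c (dg x) (b x) ^+ p *: zpow (dg y) (b y))
  | LpowXi C of eps (dg x) (dg x) = 1 & chi (dg x) = PClass C & b x = xi (dg x) :
    lpow_spec x true (p * zorder (dg x *+ p))
      (zpow (dg x) (b x) ^+ zorder (dg x *+ p) - 1).

Lemma is_xi_even x : is_xi x -> eps (dg x) (dg x) = 1.
Proof. by move=> /asboolP[]. Qed.

Lemma lpowP x : lpow_spec x (is_xi x) (lexp_bound x) (lpow x).
Proof.
rewrite /lexp_bound /lpow; have [xx|odd_x] := eqVneq (eps (dg x) (dg x)) 1; last first.
  have -> : is_xi x = false by apply: contra_neqF odd_x => /is_xi_even.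
  rewrite iota_b; apply: LpowOdd.
  by have [E|//] := bichar_sign heps (dg x); rewrite E eqxx in odd_x.
case E: (chi (dg x)) => [f|C].
  have -> : is_xi x = false by apply/asboolP => -[_ [C]]; rewrite E.
  apply: (LpowFunctional xx E) => px.
  by have [_ f0] := pchar_functional hg hchi xx E; exact: (f0 px _ (b_hom x)).
case: ifP => xix; first by apply: (LpowXi xx E); have /asboolP[_ [C' _]] := xix.
have [y yx yxi] := b_xi xx E.
have -> : zpow (dg x) (xi (dg x)) = zpow (dg y) (b y) by rewrite yx yxi.
apply: (LpowClass xx E _ yx yxi); apply/asboolP; rewrite yx; split=> //.
by exists C.
Qed.

Lemma lexp_bound_gt1 x : (1 < lexp_bound x)%N.
Proof.
case: lpowP => [_|f _ _ _|C y _ _ _ _ _|C xx Cx _] //; try lia.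
have [z0 _ _] := pchar_class hchi hxi xx Cx.
by case: (zorder _) z0 => // n _; nia.
Qed.

Lemma zpow_lead x : eps (dg x) (dg x) = 1 -> Wle 3 (L x ^+ p - zpow (dg x) (b x)).
Proof.
move=> xx; rewrite /zpow iota_b opprB addrC subrK.
exact: Wle_iota (pmap_graded hpp xx (b_hom x)).
Qed.

Arguments zpow_lead : clear implicits.

Lemma zpow_wt x : eps (dg x) (dg x) = 1 -> Wle (p * lwt x) (zpow (dg x) (b x)).
Proof.
move=> xx; rewrite -[zpow _ _](subKr (L x ^+ p)); apply: (subspaceB (Wles _)).
  exact: WleX_letter.
by apply: Wle_mono (zpow_lead x xx); have := lwt2 x; nia.
Qed.

Arguments zpow_wt : clear implicits.

Lemma zpowX_lead x k : eps (dg x) (dg x) = 1 ->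
  Wle (p * k.+1 * lwt x).-1 (L x ^+ (p * k.+1) - zpow (dg x) (b x) ^+ k.+1).
Proof.
move=> xx; set Z := zpow _ _; have wx := lwt2 x; elim: k => [|k IHk].
  by rewrite muln1 expr1; apply: Wle_mono (zpow_lead x xx); nia.
rewrite mulnS exprD [Z ^+ k.+2]exprS mul_sub_mul.
apply: (subspaceD (Wles _)).
  by apply: Wle_mono (WleM hA (WleX_letter p x) IHk); nia.
by apply: Wle_mono (WleM hA (zpow_lead x xx) (WleX hA k.+1 (zpow_wt x xx))); nia.
Qed.

Arguments zpowX_lead : clear implicits.

(** In the class case the correction $c(x)^p(\xi^p-\xi^{[p]})$ weighs $2p$ against $3p$ for $x^p$;
    this is the purpose of the smaller weight of $\xi$. *)
Lemma lpow_lead x : Wle (lexp_bound x * lwt x).-1 (word (nseq (lexp_bound x) x) - lpow x).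
Proof.
rewrite -(free_on_nseq hA) (_ : lwt x = if is_xi x then 2 else 3) //;
  case: lpowP => [_|f xx _ _|C y xx _ xiy yx _|C xx Cx xE].
- rewrite opprB addrC subrK; apply: (subspaceZ (Wles _)).
  by apply: Wle_mono (Wle_iota (lie_graded hg (b_hom x) (b_hom x))).
- rewrite opprB addrCA addrC; apply: (subspaceD (Wles _)).
    by apply: Wle_mono (zpow_lead x xx); lia.
  by apply: (subspaceZ (Wles _)); exact: Wle1.
- rewrite opprB addrCA addrC; apply: (subspaceD (Wles _)).
    by apply: Wle_mono (zpow_lead x xx); lia.
  apply: (subspaceZ (Wles _)); apply: Wle_mono (zpow_wt y (is_xi_even xiy)).
  by rewrite /lwt xiy; lia.
have [z0 _ _] := pchar_class hchi hxi xx Cx.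
rewrite opprB addrCA addrC; apply: (subspaceD (Wles _)); last exact: Wle1.
have lx : lwt x = 2%N.
  by rewrite /lwt ifT //; apply/asboolP; split=> //; exists C.
case: (zorder _) z0 => // k _; have := zpowX_lead x k xx; rewrite lx.
exact: Wle_mono.
Qed.

Lemma rel_sumD n m x y :
  rel_sum (n + m) x y = L x ^+ m * rel_sum n x y + leps x y ^+ n *: (rel_sum m x y * L x
    ^+ n).
Proof.
rewrite /rel_sum big_split_ord /= mulr_sumr mulr_suml scaler_sumr.
congr (_ + _); apply: eq_bigr => i _ /=.
  have -> : ((n + m).-1 - i = m + (n.-1 - i))%N by have := ltn_ord i; lia.
  by rewrite exprD -pzscalerAr !mulrA.
have -> : ((n + m).-1 - (n + i) = m.-1 - i)%N by lia.
by rewrite -pzscalerAl scalerA -exprD -[in RHS]mulrA -exprD [(i + n)%N]addnC.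
Qed.

Lemma tw_comm1 e y : tw_comm e 1 y = (1 - e) *: y :> A.
Proof. by rewrite /tw_comm mul1r mulr1 scalerBl scale1r. Qed.

Lemma tw_comm_mul e e' z z' y :
  tw_comm (e * e') (z * z') y = z * tw_comm e' z' y + e' *: (tw_comm e z y * z') :> A.
Proof.
rewrite /tw_comm mulrBr mulrBl -pzscalerAr -pzscalerAl !mulrA.
by lin_eq F A; ring.
Qed.

(** Commutators with powers of [Z] = $x^p-x^{[p]}$ obey a product rule, and [rel_sumD] is the same
    rule with $x^p$ in place of [Z]. The mismatch $x^p-Z$ has weight at most 3. *)
Lemma zpowX_comm k x y : eps (dg x) (dg x) = 1 ->
  LR (p * k * lwt x + lwt y)
    (tw_comm (leps x y ^+ (p * k)) (zpow (dg x) (b x) ^+ k) (L y) - rel_sum (p * k) x y).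
Proof.
move=> xx; have [wx wy] := (lwt2 x, lwt2 y); have R1 := zpow_comm x y xx.
have Zwt := zpow_wt x xx; have Zlead := zpow_lead x xx; have ZX := zpowX_lead x ^~ xx.
move: (zpow _ _) R1 Zwt Zlead ZX => Z R1 Zwt Zlead ZX.
elim: k => [|k IHk].
  rewrite muln0 !expr0 /rel_sum big_ord0 tw_comm1 subrr scale0r subrr.
  exact: subspace0.
set e := leps x y in R1 IHk *.
have -> : tw_comm (e ^+ (p * k.+1)) (Z ^+ k.+1) (L y) - rel_sum (p * k.+1) x y =
    Z * (tw_comm (e ^+ (p * k)) (Z ^+ k) (L y) - rel_sum (p * k) x y)
    - (L x ^+ p - Z) * rel_sum (p * k) x y
    + e ^+ (p * k) *: ((tw_comm (e ^+ p) Z (L y) - rel_sum p x y) * Z ^+ k)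
    - e ^+ (p * k) *: (rel_sum p x y * (L x ^+ (p * k) - Z ^+ k)).
  rewrite mulnS exprD [Z ^+ k.+1]exprS tw_comm_mul addnC rel_sumD -/e.
  move: (tw_comm _ _ _) (tw_comm _ _ _) (rel_sum _ _ _) (rel_sum _ _ _) => t1 t2 r1 r2.
  rewrite !(mulrBr, mulrBl); lin_eq F A; ring.
apply: (subspaceB (LRs _)); last first.
  apply: (subspaceZ (LRs _)); case: k {IHk} => [|k].
    by rewrite muln0 !expr0 subrr mulr0; exact: subspace0.
  have R2 : LR (p * lwt x + lwt y).+1 (rel_sum p x y) by apply: LR_rel_sum.
  by apply: LR_mono (LR_mulr hA (ZX k) R2); nia.
apply: (subspaceD (LRs _)); last first.
  apply: (subspaceZ (LRs _)).
  by apply: LR_mono (LR_mulr hA (WleX hA k Zwt) R1); nia.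
apply: (subspaceB (LRs _)).
  by apply: LR_mono (LR_mull hA Zwt IHk); nia.
have R2 : LR (p * k * lwt x + lwt y).+1 (rel_sum (p * k) x y) by apply: LR_rel_sum.
by apply: LR_mono (LR_mull hA Zlead R2); nia.
Qed.

Arguments zpowX_comm : clear implicits.

Lemma rel_diag_odd x : eps (dg x) (dg x) = -1 ->
  lexp_bound x = 2%N /\ rel x x = 2%:R *: lpow x.
Proof.
move=> xx; have two : 2%:R != 0 :> F by apply: (natF_neq0 hp); lia.
case: lpowP => [_|f xx'|C y xx'|C xx']; try by
  have /eqP := xx; rewrite xx' -subr_eq0 opprK -mulr2n (negPf two).
split=> //; rewrite /rel /rel_swap /tw_comm /leps xx scaleN1r opprK /lbr.
by rewrite scalerBr scalerA mulfV // scale1r scaler_nat mulr2n expr2.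
Qed.

Lemma rel_diag_even x : eps (dg x) (dg x) = 1 -> rel x x = 0.
Proof.
move=> xx; rewrite /rel /rel_swap /tw_comm /leps xx scale1r subrr /lbr.
by rewrite (br_self_even hp hp3 hg xx (b_hom x)) (linear_map0 iota_lin) subrr.
Qed.

Lemma rel_diag x : rel x x = 0 \/
  lexp_bound x = 2%N /\ exists k, rel x x = k *: lpow x.
Proof.
have [xx|xx] := bichar_sign heps (dg x); first by left; exact: rel_diag_even.
by right; have [-> rk] := rel_diag_odd xx; split=> //; exists 2%:R.
Qed.

(** For odd $x$ the identity needed is $[x,[x,y]]=\frac12[[x,x],y]$. A constant term contributes
    nothing, since its coefficient vanishes or the color factor of the power is 1. In the class case
    the sum of swaps coming from $\xi$ is of smaller weight. *)
Lemma lpow_comm x y :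
  LR (lexp_bound x * lwt x + lwt y)
    (tw_comm (leps x y ^+ lexp_bound x) (lpow x) (L y) - rel_sum (lexp_bound x) x y).
Proof.
have [wx wy] := (lwt2 x, lwt2 y).
have wxE : lwt x = if is_xi x then 2 else 3 by [].
have two : 2%:R != 0 :> F by apply: (natF_neq0 hp); lia.
case: lpowP wxE => [xx|f xx fx f0|C z xx Cx xiz zx bz|C xx Cx xE] wxE.
- have gxx := lie_graded hg (b_hom x) (b_hom x).
  have gxy := lie_graded hg (b_hom x) (b_hom y).
  have J := br_jacobi heps hg (b_hom y) (b_hom x) (b_hom x).
  have {}J : br (b x) (br (b x) (b y)) = 2%:R^-1 *: br (br (b x) (b x)) (b y).
    move/eqP: J; rewrite xx scaleN1r -addrA -opprD subr_eq0 => /eqP ->.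
    by rewrite -mulr2n -scaler_nat scalerA mulVf ?scale1r.
  set e := leps x y.
  have R1 : LR (2 * lwt x + lwt y) (bracket_defect (eps (dg x) (dg x + dg y)) (b x) (br
    (b x) (b y))).
    by apply: LR_defect_r gxy _; lia.
  have R2 : LR (2 * lwt x + lwt y) (bracket_defect (eps (dg x + dg x) (dg y)) (br (b x)
    (b x)) (b y)).
    by apply: LR_defect_l gxx _; lia.
  have e1 : eps (dg x) (dg x + dg y) = - e by rewrite (bichar_addr heps) xx mulN1r.
  have e2 : eps (dg x + dg x) (dg y) = e ^+ 2 by rewrite (bichar_addl heps).
  rewrite (_ : _ - _ = bracket_defect (- e) (b x) (br (b x) (b y)) -
     2%:R^-1 *: bracket_defect (e ^+ 2) (br (b x) (b x)) (b y)).
    by rewrite -e1 -e2; apply: (subspaceB (LRs _)) => //; apply: (subspaceZ (LRs _)).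
  rewrite /bracket_defect J (linear_mapZ iota_lin) !iota_b -/(L x) -/(L y).
  rewrite /rel_sum !big_ord_recl big_ord0 /= /rel /rel_swap /tw_comm -/e /lbr -/(L x)
    -/(L y).
  rewrite !subn0 !expr0 !expr1 !mul1r !mulr1 expr2.
  rewrite !(mulrBr, mulrBl) -!(pzscalerAr, pzscalerAl) !mulrA.
  by lin_eq F A; ring.
- have R1 := zpow_comm x y xx.
  rewrite (linear_mapB (tw_comm_linear_l _ _)) (linear_mapZ (tw_comm_linear_l _ _))
    tw_comm1.
  have -> : f (b x) ^+ p *: ((1 - leps x y ^+ p) *: L y) = 0.
    have [px|px] := pselect (dg x *+ p = 0).
      by rewrite /leps (bichar_torsion heps _ px) subrr scale0r scaler0.
    by rewrite f0 // expr0n -leqn0 leqNgt p_gt0 scale0r.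
  by rewrite subr0.
- have R1 := zpow_comm x y xx; have zz := is_xi_even xiz.
  have R2 := zpow_comm z y zz; have wz : lwt z = 2%N by rewrite /lwt xiz.
  have ezx : leps z y = leps x y by rewrite /leps zx.
  rewrite (linear_mapB (tw_comm_linear_l _ _)) (linear_mapZ (tw_comm_linear_l _ _)).
  rewrite -addrA [- _ + _]addrC addrA; apply: (subspaceB (LRs _)) => //.
  apply: (subspaceZ (LRs _)); rewrite -ezx; apply: (subspace_trans (LRs _)).
    by apply: LR_mono R2; nia.
  by apply: LR_rel_sum; nia.
have R1 := zpowX_comm (zorder (dg x *+ p)) x y xx.
rewrite (linear_mapB (tw_comm_linear_l _ _)) tw_comm1.
rewrite (bichar_torsion heps _ (pchar_class_torsion hchi hxi xx Cx)) in R1 *.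
by rewrite subrr scale0r subr0.
Qed.

Arguments lpow_comm : clear implicits.

(** For even [x] the swap of [x] with itself is 0. For odd [x] it is twice the power relation D, and
    [lpow_comm] with y = x becomes 3 (D x - x D), where 3 is invertible as p > 3. *)
Lemma lpow_comm_self x :
  LR (lexp_bound x * lwt x + lwt x) (lpow x * L x - L x * lpow x).
Proof.
have := lpow_comm x x.
have [xx|xx] := bichar_sign heps (dg x).
  have -> : rel_sum (lexp_bound x) x x = 0.
    by rewrite /rel_sum big1 // => i _; rewrite rel_diag_even // mulr0 mul0r scaler0.
  by rewrite subr0 /leps xx expr1n /tw_comm scale1r.
have three : 3%:R != 0 :> F by apply: (natF_neq0 hp); lia.
have [-> rk] := rel_diag_odd xx.
rewrite /rel_sum !big_ord_recl big_ord0 /= rk /leps xx /tw_comm !subn0 !expr0 !expr1.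
rewrite !mul1r !mulr1 -pzscalerAl -pzscalerAr => R3.
rewrite -[X in LR _ X]scale1r -(mulVf three) -scalerA; apply: (subspaceZ (LRs _)).
move: R3; congr (LR _ _); lin_eq F A; ring.
Qed.

Variable ltX : ssrbool.rel X.
Hypothesis ltX_asym : forall x y, ltX x y -> ~~ ltX y x.
Hypothesis ltX_trans : transitive ltX.
Hypothesis ltX_total : forall x y, x != y -> ltX x y || ltX y x.
Hypothesis b_gen : forall v, lspan [set w | exists x, w = b x] v.

Definition lrule : seq X -> A -> Prop := rule word ltX leps lbr lexp_bound lpow.
Let lt := word_lt ltX lwt.

Let lt_wf : well_founded lt := word_lt_wf ltX lwt.

Lemma lrule_lt s r : lrule s r -> lspan [set a | exists2 t,
  forall u v, lt (u ++ t ++ v) (u ++ s ++ v) & a = word t] r.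
Proof.
exact: (@rule_lt F X A word hA ltX ltX_asym lwt leps lbr lexp_bound lpow
  lwt_bounds Wle_lbr lexp_bound_gt1 lpow_lead).
Qed.

Lemma lrule_ambiguities (W : set A) w : is_subspace W ->
  (forall u s r v, lrule s r -> lt (u ++ s ++ v) w ->
     W (word u * (word s - r) * word v)) ->
  forall u s r v u' s' r' v', lrule s r -> lrule s' r' ->
  w = u ++ s ++ v -> w = u' ++ s' ++ v' ->
  (size u <= size u' < size u + size s)%N ->
  W (word u * r * word v - word u' * r' * word v').
Proof.
move=> hW W_rule u s r v u' s' r' v'.
exact: (@straightening_ambiguities F X A word hA ltX ltX_asym ltX_trans ltX_total
  lwt leps lbr lexp_bound lpow leps_inv lbr_skew lexp_bound_gt1 rel_diag
  lpow_comm lpow_comm_self ljacobi W w hW W_rule).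
Qed.

(** * The quotient by the rules as a model of the reduced enveloping algebra *)

Definition model : pzAlgType F := quot_alg (rule_rel word lrule).
Definition model_pi : A -> model := quot_pi (rule_rel word lrule).

Let pi_hom : is_alg_hom model_pi := quot_pi_hom _.
Let pi_lin := ahom_lin pi_hom.

Definition model_in v : model := model_pi (iota v).

Lemma model_in_linear : linear model_in.
Proof. by move=> k v w; rewrite /model_in iota_lin pi_lin. Qed.

Lemma model_pi_pow x : model_pi (lpow x) = 0.
Proof.
apply: quot_pi_rel; exists (nseq (lexp_bound x) x), (word (nseq (lexp_bound x) x) - lpow x).
by split; [right; exists x | rewrite subKr].
Qed.

Lemma model_pi_rel x y : model_pi (rel x y) = 0.
Proof.
have swap z t : ltX t z -> model_pi (rel z t) = 0.
  move=> lttz; apply: quot_pi_rel; exists [:: z; t], (word [:: z; t] - rel z t).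
  by split; [left; exists z, t | rewrite subKr].
have [->|/ltX_total/orP[ltxy|ltyx]] := eqVneq x y; last exact: swap.
- have [->|[_ [k ->]]] := rel_diag y; first exact: linear_map0.
  by rewrite (linear_mapZ pi_lin) model_pi_pow scaler0.
- rewrite /rel (rel_swap_skew word leps_inv lbr_skew) (linear_mapN pi_lin) (linear_mapZ
    pi_lin).
  by rewrite swap // scaler0 oppr0.
Qed.

Lemma model_in_bracket a a' v w : gr a v -> gr a' w ->
  model_in (br v w) = model_in v * model_in w - eps a a' *: (model_in w * model_in v).
Proof.
move=> av aw; apply/esym/eqP; rewrite -subr_eq0; apply/eqP; rewrite -(ahom_bracket pi_hom).
rewrite -/(tw_comm (eps a a') (iota v) (iota w)) -/(bracket_defect _ v w).
move: (b_span av) => {av}; move: v.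
have hl : linear (fun v => model_pi (bracket_defect (eps a a') v w)).
  move=> k v v'; rewrite -pi_lin; congr model_pi.
  rewrite /bracket_defect (lie_linear_l hg) !iota_lin (tw_comm_linear_l _ _ k).
  by lin_eq F A; ring.
apply: lspan_min (ker_subspace hl) _ => _ [x <- ->].
move: (b_span aw) => {aw hl}; move: w.
have hl : linear (fun w => model_pi (bracket_defect (eps (dg x) a') (b x) w)).
  move=> k v v'; rewrite -pi_lin; congr model_pi.
  rewrite /bracket_defect (lie_linear_r hg) !iota_lin (tw_comm_linear _ _ k).
  by lin_eq F A; ring.
apply: lspan_min (ker_subspace hl) _ => _ [y <- ->].
by rewrite /mkset /bracket_defect !iota_b; exact: model_pi_rel.
Qed.

Definition model_z a v : model := model_in v ^+ p - model_in (pp a v).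

(** The same Jacobson terms occur in the $p$-map of a sum and in the $p$-th power of a sum, and
    cancel in the difference. *)
Lemma model_z_semilinear a r v w : eps a a = 1 -> gr a v -> gr a w ->
  model_z a (r *: v + w) = r ^+ p *: model_z a v + model_z a w.
Proof.
move=> aa av aw; have gs := grading_sub (lie_grading hg) a.
have arv : gr a (r *: v) by apply: (subspaceZ gs).
rewrite /model_z (pmapD hpp aa arv aw) [model_in (r *: v + w)](linear_mapD model_in_linear).
rewrite (jacobson_hom hp heps hg model_in_linear model_in_bracket aa arv aw).
rewrite !(linear_mapD model_in_linear) (pmapZ hpp _ aa av) !(linear_mapZ model_in_linear).
rewrite pzexprZn scalerBr; move: (_ ^+ p) (_ ^+ p) => x y.
by lin_eq F model; ring.
Qed.

(* Both sides are p-semilinear in [v]. *)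
Lemma model_z_dual a (phi : g -> F) (z : model) : eps a a = 1 -> is_dual gr a phi ->
  (forall x, dg x = a -> model_z a (b x) = phi (b x) ^+ p *: z) ->
  forall v, gr a v -> model_z a v = phi v ^+ p *: z.
Proof.
move=> aa dual zb v av; have gs := grading_sub (lie_grading hg) a.
have charF : [pchar F].-nat p by rewrite pnatE ?(pcharf_prime hp).
suff: [set v | gr a v /\ model_z a v = phi v ^+ p *: z] v by case.
move: (b_span av) => {av}; move: v; apply: lspan_min => [|_ [x xa ->]]; last first.
  by split; [rewrite -xa; exact: b_hom | exact: zb].
have zero_p : (0 : F) ^+ p = 0 by rewrite expr0n -leqn0 leqNgt p_gt0.
split=> [|r v w [av vE] [aw wE]].
  have g0 := subspace0 gs; split=> //.
  have phi0 : phi 0 = 0.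
    by have := dual 1 0 0 g0 g0; rewrite scale1r addr0 mul1r => /eqP;
      rewrite -subr_eq0 opprD addNKr oppr_eq0 => /eqP.
  have := pmapZ hpp 0 aa g0; rewrite zero_p !scale0r => pp0.
  rewrite /model_z pp0 (linear_map0 model_in_linear) phi0 zero_p scale0r subr0.
  by rewrite -(scale0r (0 : model)) pzexprZn zero_p !scale0r.
split; first by apply: (subspaceD gs) => //; apply: (subspaceZ gs).
rewrite model_z_semilinear // vE wE dual // (exprDn_pchar _ _ charF) exprMn.
by rewrite scalerA scalerDl.
Qed.

Lemma model_pi_zpow a v : model_pi (zpow a v) = model_z a v.
Proof. by rewrite /zpow (linear_mapB pi_lin) (ahomX pi_hom). Qed.

Lemma model_z_functional a f v : eps a a = 1 -> chi a = PFunctional f -> gr a v ->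
  model_z a v = f v ^+ p *: (1 : model).
Proof.
move=> aa af av; have [dual _] := pchar_functional hg hchi aa af.
apply: (model_z_dual aa dual) av => x xa; have := model_pi_pow x; rewrite -xa in aa af *.
case: lpowP aa af => [->|f' xx fx f0|C y xx Cx _ _ _|C xx Cx _] aa.
- by move: aa => /eqP;
    rewrite eq_sym -subr_eq0 opprK -mulr2n (negPf (natF_neq0 hp _)) //; lia.
- rewrite fx => -[->];
    rewrite (linear_mapB pi_lin) (linear_mapZ pi_lin) model_pi_zpow (ahom1 pi_hom).
  by move=> /eqP; rewrite subr_eq0 => /eqP.
- by rewrite Cx.
- by rewrite Cx.
Qed.

Lemma model_z_xi a C : eps a a = 1 -> chi a = PClass C ->
  model_z a (xi a) ^+ zorder (a *+ p) = 1.
Proof.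
move=> aa Ca; have [y ya yxi] := b_xi aa Ca; have := model_pi_pow y.
have yy : is_xi y by apply/asboolP; rewrite ya; split=> //; exists C.
rewrite -ya in aa Ca yxi *; case: lpowP yy => // C' _ _ _ _.
rewrite (linear_mapB pi_lin) (ahomX pi_hom) model_pi_zpow (ahom1 pi_hom) yxi.
by move=> /eqP; rewrite subr_eq0 => /eqP.
Qed.

Lemma model_z_class a C v : eps a a = 1 -> chi a = PClass C -> gr a v ->
  model_z a v = c a v ^+ p *: model_z a (xi a).
Proof.
move=> aa Ca av; have [_ [_ dual cxi] _] := pchar_class hchi hxi aa Ca.
apply: (model_z_dual aa dual) av => x xa; have := model_pi_pow x;
  rewrite -xa in aa Ca cxi *.
case: lpowP aa Ca => [->|f' xx fx f0|C' y xx Cx _ yx yxi|C' xx Cx xE] aa.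
- by move: aa => /eqP;
    rewrite eq_sym -subr_eq0 opprK -mulr2n (negPf (natF_neq0 hp _)) //; lia.
- by rewrite fx.
- rewrite yx yxi (linear_mapB pi_lin) (linear_mapZ pi_lin) !model_pi_zpow => _.
  by move=> /eqP; rewrite subr_eq0 => /eqP.
- by rewrite xE cxi expr1n scale1r.
Qed.

(** For another representative [u] the element at [u.1] is $c(u_1)^p$ times the one at $\xi$, and
    $c(u_1)^s=1$ by the equivalence of pairs. *)
Lemma model_in_pchar : satisfies_pchar p eps gr pp chi model_in.
Proof.
move=> a aa; split=> [f af x ax|C u Ca Cu]; first exact: (model_z_functional aa af ax).
have [_ _ /(_ u Cu) [[au _ _] [c1 c2 c3 c4]]] := pchar_class hchi hxi aa Ca.
rewrite -!/(model_z _ _) /= in c1 c2 c3 c4 *.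
split=> [|x ax].
  rewrite -/(model_z a u.1) (model_z_class aa Ca au) pzexprZn (model_z_xi aa Ca).
  by rewrite -exprM mulnC exprM c3 expr1n scale1r.
rewrite -!/(model_z _ _) (model_z_class aa Ca ax) (model_z_class aa Ca au).
by rewrite scalerA -exprMn (c1 x ax) mulrC.
Qed.

Definition irr_span : set A := lspan [set w
  | exists2 t, irreducible word lrule t & w = word t].

Let nf := nf hA lt_wf lrule.

(** [nf] fixes irreducible words and kills the ideal, so the two meet only in 0. *)
Lemma model_irr_free x : irr_span x -> model_pi x = 0 -> x = 0.
Proof.
move=> irr_x x0; have nfx : nf x = x.
  move: x irr_x {x0}; apply: lspan_min.
    exact: (equalizer_subspace (nf_linear hA lt_wf lrule) (fun _ _ _ => erefl)).
  by move=> _ [t irr_t ->]; apply: nf_irr.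
rewrite -nfx; apply: (nf_ideal hA lt_wf lrule_lt lrule_ambiguities).
rewrite -[x]subr0; apply/quot_pi_eq; rewrite [LHS]x0.
by rewrite -[RHS]/(model_pi 0) (linear_map0 pi_lin).
Qed.

Lemma model_irr_span m : exists2 x, irr_span x & m = model_pi x.
Proof.
have [x ->] := quot_pi_surj m; exists (nf x).
  move: x; apply: (free_on_span hA (preim_subspace (nf_linear hA lt_wf lrule)
    (lspan_subspace _))) => t.
  apply: (nf_span hA lt_wf lrule_lt lrule_ambiguities) => [|s irr_s].
    exact: lspan_subspace.
  by apply: lspan_incl; exists s.
apply/quot_pi_eq; exact: (nf_mod hA lt_wf lrule_lt lrule_ambiguities).
Qed.

(** Each rule is an instance at basis letters of a defining relation; the square of an odd letter
    comes from its bracket with itself, divided by 2. *)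
Lemma model_lift (U : pzAlgType F) (s : g -> U) :
  linear s ->
  (forall a a' v w, gr a v -> gr a' w ->
     s (br v w) = s v * s w - eps a a' *: (s w * s v)) ->
  satisfies_pchar p eps gr pp chi s ->
  exists2 h : model -> U, is_alg_hom h & forall v, h (model_in v) = s v.
Proof.
move=> sl sbr schi; have [h hh hE] := free_lift hA (fun x => s (b x)).
have hl := ahom_lin hh; have hi v : h (iota v) = s v.
  move: (b_gen v); move: v;
    apply: lspan_min (equalizer_subspace _ sl) _ => [k v w|_ [x ->]].
    by rewrite iota_lin hl.
  by rewrite /mkset iota_b hE big_seq1.
have h_rel x y : h (rel x y) = 0.
  rewrite /rel /rel_swap /tw_comm /lbr -(iota_b x) -(iota_b y) (ahom_bracket hh) !hi.
  by rewrite (sbr _ _ _ _ (b_hom x) (b_hom y)) subrr.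
have h_pow x : h (lpow x) = 0.
  have two : 2%:R != 0 :> F by apply: (natF_neq0 hp); lia.
  have := sbr _ _ _ _ (b_hom x) (b_hom x).
  case: lpowP => [xx|f xx fx _|C y xx Cx _ yx yxi|C xx Cx xE] sxx.
  - rewrite -[L x]iota_b (linear_mapB hl) (linear_mapZ hl) (ahomX hh) !hi sxx xx scaleN1r
      opprK.
    by rewrite -mulr2n -scaler_nat scalerA mulVf // scale1r expr2 subrr.
  - rewrite (ahom_ppow hh) !hi; have [/(_ f fx _ (b_hom x)) -> _] := schi _ xx.
    by rewrite subrr.
  - rewrite (ahom_ppow_sub hh) !hi yx yxi.
    have [_ /(_ C _ Cx (hxi xx Cx)) [_ /(_ _ (b_hom x)) -> /=]] := schi _ xx.
    by rewrite subrr.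
  - rewrite (ahom_ppow_ppow hh) !hi xE.
    have [_ /(_ C _ Cx (hxi xx Cx)) [/= -> _]] := schi _ xx.
    by rewrite subrr.
have [|k hk kE] := @quot_lift _ _ _ (rule_rel word lrule) _ hh.
  move=> _ [t [r [tr ->]]]; case: tr => [[x [y [_ _ ->]]]|[x [_ ->]]]; rewrite subKr.
    exact: h_rel.
  exact: h_pow.
by exists k => // v; rewrite [LHS]kE hi.
Qed.

(** * Homogeneity of the rules and directness of the grading *)

Definition wdeg (t : seq X) : G := \sum_(x <- t) dg x.

Definition homog a : set A := lspan [set w | exists2 t, wdeg t = a & w = word t].

Lemma homogM a a' x y : homog a x -> homog a' y -> homog (a + a') (x * y).
Proof.
move=> ax ay; move: x ax.
apply: lspan_min (preim_subspace (mul_linear_r y) (lspan_subspace _)) _ => _ [s <- ->].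
move: y ay.
apply: lspan_min (preim_subspace (mul_linear_l _) (lspan_subspace _)) _ => _ [t <- ->].
rewrite /mkset -(free_on_cat hA); apply: lspan_incl; exists (s ++ t) => //.
by rewrite /wdeg big_cat.
Qed.

Lemma homog1 : homog 0 1.
Proof. by apply: lspan_incl; exists [::]; rewrite /wdeg ?big_nil // (free_on_nil hA). Qed.

Lemma homogX a n x : homog a x -> homog (a *+ n) (x ^+ n).
Proof.
move=> ax; elim: n => [|n IHn]; first by rewrite expr0 mulr0n; exact: homog1.
by rewrite exprS mulrS; apply: homogM.
Qed.

Lemma homog_iota a v : gr a v -> homog a (iota v).
Proof.
move=> /b_span; move: v; apply: lspan_min (preim_subspace iota_lin (lspan_subspace _)) _.
move=> _ [x xa ->]; rewrite /mkset iota_b; apply: lspan_incl; exists [:: x] => //.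
by rewrite /wdeg big_seq1.
Qed.

Lemma homog_zpow a v : eps a a = 1 -> gr a v -> homog (a *+ p) (zpow a v).
Proof.
move=> aa av; apply: (subspaceB (lspan_subspace _)); first by apply: homogX;
  apply: homog_iota.
exact: homog_iota (pmap_graded hpp aa av).
Qed.

Lemma homog_rel x y : homog (dg x + dg y) (rel x y).
Proof.
have [hx hy] := (homog_iota (b_hom x), homog_iota (b_hom y)); rewrite !iota_b in hx hy.
apply: (subspaceB (lspan_subspace _)).
  apply: (subspaceB (lspan_subspace _)); first exact: homogM.
  by apply: (subspaceZ (lspan_subspace _)); rewrite addrC; apply: homogM.
exact: homog_iota (lie_graded hg (b_hom x) (b_hom y)).
Qed.

(** A constant has degree 0, which is the degree of the leading power when the exponent kills
    [dg x]; otherwise its coefficient is 0. *)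
Lemma homog_lpow x : homog (dg x *+ lexp_bound x) (lpow x).
Proof.
have hs a := lspan_subspace [set w | exists2 t, wdeg t = a & w = word t].
case: lpowP => [xx|f xx fx f0|C y xx Cx _ yx yxi|C xx Cx xE].
- apply: (subspaceB (hs _)); first by apply: homogX; rewrite -[L x]iota_b;
    exact: homog_iota.
  apply: (subspaceZ (hs _)); rewrite mulr2n.
  exact: homog_iota (lie_graded hg (b_hom x) (b_hom x)).
- apply: (subspaceB (hs _)); first exact: homog_zpow.
  have [px|px] := pselect (dg x *+ p = 0).
    by rewrite px; apply: (subspaceZ (hs _)); exact: homog1.
  by rewrite f0 // expr0n -leqn0 leqNgt p_gt0 scale0r; exact: subspace0.
- apply: (subspaceB (hs _)); first exact: homog_zpow.
  by apply: (subspaceZ (hs _)); rewrite -yx; apply: homog_zpow (b_hom y); rewrite yx.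
- apply: (subspaceB (hs _)); first by rewrite mulrnA; apply: homogX; apply: homog_zpow.
  by rewrite (pchar_class_torsion hchi hxi xx Cx); exact: homog1.
Qed.

Definition proj (d : G) : A -> A := wlin hA (fun t => if wdeg t == d then word t else 0).

Lemma proj_linear d : linear (proj d). Proof. exact: wlin_linear. Qed.

Lemma proj_homog d a x : homog a x -> proj d x = if a == d then x else 0.
Proof.
move: x; apply: lspan_min => [|_ [t <- ->]]; last by rewrite /mkset /proj wlin_word.
case: (a == d); last exact: (ker_subspace (proj_linear d)).
exact: (equalizer_subspace (proj_linear d) (fun _ _ _ => erefl)).
Qed.

Lemma proj_word_mul d u x v :
  proj d (word u * x * word v) = word u * proj (d - wdeg u - wdeg v) x * word v.
Proof.
move: x; apply: (linear_eq_free hA) => [k x y|k x y|t].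
- by rewrite mul_linear_lr proj_linear.
- by rewrite proj_linear mul_linear_lr.
rewrite -!(free_on_cat hA) /proj !wlin_word -catA /wdeg !big_cat /=.
rewrite -/(wdeg u) -/(wdeg t) -/(wdeg v).
have -> : (wdeg t == d - wdeg u - wdeg v) = (wdeg u + (wdeg t + wdeg v) == d).
  by rewrite eq_sym !subr_eq eq_sym addrC.
case: ifP => _; first by rewrite !(free_on_cat hA) mulrA.
by rewrite mulr0 mul0r.
Qed.

(** The generators are homogeneous, and projecting a product with words on both sides means
    projecting the middle factor to a shifted degree. *)
Lemma ideal_proj d x : x \in ideal_gen (rule_rel word lrule) ->
  proj d x \in ideal_gen (rule_rel word lrule).
Proof.
set I := ideal_gen _; have hI := ideal_gen_subspace (rule_rel word lrule).
move=> /ideal_genP /(_ [set x | forall d, proj d x \in I]) Ix; move: d; apply: Ix;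
  last first.
  move=> _ [s [r [sr ->]]] d.
  have [a ha] : exists a, homog a (word s - r).
    case: sr => [[y [z [_ _ ->]]]|[y [_ ->]]]; rewrite subKr.
      by eexists; exact: homog_rel.
    by eexists; exact: homog_lpow.
  rewrite (proj_homog d ha); case: ifP => _; last exact: rpred0.
  by apply: mem_ideal_gen; exists s, r.
split=> [d|y z hy hz d|a y a' hy].
- by rewrite (linear_map0 (proj_linear d)); exact: rpred0.
- by rewrite (linear_mapB (proj_linear d)); apply: rpredB.
rewrite /mkset => d.
refine (free_on_span hA (W := fun a => proj d (a * y * a') \in I) _ _ a) => [|u].
  exact: (preim_subspace (mul_linear_r y) (preim_subspace (mul_linear_r a')
    (preim_subspace (proj_linear d) hI))).
refine (free_on_span hA (W := fun b => proj d (word u * y * b) \in I) _ _ a') => [|v].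
  exact: (preim_subspace (mul_linear_l (word u * y)) (preim_subspace (proj_linear d) hI)).
by rewrite proj_word_mul; exact: ideal_genM.
Qed.

Lemma model_direct (s : seq G) (h : G -> A) : uniq s -> (forall a, homog a (h a)) ->
  \sum_(a <- s) model_pi (h a) = 0 -> forall a, a \in s -> model_pi (h a) = 0.
Proof.
have piI x : model_pi x = 0 <-> x \in ideal_gen (rule_rel word lrule).
  by rewrite -{1}(linear_map0 pi_lin) -{2}[x]subr0; exact: quot_pi_eq.
move=> us hh; rewrite -(linear_map_sum pi_lin) => /piI sI a a_s; apply/piI.
have := ideal_proj a sI; rewrite (linear_map_sum (proj_linear a)).
rewrite (bigD1_seq a) //= (proj_homog a (hh a)) eqxx big1 ?addr0 // => d da.
by rewrite (proj_homog a (hh d)) (negPf da).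
Qed.

(** * Transfer from the model to the reduced enveloping algebra *)

Local Notation u := (@red_uea F p G eps g gr br pp chi).
Local Notation inu := (@red_uea_in F p G eps g gr br pp chi).
Local Notation gru := (@red_uea_gr F p G eps g gr br pp chi).

(** [Psi \o Phi] fixes the generators, hence is the identity. The resulting injectivity of [Phi]
    transfers directness and independence from the model. *)
Lemma red_uea_model : exists (Phi : u -> model) (Psi : model -> u),
  [/\ is_alg_hom Phi, is_alg_hom Psi, forall v, Phi (inu v) = model_in v,
      forall v, Psi (model_in v) = inu v & cancel Phi Psi].
Proof.
have [Phi hPhi PhiE] := red_uea_lift model_in_linear model_in_bracket model_in_pchar.
have [Psi hPsi PsiE] := model_lift (red_uea_in_linear p eps gr br pp chi)
  (@red_uea_in_bracket F p G eps g gr br pp chi) (@red_uea_in_pchar F p G eps g gr br pp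
    chi).
exists Phi, Psi; split=> // w.
apply: (red_uea_hom_eq (alg_hom_comp hPhi hPsi) (k := id)) => [|v]; first by split.
by rewrite /= PhiE PsiE.
Qed.

Let grus := @red_uea_gr_subspace F p G eps g gr br pp chi.

Lemma red_uea_grading : is_grading gru.
Proof.
have [Phi [Psi [hPhi _ PhiE _ PhiK]]] := red_uea_model.
have hl := ahom_lin hPhi; split=> [a|w|s x us xs sx a a_s].
- exact: grus.
- pose W w := exists l : seq (G * u),
    (forall q, q \in l -> gru q.1 q.2) /\ w = \sum_(q <- l) q.2.
  have [l [lh ->]] : W w.
    move: w; apply: red_uea_ind => [|s].
      split; first by exists [::]; rewrite big_nil.
      move=> k x y [l [lh ->]] [l' [lh' ->]].
      exists ([seq (q.1, k *: q.2) | q <- l] ++ l'); split.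
        move=> q; rewrite mem_cat => /orP[/mapP[q' q'l ->]|/lh' //] /=.
        by apply: (subspaceZ (grus _)); exact: (lh q').
      by rewrite big_cat big_map /= scaler_sumr.
    elim: s => [|v s [l [lh lE]]].
      exists [:: (0, 1)]; rewrite big_nil big_seq1; split=> // q /[!inE] /eqP ->.
      exact: red_uea_gr1.
    (* A product of generators is expanded into homogeneous terms one factor at a time. *)
    have [t [y [yh vE]]] := grading_sum (lie_grading hg) v.
    exists [seq (a + q.1, inu (y a) * q.2) | a <- t, q <- l]; split.
      move=> _ /allpairsP[[a q] /= [_ ql ->]] /=.
      by apply: red_uea_grM; [exact: red_uea_gr_in | exact: lh].
    rewrite big_cons lE vE (linear_map_sum (@red_uea_in_linear F p G eps g gr br pp chi)).
    rewrite big_allpairs_dep mulr_suml; apply: eq_bigr => a _.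
    by rewrite mulr_sumr.
  exists (undup (map fst l)), (fun a => \sum_(q <- l | q.1 == a) q.2); split.
    move=> a; rewrite big_seq_cond; apply: (subspace_sum (grus _)).
    by move=> q /andP[/lh qh /eqP <-].
  exact: sum_regroup.
(* An element of degree [d] has a homogeneous representative in the free algebra, where the degree
   projections are available. *)
have homogP d w : gru d w -> exists2 h, homog d h & Phi w = model_pi h.
  rewrite red_uea_grE; move: w; apply: lspan_min => [|_ [l [lh <- ->]]].
    split; first by exists 0;
      [exact: (subspace0 (lspan_subspace _)) | rewrite !linear_map0].
    move=> k y z [h1 hh1 E1] [h2 hh2 E2]; exists (k *: h1 + h2).
      by apply: (subspaceD (lspan_subspace _)) => //; apply: (subspaceZ (lspan_subspace _)).
    by rewrite hl pi_lin E1 E2.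
  exists (\prod_(v <- l) iota v.2); last first.
    rewrite (ahom_prod hPhi) (ahom_prod pi_hom); apply: eq_bigr => v _; exact: PhiE.
  elim: l lh => [|v l IHl] lh; first by rewrite !big_nil; exact: homog1.
  rewrite !big_cons; apply: homogM; first by apply: homog_iota; apply: lh; rewrite mem_head.
  by apply: IHl => q ql; apply: lh; rewrite inE ql orbT.
have [|h hE] := @choice G A (fun a h => homog a h /\ Phi (x a) = model_pi h).
  by move=> d; have [h] := homogP d _ (xs d); exists h.
have hh d : homog d (h d) by case: (hE d).
have x_h d : Phi (x d) = model_pi (h d) by case: (hE d).
apply: (can_inj PhiK); rewrite x_h (linear_map0 hl).
apply: (model_direct us hh) a_s; have := congr1 Phi sx.
rewrite (linear_map_sum hl) (linear_map0 hl).
by under eq_bigr do rewrite x_h.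
Qed.

Theorem red_uea_is_reduced : is_reduced_uea p eps gr br pp chi gru inu.
Proof.
split.
- split; [exact: red_uea_grading | exact: red_uea_gr1 | exact: red_uea_grM].
- split; [exact: red_uea_in_linear | exact: red_uea_gr_in | exact: red_uea_in_bracket].
- exact: red_uea_in_pchar.
move=> B grB k hB hk kchi.
have [h hh hE] := red_uea_lift (lie_hom_linear hk) (lie_hom_bracket hk) kchi.
have gB := graded_alg_grading hB.
exists h; split; first split; [split|by apply/funext => v; exact: hE|].
- exact: ahom_lin hh.
- exact: ahomM hh.
- exact: ahom1 hh.
- move=> a w; rewrite red_uea_grE; move: w.
  apply: lspan_min => [|_ [l [lh <- ->]]].
    exact: (preim_subspace (ahom_lin hh) (grading_sub gB a)).
  rewrite /mkset (ahom_prod hh); under eq_bigr do rewrite hE.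
  elim: l lh => [|v l IHl] lh; first by rewrite !big_nil; exact: graded_alg_one hB.
  rewrite !big_cons; apply: (graded_alg_mul hB).
    by apply: (lie_hom_graded hk); apply: lh; rewrite mem_head.
  by apply: IHl => q ql; apply: lh; rewrite inE ql orbT.
move=> h' [[h'l h'M h'1 _] h'E]; apply/funext; apply: red_uea_hom_eq hh _ _ => // v.
by rewrite hE -h'E.
Qed.

Lemma model_pi_word (Phi : u -> model) t : is_alg_hom Phi ->
  (forall v, Phi (inu v) = model_in v) ->
    model_pi (word t) = Phi (\prod_(x <- t) inu (b x)).
Proof.
move=> hPhi PhiE; rewrite (ahom_prod hPhi).
elim: t => [|x t IHt]; first by rewrite big_nil (free_on_nil hA) (ahom1 pi_hom).
rewrite big_cons -IHt PhiE /model_in iota_b -(ahomM pi_hom) -(free_on_cat hA) //.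
Qed.

Lemma red_uea_irr_free (K : eqType) (wd : K -> seq X) (s : seq K) (k : K -> F) :
  injective wd -> uniq s -> (forall i, i \in s -> irreducible word lrule (wd i)) ->
  \sum_(i <- s) k i *: \prod_(x <- wd i) inu (b x) = 0 -> forall i, i \in s -> k i = 0.
Proof.
have [Phi [Psi [hPhi _ PhiE _ _]]] := red_uea_model.
move=> wd_inj us irr_s /(congr1 Phi); have hl := ahom_lin hPhi.
rewrite (linear_map0 hl) (linear_map_sum hl).
under eq_bigr => t _ do rewrite (linear_mapZ hl) -model_pi_word // -(linear_mapZ pi_lin).
rewrite -(linear_map_sum pi_lin) => s0 t ts.
have /model_irr_free /(_ s0) : irr_span (\sum_(i <- s) k i *: word (wd i)).
  apply: (subspace_sum_seq (lspan_subspace _)) => i si.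
  apply: (subspaceZ (lspan_subspace _)); apply: lspan_incl.
  by exists (wd i) => //; exact: irr_s.
(* The functional reading off the coefficient of the word [wd t]. *)
pose d := wlin hA (fun t' => if t' == wd t then 1 else 0 : F^o).
have dl : linear d by exact: wlin_linear.
have dw t' : d (word t') = if t' == wd t then 1 else 0 by exact: wlin_word.
move=> /(congr1 d); rewrite (linear_map0 dl) (linear_map_sum dl) (bigD1_seq t) //=.
rewrite big1 ?addr0 => [|i it].
  by rewrite (linear_mapZ dl) dw eqxx /GRing.scale /= mulr1.
by rewrite (linear_mapZ dl) dw (inj_eq wd_inj) (negPf it) scaler0.
Qed.

Lemma red_uea_irr_span w :
  lspan [set w | exists2 t, irreducible word lrule t & w = \prod_(x <- t) inu (b x)] w.
Proof.
have [Phi [Psi [hPhi hPsi PhiE _ PhiK]]] := red_uea_model.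
have [x irr_x wE] := model_irr_span (Phi w); rewrite -(PhiK w) wE {w wE}.
have hl : linear (fun x => Psi (model_pi x)).
  by move=> r y z; rewrite pi_lin (ahom_lin hPsi).
move: x irr_x; apply: lspan_min (preim_subspace hl (lspan_subspace _)) _ => _ [t irr_t ->].
by rewrite /mkset (model_pi_word t hPhi PhiE) PhiK; apply: lspan_incl; exists t.
Qed.

End LetterRelations.

(** * Irreducible words and PBW monomials *)

Section SortedWords.
Variables (X : eqType) (ltX : rel X).
Hypothesis ltX_asym : forall x y, ltX x y -> ~~ ltX y x.
Hypothesis ltX_trans : transitive ltX.
Hypothesis ltX_total : forall x y, x != y -> ltX x y || ltX y x.
Implicit Types (s t u v : seq X) (x y : X).

Definition leX x y := ~~ ltX y x.

Lemma leX_eqVlt x y : leX x y = (x == y) || ltX x y.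
Proof.
rewrite /leX; have [->|ne] := eqVneq x y; first by rewrite (ltX_irr ltX_asym).
by apply/idP/idP => [nyx|/ltX_asym //]; have := ltX_total ne; rewrite (negPf nyx) orbF.
Qed.

Lemma leX_refl : reflexive leX.
Proof. by move=> x; rewrite leX_eqVlt eqxx. Qed.

Lemma leX_trans : transitive leX.
Proof.
move=> y x z; rewrite !leX_eqVlt => /orP[/eqP->//|ltxy] /orP[/eqP<-|ltyz].
  by rewrite ltxy orbT.
by rewrite (ltX_trans ltxy ltyz) orbT.
Qed.

Lemma leX_antisym : antisymmetric leX.
Proof.
move=> x y; rewrite /leX => /andP[nyx nxy]; apply/eqP; apply: contraT => /ltX_total.
by rewrite (negPf nyx) (negPf nxy).
Qed.

Lemma unsorted_descent t : ~~ sorted leX t ->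
  exists u x y v, t = u ++ [:: x; y] ++ v /\ ltX y x.
Proof.
case: t => //= x t; elim: t x => //= y t IHt x; rewrite negb_and => /orP[|/IHt].
  by rewrite negbK => ltyx; exists [::], x, y, t.
by move=> [u [x' [y' [v [-> lt']]]]]; exists (x :: u), x', y', v.
Qed.

(** The letters below [x], the copies of [x] and the letters above [x] concatenate to a sorted word
    with the same letters, which must be [t]. *)
Lemma sorted_nseq_split x t : sorted leX t ->
  exists u v, t = u ++ nseq (count_mem x t) x ++ v.
Proof.
move=> st; exists (filter (ltX^~ x) t), (filter (ltX x) t).
apply: (sorted_eq leX_trans leX_antisym) => //.
  move: st; rewrite !(sorted_pairwise leX_trans) => pt.
  rewrite !pairwise_cat !pairwise_filter // !andbT andTb; apply/and3P; split.
  - apply/allrelP => y z; rewrite mem_filter => /andP[ltyx _].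
    rewrite mem_cat mem_nseq mem_filter leX_eqVlt => /orP[/andP[_ /eqP ->]|/andP[ltxz _]].
      by rewrite ltyx orbT.
    by rewrite (ltX_trans ltyx ltxz) orbT.
  - apply/allrelP => y z; rewrite mem_nseq mem_filter leX_eqVlt.
    by move=> /andP[_ /eqP ->] /andP[-> _]; rewrite orbT.
  - elim: (count_mem x t) => //= n ->; rewrite andbT; apply/allP => y.
    by rewrite mem_nseq => /andP[_ /eqP ->]; exact: leX_refl.
apply/permP => P; rewrite !count_cat count_nseq {st}.
elim: t => [|y t IHt] /=; first by rewrite muln0.
rewrite {}IHt; have [->|ne] := eqVneq y x.
  by rewrite (ltX_irr ltX_asym) /=; lia.
by case/orP: (ltX_total ne) => lt; rewrite lt (negPf (ltX_asym lt)) /=; lia.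
Qed.

(** An adjacent descent is a reducible swap; in a sorted word equal letters are adjacent, so too
    many occurrences of a letter contain its power. *)
Lemma irreducible_sorted (F : fieldType) (A : pzAlgType F) (word : seq X -> A)
  ep br mexp D t :
  (forall x, (1 < mexp x)%N) ->
  irreducible word (rule word ltX ep br mexp D) t <->
  sorted leX t /\ forall x, (count_mem x t < mexp x)%N.
Proof.
move=> mexp_gt1; split=> [irr_t|[st ct] [a [u [s [r [v [sr tE _]]]]]]].
  have st : sorted leX t.
    apply: contra_notT irr_t => /unsorted_descent[u [x [y [v [-> ltyx]]]]].
    set r := word [:: x; y] - rel_swap word ep br x y.
    by exists (word u * r * word v), u, [:: x; y], r, v; split=> //; left; exists x, y.
  split=> // x; rewrite ltnNge; apply: contra_notN irr_t => le_x.
  have [u [v tE]] := sorted_nseq_split x st.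
  set k := mexp x in le_x *; set r := word (nseq k x) - D x.
  exists (word u * r * word (nseq (count_mem x t - k) x ++ v)), u, (nseq k x), r.
  exists (nseq (count_mem x t - k) x ++ v); split=> //; first by right; exists x.
  by rewrite {1}tE; congr (_ ++ _); rewrite catA -nseqD subnKC.
case: sr tE => [[x [y [ltyx -> _]]]|[x [-> _]]] tE.
  move: st; rewrite tE (sorted_pairwise leX_trans) !pairwise_cat.
  by rewrite /= /leX ltyx !andbF.
have := ct x; rewrite tE !count_cat count_nseq /= eqxx mul1n; lia.
Qed.

End SortedWords.

Section Blocks.
Variable K : eqType.

Definition blocks (n : K -> nat) (s : seq K) : seq K := flatten [seq nseq (n k) k | k <- s].

Lemma count_blocks n s k : uniq s ->
  count_mem k (blocks n s) = (if k \in s then n k else 0)%N.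
Proof.
elim: s => //= x s IHs /andP[xs us];
  rewrite /blocks /= count_cat count_nseq inE -/(blocks n s) IHs //=.
by rewrite eq_sym; case: eqP => [->|_]; rewrite ?(negPf xs) ?mul1n ?addn0 ?mul0n.
Qed.

Lemma mem_blocks n s k : k \in blocks n s -> k \in s.
Proof. by move=> /flattenP[l /mapP[x xs ->]]; rewrite mem_nseq => /andP[_ /eqP ->]. Qed.

Lemma pairwise_blocks (r : rel K) n s : reflexive r -> pairwise r s ->
  pairwise r (blocks n s).
Proof.
move=> rr; elim: s => //= x s IHs /andP[/allP xs ps].
rewrite /blocks /= pairwise_cat -/(blocks n s) IHs // andbT; apply/andP; split.
  apply/allrelP => y z; rewrite mem_nseq => /andP[_ /eqP ->] /mem_blocks.
  exact: xs.
by elim: (n x) => //= m ->; rewrite andbT; apply/allP => y;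
  rewrite mem_nseq => /andP[_ /eqP ->].
Qed.

Lemma prod_blocks (R : pzRingType) (h : K -> R) n s :
  \prod_(k <- blocks n s) h k = \prod_(k <- s) h k ^+ n k.
Proof.
elim: s => [|x s IHs]; first by rewrite !big_nil.
rewrite big_cons /blocks /= big_cat -/(blocks n s) IHs; congr (_ * _).
by elim: (n x) => [|m IHm]; rewrite ?big_nil ?expr0 //= big_cons IHm exprS.
Qed.

End Blocks.

Section SignParts.
Variables (F : fieldType) (G : zmodType) (eps : G -> G -> F).
Variables (V : lmodType F) (gr : G -> set V) (hgr : is_grading gr).
Let gs a : is_subspace (gr a) := grading_sub hgr a.

Lemma sign_part_homog e v : sign_part eps gr e v -> exists (s : seq G) (x : G -> V),
  [/\ uniq s, forall a, gr a (x a), forall a, a \in s ->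
    eps a a = e & v = \sum_(a <- s) x a].
Proof.
pose W v := exists l : seq (G * V),
  (forall q, q \in l -> gr q.1 q.2 /\ eps q.1 q.1 = e) /\ v = \sum_(q <- l) q.2.
move=> ve; have [l [lh ->]] : W v.
  move: v ve; apply: lspan_min => [|v [a aa av]]; last first.
    by exists [:: (a, v)]; rewrite big_seq1; split=> // q /[!inE] /eqP ->.
  split; first by exists [::]; rewrite big_nil.
  move=> r x y [l [lh ->]] [l' [lh' ->]].
  exists ([seq (q.1, r *: q.2) | q <- l] ++ l'); split.
    move=> q; rewrite mem_cat => /orP[/mapP[q' /lh[h1 h2] ->]|/lh' //].
    by split=> //=; apply: (subspaceZ (gs _)).
  by rewrite big_cat big_map scaler_sumr.
rewrite sum_regroup; exists (undup (map fst l)), (fun a => \sum_(q <- l | q.1 == a) q.2).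
split=> // [|a|a]; first exact: undup_uniq.
  rewrite big_seq_cond; apply: (subspace_sum (gs _)) => q /andP[/lh[qh _] /eqP <-] //.
by rewrite mem_undup => /mapP[q /lh[_ qe] ->].
Qed.

(** The two homogeneous expansions of [v] have no degree in common, so their difference is a
    vanishing sum with distinct degrees. *)
Lemma sign_part_disjoint e e' v : e <> e' ->
  sign_part eps gr e v -> sign_part eps gr e' v -> v = 0.
Proof.
move=> ee' /sign_part_homog[s [x [us xh se vE]]] /sign_part_homog[s' [x' [us' xh' se'
  vE']]].
have dis a : a \in s' -> a \notin s.
  by move=> /se' ae'; apply/negP => /se ae; apply: ee'; rewrite -ae -ae'.
pose y a := if a \in s then x a else - x' a.
have y0 : \sum_(a <- s ++ s') y a = 0.
  rewrite big_cat /= -[RHS](subrr v) {1}vE vE' -sumrN; congr (_ + _).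
    by apply: eq_big_seq => a a_s; rewrite /y a_s.
  by apply: eq_big_seq => a a_s; rewrite /y (negPf (dis a a_s)).
rewrite vE big_seq big1 // => a a_s.
have yh d : gr d (y d) by rewrite /y; case: ifP => _ //; apply: (subspaceN (gs d)).
have := grading_direct hgr _ yh y0 _ (a := a); rewrite {1}/y a_s; apply.
  rewrite cat_uniq us us' andbT; apply/hasPn => d; exact: dis.
by rewrite mem_cat a_s.
Qed.

Lemma homog_deg_unique a a' v : gr a v -> gr a' v -> v <> 0 -> a = a'.
Proof.
move=> av av' v0; apply/eqP; apply: contra_notT v0 => aa'.
pose y d := if d == a then v else if d == a' then - v else 0.
have yh d : gr d (y d).
  rewrite /y; case: eqP => [->//|_]; case: eqP => [->|_]; last exact: (subspace0 (gs d)).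
  exact: (subspaceN (gs _)).
have := grading_direct hgr (s := [:: a; a']) _ yh _ (a := a).
rewrite {2}/y eqxx; apply; rewrite ?mem_head //= ?inE ?aa' //.
by rewrite !big_cons big_nil /y eqxx eq_sym (negPf aa') eqxx addr0 subrr.
Qed.

End SignParts.

Section SumOrder.
Variables (dI dM : Order.disp_t) (I : orderType dI) (M : orderType dM).

Definition sum_lt (x y : M + I) : bool :=
  match x, y with
  | inl j, inl j' => (j < j')%O
  | inl _, inr _ => true
  | inr _, inl _ => false
  | inr i, inr i' => (i < i')%O
  end.

Lemma sum_lt_asym x y : sum_lt x y -> ~~ sum_lt y x.
Proof. by case: x y => [j|i] [j'|i'] //=; rewrite -leNgt => /ltW. Qed.

Lemma sum_lt_trans : transitive sum_lt.
Proof. by move=> [j|i] [j'|i'] [j''|i''] //=; exact: lt_trans. Qed.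

Lemma sum_lt_total x y : x != y -> sum_lt x y || sum_lt y x.
Proof. by case: x y => [j|i] [j'|i'] //= ne; rewrite -neq_lt;
  apply: contraNneq ne => ->. Qed.

Local Notation index := ({fsfun M -> bool with false} * {fsfun I -> nat with 0%N})%type.

Definition index_word (dn : index) : seq (M + I) :=
  map inl (blocks (fun j => dn.1 j : nat) (sort <=%O (finsupp dn.1))) ++
  map inr (blocks dn.2 (sort <=%O (finsupp dn.2))).

Lemma count_index_word_l dn j : count_mem (inl j) (index_word dn) = dn.1 j.
Proof.
rewrite /index_word count_cat !count_map [X in (_ + X)%N](_ : _ = 0%N); last first.
  by rewrite (eq_count (a2 := pred0)) ?count_pred0.
rewrite (eq_count (a2 := pred1 j)) // addn0 count_blocks ?sort_uniq ?fset_uniq //.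
by rewrite mem_sort; case: finsuppP.
Qed.

Lemma count_index_word_r dn i : count_mem (inr i) (index_word dn) = dn.2 i.
Proof.
rewrite /index_word count_cat !count_map [X in (X + _)%N](_ : _ = 0%N); last first.
  by rewrite (eq_count (a2 := pred0)) ?count_pred0.
rewrite (eq_count (a2 := pred1 i)) // add0n count_blocks ?sort_uniq ?fset_uniq //.
by rewrite mem_sort; case: finsuppP.
Qed.

Lemma index_word_inj : injective index_word.
Proof.
move=> [d n] [d' n'] E; congr (_, _); apply/fsfunP => k.
  have := count_index_word_l (d, n) k; rewrite E count_index_word_l /=.
  by case: (d k); case: (d' k).
by have := count_index_word_r (d, n) k; rewrite E count_index_word_r.
Qed.

Lemma index_word_sorted dn : sorted (leX sum_lt) (index_word dn).
Proof.
rewrite (sorted_pairwise (leX_trans sum_lt_asym sum_lt_trans sum_lt_total)).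
rewrite pairwise_cat !pairwise_map; apply/and3P; split.
- by apply/allrelP => x y /mapP[j _ ->] /mapP[i _ ->].
- apply: (pairwise_blocks (fun=> _)) => [j|]; first by rewrite /relpre /leX /= ltxx.
  rewrite -(sorted_pairwise (leT := relpre inl (leX sum_lt))); last first.
    by move=> x y z; rewrite /= /leX /= -!leNgt; exact: le_trans.
  have := sort_le_sorted (finsupp dn.1); apply: sub_sorted => x y.
  by rewrite /= /leX /= -leNgt.
- apply: (pairwise_blocks (fun=> _)) => [j|]; first by rewrite /relpre /leX /= ltxx.
  rewrite -(sorted_pairwise (leT := relpre inr (leX sum_lt))); last first.
    by move=> x y z; rewrite /= /leX /= -!leNgt; exact: le_trans.
  have := sort_le_sorted (finsupp dn.2); apply: sub_sorted => x y.
  by rewrite /= /leX /= -leNgt.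
Qed.

(** The exponents are the multiplicities of the letters; a boolean suffices for an odd letter, which
    occurs at most once. *)
Lemma index_word_surj t : sorted (leX sum_lt) t ->
  (forall j, (count_mem (inl j) t < 2)%N) -> exists dn, index_word dn = t.
Proof.
move=> st t2.
pose sl := pmap (fun x : M + I => if x is inl j then Some j else None) t.
pose sr := pmap (fun x : M + I => if x is inr i then Some i else None) t.
have slP j : (j \in sl) = (inl j \in t).
  rewrite mem_pmap; apply/mapP/idP => [[[j'|i] xt // [->]] //|jt]; by exists (inl j).
have srP i : (i \in sr) = (inr i \in t).
  rewrite mem_pmap; apply/mapP/idP => [[[j|i'] xt // [->]] //|it]; by exists (inr i).
pose d : {fsfun M -> bool with false} := [fsfun j in seq_fset tt sl => inl j \in t].
pose n : {fsfun I -> nat with 0%N} := [fsfun i in seq_fset tt sr => count_mem (inr i) t].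
have dE j : d j = (inl j \in t).
  by rewrite fsfunE seq_fsetE slP; case: ifP.
have nE i : n i = count_mem (inr i) t.
  by rewrite fsfunE seq_fsetE srP; case: ifP => // /count_memPn.
exists (d, n); apply: (sorted_eq (leX_trans sum_lt_asym sum_lt_trans sum_lt_total)
  (leX_antisym sum_lt_total) (index_word_sorted _) st).
apply/allP => -[j|i] _ /=.
  rewrite count_index_word_l dE; have := t2 j; rewrite -has_pred1 has_count.
  by case: (count_mem _ t) => [|[|]].
by rewrite count_index_word_r nE.
Qed.

Lemma index_word_prod (R : pzRingType) (s : M + I -> R) dn :
  \prod_(x <- index_word dn) s x =
  \prod_(j <- sort <=%O (finsupp dn.1)) s (inl j) ^+ dn.1 j *
  \prod_(i <- sort <=%O (finsupp dn.2)) s (inr i) ^+ dn.2 i.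
Proof. by rewrite /index_word big_cat !big_map !prod_blocks. Qed.

End SumOrder.

Section SignBasis.
Variables (F : fieldType) (G : zmodType) (eps : G -> G -> F) (heps : bicharacter eps).
Hypothesis sign_neq : (-1 : F) <> 1.
Variables (g : lmodType F) (gr : G -> set g) (hgr : is_grading gr).
Variables (I M : choiceType) (e : I -> g) (degI : I -> G) (f : M -> g) (degM : M -> G).
Hypothesis he_hom : forall i, gr (degI i) (e i).
Hypothesis he : is_basis [set: I] e (sign_part eps gr 1).
Hypothesis hf_hom : forall j, gr (degM j) (f j).
Hypothesis hf : is_basis [set: M] f (sign_part eps gr (-1)).

Definition sum_vec (x : M + I) : g := match x with inl j => f j | inr i => e i end.
Definition sum_deg (x : M + I) : G := match x with inl j => degM j | inr i => degI i end.

Lemma sum_vec_hom x : gr (sum_deg x) (sum_vec x).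
Proof. by case: x. Qed.

Lemma basis_neq0 (K : choiceType) (b : K -> g) (W : set g) :
  is_basis [set: K] b W -> forall k, b k <> 0.
Proof.
move=> [_ free _] k bk; have := free [:: k] isT (fun _ _ => Logic.I) (fun=> 1).
rewrite big_seq1 scale1r => /(_ bk k (mem_head _ _)) /eqP; by rewrite oner_eq0.
Qed.

Lemma sign_deg s a v : sign_part eps gr s v -> gr a v -> v <> 0 ->
  s = 1 \/ s = -1 -> eps a a = s.
Proof.
move=> vs av v0 ss; have va : sign_part eps gr (eps a a) v by apply: lspan_incl; exists a.
by apply: contra_notP v0 => ne; apply: (sign_part_disjoint hgr ne va vs).
Qed.

Lemma degI_even i : eps (degI i) (degI i) = 1.
Proof.
have [ei _ _] := he; apply: (sign_deg (ei i Logic.I) (he_hom i)); last by left.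
exact: (basis_neq0 he).
Qed.

Lemma degM_odd j : eps (degM j) (degM j) = -1.
Proof.
have [fj _ _] := hf; apply: (sign_deg (fj j Logic.I) (hf_hom j)); last by right.
exact: (basis_neq0 hf).
Qed.

(** Since [eps a a] is always 1 or -1, the two sign parts span [g], and they meet in 0 because the
    signs differ. *)
Lemma sum_basis : is_basis [set: M + I] sum_vec [set: g].
Proof.
have [eW efree espan] := he; have [fW ffree fspan] := hf.
split=> // [s us _ a s0|v _].
- pose sl := pmap (fun x : M + I => if x is inl j then Some j else None) s.
  pose sr := pmap (fun x : M + I => if x is inr i then Some i else None) s.
  have sumE : \sum_(x <- s) a x *: sum_vec x =
      \sum_(j <- sl) a (inl j) *: f j + \sum_(i <- sr) a (inr i) *: e i.
    rewrite /sl /sr; elim: s {us s0 sl sr} => [|[j|i] s IHs].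
    + by rewrite !big_nil addr0.
    + by rewrite /= !big_cons IHs addrA.
    + by rewrite /= !big_cons IHs addrCA.
  have sps := lspan_subspace;
    have vl : sign_part eps gr (-1) (\sum_(j <- sl) a (inl j) *: f j).
    by apply: (subspace_sum (sps _ _ _)) => j _; apply: (subspaceZ (sps _ _ _)); exact: fW.
  have vr : sign_part eps gr 1 (\sum_(i <- sr) a (inr i) *: e i).
    by apply: (subspace_sum (sps _ _ _)) => j _; apply: (subspaceZ (sps _ _ _)); exact: eW.
  move: s0; rewrite sumE => /eqP; rewrite addr_eq0 => /eqP lr.
  have l0 : \sum_(j <- sl) a (inl j) *: f j = 0.
    apply: (sign_part_disjoint hgr sign_neq vl); rewrite lr.
    exact: (subspaceN (sps _ _ _)).
  have r0 : \sum_(i <- sr) a (inr i) *: e i = 0.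
    by apply/eqP; rewrite -oppr_eq0 -lr l0.
  have usl : uniq sl by apply: pmap_uniq us => -[j|i] //.
  have usr : uniq sr by apply: pmap_uniq us => -[j|i] //.
  move=> [j|i] xs.
    apply: (ffree sl usl _ (fun j => a (inl j)) l0) => //.
    by rewrite mem_pmap; apply/mapP; exists (inl j).
  apply: (efree sr usr _ (fun i => a (inr i)) r0) => //.
  by rewrite mem_pmap; apply/mapP; exists (inr i).
- have [s [a [_ ->]]] : exists (s : seq (M + I)%type) (a : M + I -> F),
      (forall k, k \in s -> [set: M + I] k) /\ v = \sum_(k <- s) a k *: sum_vec k.
    apply: lspan_comb; have [s [x [xh ->]]] := grading_sum hgr v.
    apply: (subspace_sum (lspan_subspace _)) => d _.
    have [dd|dd] := bichar_sign heps d.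
      have [t [a [_ ->]]] := espan (x d) (lspan_incl (ex_intro2 _ _ d dd (xh d))).
      apply: (subspace_sum (lspan_subspace _)) => i _;
        apply: (subspaceZ (lspan_subspace _)).
      by apply: lspan_incl; exists (inr i).
    have [t [a [_ ->]]] := fspan (x d) (lspan_incl (ex_intro2 _ _ d dd (xh d))).
    apply: (subspace_sum (lspan_subspace _)) => i _; apply: (subspaceZ (lspan_subspace _)).
    by apply: lspan_incl; exists (inl i).
  by exists s, a.
Qed.

End SignBasis.

Theorem theorem2p13
  (F : closedFieldType) (p : nat) (hp : p \in [pchar F]) (hp3 : (3 < p)%N)
  (G : zmodType) (eps : G -> G -> F) (heps : bicharacter eps)
  (g : lmodType F) (gr : G -> set g) (br : g -> g -> g)
  (hg : is_lie_color eps gr br)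
  (pp : G -> g -> g) (hpp : is_restricted p eps gr br pp)
  (chi : G -> pchar_value g) (hchi : is_pcharacter p eps gr chi)
  (xi : G -> g) (c : G -> g -> F)
  (hxi : forall a C, eps a a = 1 -> chi a = PClass C -> C (xi a, c a))
  (dI dM : Order.disp_t) (I : orderType dI) (M : orderType dM)
  (e : I -> g) (degI : I -> G)
  (he_hom : forall i, gr (degI i) (e i))
  (he : is_basis [set: I] e (sign_part eps gr 1))
  (he_xi : forall a C, eps a a = 1 -> chi a = PClass C -> exists i, e i = xi a)
  (f : M -> g) (degM : M -> G)
  (hf_hom : forall j, gr (degM j) (f j))
  (hf : is_basis [set: M] f (sign_part eps gr (-1)))
  (J : set I)
  (hJ : J = [set i | exists a C,
               [/\ eps a a = 1, chi a = PClass C & e i = xi a]]) :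
  is_reduced_uea p eps gr br pp chi
    (@red_uea_gr F p G eps g gr br pp chi) (@red_uea_in F p G eps g gr br pp chi)
  /\
  is_basis
    [set dn : {fsfun M -> bool with false} * {fsfun I -> nat with 0%N} |
       forall i, (~ J i -> (dn.2 i < p)%N) /\
                 (J i -> (dn.2 i < p * zorder (degI i *+ p))%N)]
    (pbw_monomial (@red_uea_in F p G eps g gr br pp chi) e f)
    [set: @red_uea F p G eps g gr br pp chi].
Proof.
have G_grading := lie_grading hg.
have two : (-1 : F) <> 1.
  move=> /eqP; rewrite eq_sym -subr_eq0 opprK -mulr2n.
  by rewrite (negPf (natF_neq0 hp _)) //; lia.
set b := sum_vec e f; set dg := sum_deg degI degM.
have b_hom : forall x, gr (dg x) (b x) := sum_vec_hom he_hom hf_hom.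
have hb : is_basis [set: M + I] b [set: g] := sum_basis heps two G_grading he hf.
have b_span := basis_homog hb G_grading b_hom.
have b_xi a C : eps a a = 1 -> chi a = PClass C -> exists2 x, dg x = a & b x = xi a.
  move=> aa Ca; have [i ei] := he_xi _ _ aa Ca; exists (inr i) => //=.
  have [_ [axi _ _] _] := pchar_class hchi hxi aa Ca.
  (* The basis vector equal to [xi a] is nonzero and so has only one degree, namely [a]. *)
  by apply: (homog_deg_unique G_grading (he_hom i) _ (basis_neq0 he (k := i))); rewrite ei.
have b_gen v : lspan [set w | exists x, w = b x] v.
  have [_ _ /(_ v Logic.I) [s [a [_ ->]]]] := hb.
  apply: (subspace_sum (lspan_subspace _)) => x _; apply: (subspaceZ (lspan_subspace _)).
  by apply: lspan_incl; exists x.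
have hA := free_alg_free F (M + I)%type.
have [iota iota_lin iota_b] := basis_linear hb (fun x => word F [:: x]).
have lt_asym := @sum_lt_asym _ _ I M; have lt_total := @sum_lt_total _ _ I M.
have lt_tr := @sum_lt_trans _ _ I M.
split.
  exact: (red_uea_is_reduced hp hp3 heps hg hpp hchi hxi b_hom b_span b_xi hA iota_lin
    iota_b
    lt_total b_gen).
have free := red_uea_irr_free hp hp3 heps hg hpp hchi hxi b_hom b_span b_xi hA iota_lin
  iota_b
    lt_asym lt_tr lt_total b_gen.
have span := red_uea_irr_span hp hp3 heps hg hpp hchi hxi b_hom b_span b_xi hA iota_lin
  iota_b
    lt_asym lt_tr lt_total b_gen.
have bound_gt1 := lexp_bound_gt1 hp hp3 heps hg pp hchi hxi b_hom b_xi iota_b.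
set bound := lexp_bound p eps chi xi b dg in bound_gt1.
have bound_l j : bound (inl j) = 2%N.
  rewrite /bound /lexp_bound /= (degM_odd G_grading hf_hom hf).
  by case: eqP.
have bound_r i : bound (inr i) = if `[< J i >] then (p * zorder (degI i *+ p))%N else p.
  rewrite /bound /lexp_bound /= (degI_even G_grading he_hom he) eqxx.
  (* Membership in [J] refers to some degree [a]; as [e i] is nonzero, that degree is [degI i], the
     one tested by [is_xi]. *)
  congr (if _ then _ else _); apply: asbool_equiv_eq; rewrite hJ /=; split.
    by move=> [ii [C Ci ei]]; exists (degI i), C.
  move=> [a [C [aa Ca ei]]].
  have [_ [axi _ _] _] := pchar_class hchi hxi aa Ca; rewrite /= -ei in axi.
  have ai := homog_deg_unique G_grading axi (he_hom i) (basis_neq0 he (k := i)).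
  by rewrite -ai; split=> //; exists C.
set D := [set dn | _]; set inu := @red_uea_in F p G eps g gr br pp chi in free span *.
(* The exponent bounds of the theorem are the multiplicity bounds of irreducible words; the bound 2
   on odd letters holds for booleans automatically. *)
have D_irr dn : D dn <->
    irreducible (word F (X := (M + I)%type)) (lrule p eps br pp chi xi c b dg (word F (X
      := (M + I)%type)) iota
      (@sum_lt _ _ I M)) (index_word dn).
  rewrite (irreducible_sorted lt_asym lt_tr lt_total) //; split=> [Ddn|[_ bnd] i].
    split=> [|[j|i]]; first exact: index_word_sorted.
      by rewrite -/(bound (inl j)) count_index_word_l bound_l; case: (dn.1 j).
    rewrite -/(bound (inr i)) count_index_word_r bound_r; have [D1 D2] := Ddn i.
    by case: asboolP.
  by have := bnd (inr i); rewrite -/(bound (inr i)) count_index_word_r bound_r;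
    case: asboolP.
have pbwE dn : pbw_monomial inu e f dn = \prod_(x <- index_word dn) inu (b x).
  by rewrite index_word_prod.
split=> [//|s us sD a s0 k ks|w _].
  apply: (free _ _ s a (@index_word_inj _ _ I M) us _ _ k ks).
    by move=> dn /sD /D_irr.
  by rewrite -[RHS]s0; apply: eq_bigr => dn _; rewrite pbwE.
apply: lspan_comb; have := span w; move: w.
apply: lspan_min (lspan_subspace _) _ => _ [t irr_t ->].
move: (irr_t); rewrite (irreducible_sorted lt_asym lt_tr lt_total) // => -[st t_bnd].
have [j|dn tE] := index_word_surj st; first by have := t_bnd (inl j);
  rewrite -/(bound (inl j)) bound_l.
apply: lspan_incl; exists dn; first by apply/D_irr; rewrite tE.
by rewrite pbwE tE.
Qed.
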